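(* Consider the infinite-horizon optimal control problem given by the data $A,U,f,f_0$, with set of admissible pairs $\Omega$ and objective functional $J$, as described in the context (including the standing conditions (i)–(iii) there). Suppose that there is an $\alpha\in\mathbb R$ such that $\widetilde\Omega_\alpha:=\{(x,u)\in\Omega\mid J(x,u)\ge\alpha\}\neq\varnothing$ and such that all of the following conditions hold: (iv) for every $t\in\mathbb R_+$ the function $f(t,\cdot,\cdot)$ is continuous on $\mathcal U(t):=\{(\chi,\upsilon)\in\mathbb R^n\times\mathbb R^m\mid (t,\chi,\upsilon)\in\mathcal U\}$; (v) for every $t\in\mathbb R_+$ the function $f_0(t,\cdot,\cdot)$ is upper semicontinuous on $\mathcal U(t)$; (vi) the sets $A(t)$ and $\mathcal U(t)$ are closed for every $t\in\mathbb R_+$; (vii) the set $\{x(0)\mid (x,u)\in\widetilde\Omega_\alpha\}$ is bounded; (viii) for every $T>0$, the set of functions $F^T_\alpha:=\{f(\cdot,x(\cdot),u(\cdot))|_{[0,T]}\mid (x,u)\in\widetilde\Omega_\alpha\}$ is uniformly integrable on $[0,T]$, i.e. $\inf_{c>0}\sup_{g\in F^T_\alpha}\int_{C^T_{g,c}}|g(t)|\,dt=0$, where $C^T_{g,c}=\{t\in[0,T]\mid |g(t)|>c\}$; (ix) for all $(t,\chi)\in\mathcal A$ the set $Q(t,\chi):=\{(z^0,z)\in\mathbb R\times\mathbb R^n\mid \text{there is } \upsilon\in U(t,\chi)\text{ with } z^0\le f_0(t,\chi,\upsilon),\ z=f(t,\chi,\upsilon)\}$ is convex; (x) for all $(t,\chi)\in\mathcal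 A$, $Q(t,\chi)=\bigcap_{\delta>0}\mathrm{cl}\bigl(\bigcup_{\chi'\in A(t)\cap B_\delta(\chi)}Q(t,\chi')\bigr)$, where $B_\delta(\chi)$ is the ball of radius $\delta$ centered at $\chi$ and $\mathrm{cl}$ denotes closure; (xi$'$) for every $T>0$, the set of functions $F_0^{T,+}:=\{f_0^+(\cdot,x(\cdot),u(\cdot))|_{[0,T]}\mid (x,u)\in\Omega\}$ is uniformly integrable on $[0,T]$, i.e. $\inf_{c>0}\sup_{g\in F_0^{T,+}}\int_{\{t\in[0,T]\,:\,|g(t)|>c\}}|g(t)|\,dt=0$; and at least one of the following three conditions holds: (xii) $\displaystyle\limsup_{T\to+\infty}\ \sup_{T'>T}\ \sup_{(x,u)\in\Omega}\int_T^{T'}f_0(t,x(t),u(t))\,dt\le 0$; (xii$'$) there is a continuous function $\omega\colon\mathbb R_+^2\to\mathbb R_+$ such that $\omega(T,T')\to0$ as $T,T'\to\infty$ and $\sup_{(x,u)\in\Omega}\int_T^{T'}f_0(t,x(t),u(t))\,dt\le\omega(T,T')$ for all $T,T'$ with $T'>T\ge0$; (xii$''$) there is a continuous function $\widetilde\omega\colon\mathbb R_+\to\mathbb R_+$ such that $\widetilde\omega(T)\to0$ as $T\to\infty$ and $\sup_{T'>T}\sup_{(x,u)\in\Omega}\int_T^{T'}f_0(t,x(t),u(t))\,dt\le\widetilde\omega(T)$ for all $T\ge0$. Then there exists an admissible pair $(x_*,u_* )\in\Omega$ such that $J(x_*,u_* )=\sup_{(x,u)\in\Omega}J(x,u)$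.
   Context: Notation: $\mathbb R_+=[0,+\infty)$; $m,n\in\mathbb N$ are fixed; $g^{\pm}:=\max\{\pm g,0\}$ (in particular $f_0^+=\max\{f_0,0\}$). $\mathcal L$ is the $\sigma$-algebra of Lebesgue measurable subsets of $\mathbb R_+$, $\mathcal B^k$ is the Borel $\sigma$-algebra of $\mathbb R^k$, and $\mathcal L\times\mathcal B^k$ is the $\sigma$-algebra on $\mathbb R_+\times\mathbb R^k$ generated by products of sets in $\mathcal L$ and $\mathcal B^k$. A function is $(\mathcal L\times\mathcal B^k)$-measurable if preimages of Borel sets are $(\mathcal L\times\mathcal B^k)$-measurable. Standing conditions on the data: (i) $A\colon\mathbb R_+\rightrightarrows\mathbb R^n$ is a set-valued map whose graph $\mathcal A=\{(t,\chi)\mid t\in\mathbb R_+,\ \chi\in A(t)\}$ is $(\mathcal L\times\mathcal B^n)$-measurable; (ii) $U\colon\mathcal A\rightrightarrows\mathbb R^m$ is a set-valued map whose graph $\mathcal U=\{(t,\chi,\upsilon)\mid (t,\chi)\in\mathcal A,\ \upsilon\in U(t,\chi)\}$ is $(\mathcal L\times\mathcal B^{n+m})$-measurable; (iii) the functions $f\colon\mathcal U\to\mathbb R^n$ and $f_0\colon\mathcal U\to\mathbb R\cup\{-\infty\}$ are $(\mathcal L\times\mathcal B^{n+m})$-measurable. The set $\Omega$ of admissible pairs consists of all pairs $(x,u)$ where $x\colon\mathbb R_+\to\mathbb R^n$ is locally absolutely continuous (absolutely continuous on each finite interval), $u\colon\mathbb R_+\to\mathbb R^m$ is Lebesgue measurable,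 and for a.e. $t\in\mathbb R_+$: $x(t)\in A(t)$, $u(t)\in U(t,x(t))$ and $\dot x(t)=f(t,x(t),u(t))$. Integrals of extended-real-valued functions are understood as $\int g\,dt=\int g^+\,dt-\int g^-\,dt$ with the convention $(+\infty)-(+\infty)=-\infty$. The objective functional, to be maximized over $\Omega$, is the improper integral $$J(x,u):=\lim_{T\to+\infty}\int_0^T f_0(t,x(t),u(t))\,dt,$$ provided that the limit exists (values in the extended real line). (Under (xi$'$) together with any of (xii), (xii$'$), (xii$''$), the limit exists for every $(x,u)\in\Omega$ and is either finite or $-\infty$.) *)

(* Defs.v *)
From HB Require Import structures.
From mathcomp Require Import all_boot all_order all_algebra.
From mathcomp Require Import all_classical all_reals all_analysis.
From mathcomp Require Import measurable_realfun.

Set Implicit Arguments.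
Unset Strict Implicit.
Unset Printing Implicit Defensive.

Import Order.TTheory GRing.Theory Num.Theory.
Import numFieldNormedType.Exports.

Local Open Scope classical_set_scope.
Local Open Scope ring_scope.

(* Conventions: objects living on the half-line R_+ are total functions on R  *)
(* all of whose properties are only required on R_+, and likewise f and f0    *)
(* are total functions constrained only on the graph of U. Since the Lebesgue *)
(* measure below is complete, values on null sets do not affect measurability *)
(* or integrals. A subset of R_+ * V is measurable for the trace of the       *)
(* product sigma-algebra iff it is measurable in R * V, R_+ being Lebesgue    *)
(* measurable. Row vectors carry the library's norm (the maximum norm).       *)

(* The real line equipped with the sigma-algebra of Lebesgue measurable sets. *)
Definition lebesgue_type (R : realType) : measurableType _ :=
  caratheodory_type (R := R) (T := ocitv_type R) ((wlength idfun)^*)%mu.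

Definition borel_type (R : realType) (V : normedModType R) : measurableType _ :=
  g_sigma_algebraType (@open V).

Definition leb (R : realType) : {measure set (lebesgue_type R) -> \bar R} :=
  @completed_lebesgue_measure R.

Section function_properties.
Context {R : realType}.

Definition abs_continuous_on (V : normedModType R) (a b : R) (x : R -> V) :=
  forall e, 0 < e -> exists2 d, 0 < d &
    forall (k : nat) (s r : 'I_k -> R),
      (forall i, a <= s i /\ s i <= r i /\ r i <= b) ->
      trivIset [set: 'I_k] (fun i => `]s i, r i[%classic) ->
      \sum_(i < k) (r i - s i) < d ->
      \sum_(i < k) `|x (r i) - x (s i)| < e.

Definition locally_abs_continuous (V : normedModType R) (x : R -> V) :=
  forall a b, 0 <= a -> a <= b -> abs_continuous_on a b x.

Definition upper_semicontinuous_on (X : topologicalType) (D : set X)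
    (g : X -> \bar R) :=
  lower_semicontinuous (fun p : subspace D => - g p)%E.

(* [nrm] is the norm in which the values of the family are measured: it is    *)
(* instantiated both at vector-valued and at extended-real-valued functions.  *)
Definition uniformly_integrable (V : Type) (nrm : V -> \bar R) (T : R)
    (F : set (R -> V)) : Prop :=
  (ereal_inf [set ereal_sup
      [set \int[leb R]_(t in [set t | `[0%R, T]%classic t /\ c%:E < nrm (g t)])
             nrm (g t) | g in F]
    | c in [set c : R | (0 < c)%R]] = 0)%E.

End function_properties.

Section control_problem.
Context {R : realType} {n m : nat}.

Local Notation process := ((R -> 'rV[R]_n) * (R -> 'rV[R]_m))%type.

Variables (A : R -> set 'rV[R]_n) (U : R -> 'rV[R]_n -> set 'rV[R]_m).

Definition graphA : set (R * 'rV[R]_n) :=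
  [set p | 0 <= p.1 /\ A p.1 p.2].

Definition graphU : set (R * ('rV[R]_n * 'rV[R]_m)) :=
  [set p | graphA (p.1, p.2.1) /\ U p.1 p.2.1 p.2.2].

Definition sliceU (t : R) : set ('rV[R]_n * 'rV[R]_m) :=
  [set q | graphU (t, q)].

Variables (f : R * ('rV[R]_n * 'rV[R]_m) -> 'rV[R]_n)
          (f0 : R * ('rV[R]_n * 'rV[R]_m) -> \bar R).

Local Notation LB V := (lebesgue_type R * borel_type V)%type.
Local Notation LBnm := (LB ('rV[R]_n * 'rV[R]_m)%type).

Definition standing_conditions : Prop :=
  [/\ measurable (graphA : set (LB 'rV[R]_n)),
      measurable (graphU : set LBnm),
      measurable_fun (graphU : set LBnm) (f : LBnm -> borel_type 'rV[R]_n),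
      measurable_fun (graphU : set LBnm) (f0 : LBnm -> \bar R) &
      forall p, graphU p -> f0 p != +oo%E].

Definition Omega : set process :=
  [set p | let: (x, u) := p in
    [/\ locally_abs_continuous x,
        measurable_fun (`[0, +oo[%classic : set (lebesgue_type R))
          (u : _ -> borel_type 'rV[R]_m) &
        {ae leb R, forall t : R, 0 <= t ->
          [/\ A t (x t), U t (x t) (u t) &
              is_derive t (1 : R) x (f (t, (x t, u t)))]}]].

Definition rhs (p : process) (t : R) : 'rV[R]_n := f (t, (p.1 t, p.2 t)).

Definition payoff_rate (p : process) (t : R) : \bar R :=
  f0 (t, (p.1 t, p.2 t)).

(* The library's [\int] is the difference of the integrals of the positive    *)
(* and negative parts, and its addition satisfies +oo - +oo = -oo.            *)
Definition payoff (T T' : R) (p : process) : \bar R :=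
  \int[leb R]_(t in `[T, T']%classic) payoff_rate p t.

Definition J_exists (p : process) : Prop :=
  cvg (payoff 0 T p @[T --> +oo]).

(* Meaningful only when [J_exists p]; [lim] returns an arbitrary value        *)
(* otherwise.                                                                 *)
Definition J (p : process) : \bar R := lim (payoff 0 T p @[T --> +oo]).

Definition Omega_ge (alpha : R) : set process :=
  [set p | [/\ Omega p, J_exists p & (alpha%:E <= J p)%E]].

Definition Q (t : R) (chi : 'rV[R]_n) : set (R^o * 'rV[R]_n) :=
  [set z | exists2 v, U t chi v &
    (z.1%:E <= f0 (t, (chi, v)))%E /\ z.2 = f (t, (chi, v))].

End control_problem.

(* Main.v *)
Require Import Defs.
From mathcomp Require Import all_boot all_order all_algebra.
From mathcomp Require Import all_classical all_reals all_analysis.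
From mathcomp Require Import ring lra zify measurable_realfun.

Set Implicit Arguments.
Unset Strict Implicit.
Unset Printing Implicit Defensive.

Import Order.TTheory GRing.Theory Num.Theory.
Import numFieldNormedType.Exports.

Local Open Scope classical_set_scope.
Local Open Scope ring_scope.

(* Take a maximizing sequence of admissible pairs. By uniform integrability the
   trajectories are locally bounded and equicontinuous, so a subsequence
   converges pointwise to some [y]. The velocities and the payoff rates, split
   into positive and negative parts, are handled by a lower closure argument:
   truncate at height M on the set where all parts are at most M, take convex
   combinations that converge almost everywhere (Mazur's lemma in L2), and let
   M tend to infinity. Uniform integrability of the velocities and of the
   positive parts of the rates prevents loss of mass there, while negative parts
   of the rates can only lose mass, which increases the payoff. The limits [h]
   and [g] satisfy [y = y 0 + primitive h], the integrals of [g] bound the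
   limiting payoffs from above, and [(g t, h t)] lies in [Q t (y t)] almost
   everywhere by convexity and the semicontinuity property of [Q]. Aumann's
   selection theorem produces a control realizing [h] with a payoff rate at
   least [g]; since the tails of the payoffs are asymptotically nonpositive
   uniformly over admissible pairs, this control is optimal. *)

(** * Lower closure *)

(** The negative parts of the rates are only bounded in L1, so the rates themselves need not have a
    weak limit. Truncations at a fixed height on sets of finite measure lie in L2, and there the
    parallelogram identity produces strong limits of convex combinations without any duality;
    midpoints are the only combinations it uses. One sequence of combinations has to serve every
    height, every component and every bounded piece of the half-line, since the pointwise membership
    in [Q] compares all of them at the same point. The mass removed by a truncation is tracked by a
    constant component: it records the share of the combination that survives, dividing by it
    restores a genuine convex combination, and it tends to 1 because the integrals of the components
    bound the measure of the removed set by a constant over M. In the selection theorem the obstacle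
    is that the set of points admitting a solution is a projection, with no measurability known
    beforehand. Its outer measure is controlled instead, until the branching is finite and the set
    of solvable points becomes a countable intersection of measurable sets. *)

Inductive midpoint_hull (V : Type) (mid : V -> V -> V) (S : set V) : V -> Prop :=
| midpoint_hull_base x of S x : midpoint_hull mid S x
| midpoint_hull_mid x y of midpoint_hull mid S x & midpoint_hull mid S y :
    midpoint_hull mid S (mid x y).

Lemma midpoint_hullS (V : Type) (mid : V -> V -> V) (S S' : set V) :
  S `<=` S' -> midpoint_hull mid S `<=` midpoint_hull mid S'.
Proof.
move=> SS' x; elim=> [y /SS'|y z _ ? _ ?]; first exact: midpoint_hull_base.
exact: midpoint_hull_mid.
Qed.

Lemma midpoint_hull_sub (V : Type) (mid : V -> V -> V) (S D : set V) :
  S `<=` D -> (forall x y, D x -> D y -> D (mid x y)) ->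
  midpoint_hull mid S `<=` D.
Proof. by move=> SD Dmid x; elim=> [y /SD //|y z _ Dy _ Dz]; exact: Dmid. Qed.

Section mazur.
Context {R : realType} {V : Type} (mid : V -> V -> V).
Variables (D : set V) (q : nat -> V -> R) (B : nat -> R) (v : nat -> V).

(** For a squared norm and the true midpoint this is the squared distance between x and y, by the
    parallelogram identity. *)
Definition defect a (x y : V) : R := 2 * q a x + 2 * q a y - 4 * q a (mid x y).

Hypotheses (Dv : forall k, D (v k)) (Dmid : forall x y, D x -> D y -> D (mid x y))
  (q_ge0 : forall a x, D x -> 0 <= q a x) (qB : forall a x, D x -> q a x <= B a)
  (defect_ge0 : forall a x y, D x -> D y -> 0 <= defect a x y).

Definition tail_hull j := midpoint_hull mid [set v k | k in [set k | (j <= k)%N]].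

Lemma tail_hullS i j : (i <= j)%N -> tail_hull j `<=` tail_hull i.
Proof.
by move=> ij; apply: midpoint_hullS => _ [k /= jk <-]; exists k => //=; exact: leq_trans jk.
Qed.

Lemma tail_hull_sub j : tail_hull j `<=` D.
Proof. by apply: midpoint_hull_sub => // _ [k _ <-]. Qed.

(* Minimise the weighted sum of the first [j] functionals over the hull of the
   [j]-th tail: these minima increase to a finite limit, so the parallelogram
   identity makes the near-minimisers Cauchy. *)
Lemma mazur : exists u : nat -> V, (forall j, tail_hull j (u j)) /\
  forall a e, 0 < e -> exists J, forall i j, (J <= i)%N -> (J <= j)%N ->
    defect a (u i) (u j) <= e.
Proof.
have B_ge0 a : 0 <= B a by apply: le_trans (q_ge0 a (Dv 0)) (qB a (Dv 0)).
(* Dividing by [1 + B a] keeps the a-th weighted functional below [2^-1 ^+ a.+1], so all weighted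
   sums stay below 1. *)
pose w a : R := 2^-1 ^+ a.+1 / (1 + B a).
have w_gt0 a : 0 < w a by rewrite divr_gt0 ?exprn_gt0 // ltr_wpDr.
pose Q j x := \sum_(a < j) w a * q a x.
have QS i j x : D x -> (i <= j)%N -> Q i x <= Q j x.
  move=> Dx ij; rewrite /Q -!(big_mkord predT (fun a => w a * q a x)).
  rewrite (@big_cat_nat _ _ _ i 0%N j) //= lerDl sumr_ge0 // => a _.
  by rewrite mulr_ge0 ?q_ge0 // ltW.
have Q_le1 j x : D x -> Q j x <= 1.
  move=> Dx; suff : Q j x <= 1 - 2^-1 ^+ j.
    by move=> /le_trans; apply; rewrite lerBlDr lerDl exprn_ge0.
  elim: j => [|j IH]; first by rewrite /Q big_ord0 expr0 subrr.
  rewrite /Q big_ord_recr /=.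
  have : w j * q j x <= 2^-1 ^+ j.+1.
    rewrite /w -mulrA ler_piMr ?exprn_ge0 // mulrC ler_pdivrMr ?mul1r; last first.
      by rewrite ltr_wpDr.
    by rewrite ler_wpDl // qB.
  by move=> /(lerD IH) /le_trans; apply; rewrite exprS; lra.
have Q_ge0 j x : D x -> 0 <= Q j x.
  by move=> Dx; apply: sumr_ge0 => a _; rewrite mulr_ge0 ?q_ge0 // ltW.
pose E j := Q j @` tail_hull j.
have vT j : tail_hull j (v j) by apply: midpoint_hull_base; exists j => /=.
have E0 j : E j !=set0 by exists (Q j (v j)), (v j).
have Einf j : has_inf (E j).
  split=> //; exists 0 => _ [x /tail_hull_sub Dx <-]; exact: Q_ge0.
pose A j := inf (E j).
have A_le j x : tail_hull j x -> A j <= Q j x.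
  by move=> Tx; apply: ge_inf; [exact: (Einf j).2|exists x].
have near_min j : exists x, tail_hull j x /\ Q j x < A j + j.+1%:R^-1.
  have [|_ [x Tx <-] Qx] := @inf_adherent _ (E j) j.+1%:R^-1 _ (Einf j).
    by rewrite invr_gt0.
  by exists x.
have [u uP] := choice near_min.
have A_nd : nondecreasing_seq A.
  move=> i j ij; apply: lb_le_inf => // _ [x Tx <-].
  apply: le_trans (A_le i x _) (QS _ _ _ (tail_hull_sub Tx) ij).
  exact: tail_hullS Tx.
have A_ub : has_ubound (range A).
  by exists 1 => _ [j _ <-]; apply: le_trans (A_le j _ (vT j)) (Q_le1 _ _ (Dv j)).
exists u; split=> [j|a e e0]; first by case: (uP j).
have /cvgrPdist_lt Acvg := nondecreasing_cvgn A_nd A_ub.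
have Asup j : A j <= sup (range A) by apply: ub_le_sup => //; exists j.
(* The coefficients 2, 2 and 4 in [defect] add up to 8, and each of them will multiply an error of
   this size. *)
have we : 0 < w a * e / 8 by have := mulr_gt0 (w_gt0 a) e0; lra.
have [N _ NA] := Acvg _ we.
have [N' _ NN'] := near_infty_natSinv_lt (PosNum we).
pose J := maxn a.+1 (maxn N N').
exists J => i j Ji Jj.
have NJ : (N <= J)%N by rewrite /J; lia.
have NJ' : (N' <= J)%N by rewrite /J; lia.
have QJ k : (J <= k)%N -> Q J (u k) <= sup (range A) + w a * e / 8.
  move=> Jk; have [Tk Qk] := uP k.
  apply: le_trans (QS _ _ _ (tail_hull_sub Tk) Jk) _.
  apply: le_trans (ltW Qk) _; apply: lerD => //.
  by apply/ltW/NN' => /=; exact: leq_trans Jk.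
have Tu k : (J <= k)%N -> tail_hull J (u k).
  by move=> Jk; have [Tk _] := uP k; exact: tail_hullS Tk.
have Tm : tail_hull J (mid (u i) (u j)) by apply: midpoint_hull_mid; exact: Tu.
have := A_le J _ Tm.
have : sup (range A) - A J < w a * e / 8.
  by have := NA _ NJ; rewrite ger0_norm // subr_ge0.
have : w a * defect a (u i) (u j) <=
    2 * Q J (u i) + 2 * Q J (u j) - 4 * Q J (mid (u i) (u j)).

  have -> : 2 * Q J (u i) + 2 * Q J (u j) - 4 * Q J (mid (u i) (u j)) =
      \sum_(b < J) w b * defect b (u i) (u j).
    rewrite /Q !mulr_sumr -sumrN -!big_split /=.
    by apply: eq_bigr => b _; rewrite /defect; ring.
  have aJ : (a < J)%N by rewrite /J; lia.
  rewrite (bigD1 (Ordinal aJ)) //= lerDl sumr_ge0 // => b _.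
  by rewrite mulr_ge0 ?(ltW (w_gt0 _)) // defect_ge0 //; apply: (@tail_hull_sub J); exact: Tu.
have := QJ i Ji; have := QJ j Jj => h1 h2 h3 h4 h5.
rewrite -(ler_pM2l (w_gt0 a)); lra.
Qed.

End mazur.

(** * Almost everywhere convergence from integral estimates *)

Section integration.
Context {d : measure_display} {T : measurableType d} {R : realType}.
Variable mu : {measure set T -> \bar R}.

(** With [s = 2^-1 ^+ p], the inequality |z| <= s + z^2 / s turns the bound on the squared
    increments into a geometric bound on their L1 norms. The sum of the absolute increments is then
    integrable, hence finite almost everywhere, and the sequence converges there as a telescoping
    series. *)
Lemma ae_cvgn_fast_L2 (E : set T) (f : nat -> T -> R) (N : nat) :
  measurable E -> (mu E < +oo)%E -> (forall p, measurable_fun E (f p)) ->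
  (forall p, (N <= p)%N ->
    (\int[mu]_(x in E) ((f p.+1 x - f p x) ^+ 2)%:E <= (8^-1 ^+ p)%:E)%E) ->
  {ae mu, forall x, E x -> cvgn (f ^~ x)}.
Proof.
move=> mE muE mf fast; pose g p x : R := `|f (p + N).+1 x - f (p + N)%N x|.
have mg p : measurable_fun E (EFin \o g p).
  apply/measurable_EFinP; apply: measurableT_comp => //.
  exact: measurable_funB.
pose c := fine (mu E) + 1.
have c_ge0 : 0 <= c by rewrite addr_ge0 // fine_ge0.
have int_g p : (\int[mu]_(x in E) (g p x)%:E <= (2 * c / (2 ^ (p + 1))%:R)%:E)%E.
  pose s : R := 2^-1 ^+ p; have s_gt0 : 0 < s by rewrite exprn_gt0.
  have msq : measurable_fun E (fun x => ((f (p + N).+1 x - f (p + N)%N x) ^+ 2)%:E).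
    by apply/measurable_EFinP; apply: measurable_funX; exact: measurable_funB.
  apply: (@le_trans _ _ (\int[mu]_(x in E)
      (s%:E + (s^-1)%:E * ((f (p + N).+1 x - f (p + N)%N x) ^+ 2)%:E))%E).
    apply: ge0_le_integral => //.
    - by move=> x _; rewrite lee_fin /g.
    - exact: mg.
    - by apply: emeasurable_funD => //; exact: emeasurable_funM.
    - move=> x _; rewrite -EFinM -EFinD lee_fin /g.
      set z := f _ x - _; rewrite -real_normK ?num_real //; set y := `|z|.
      rewrite -(ler_pM2l s_gt0) mulrDr mulrA divff ?gt_eqF // mul1r.
      have y0 : 0 <= y by rewrite /y.
      by nra.
  rewrite ge0_integralD //; last 3 first.
  - by move=> x _; rewrite lee_fin ltW.
  - by move=> x _; rewrite -EFinM lee_fin mulr_ge0 ?sqr_ge0 ?invr_ge0 ?ltW.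
  - exact: emeasurable_funM.
  rewrite ge0_integralZl_EFin //; last 2 first.
  - by move=> x _; rewrite lee_fin sqr_ge0.
  - by rewrite invr_ge0 ltW.
  rewrite [X in (X + _)%E](integral_cst mu mE s%:E).
  apply: (@le_trans _ _ (s%:E * mu E + (s^-1)%:E * (8^-1 ^+ (p + N))%:E)%E).
    apply: leeD => //; apply: lee_wpmul2l; first by rewrite lee_fin invr_ge0 ltW.
    by apply: fast; rewrite leq_addl.
  have -> : mu E = (fine (mu E))%:E by rewrite fineK // ge0_fin_numE.
  rewrite -!EFinM -EFinD lee_fin.
  have -> : 2 * c / (2 ^ (p + 1))%:R = s * c.
    by rewrite addn1 natrX exprS /s exprVn; field; rewrite expf_neq0.
  rewrite /c mulrDr lerD2l mulr1 exprD.
  have -> : 8^-1 ^+ p = s * s * s :> R.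
    by rewrite /s -!exprMn; congr (_ ^+ _); field.
  have -> : s^-1 * (s * s * s * 8^-1 ^+ N) = s * (s * 8^-1 ^+ N).
    by field; rewrite gt_eqF.
  rewrite ler_piMr ?(ltW s_gt0) //.
  by apply: mulr_ile1; rewrite ?exprn_ge0 // exprn_ile1 //; lra.
pose G x := (\sum_(0 <= p <oo) (g p x)%:E)%E.
have mG : measurable_fun E G.
  apply: (@ge0_emeasurable_sum _ _ _ E (fun p x => (g p x)%:E) xpredT) => [p x _ _|p _].
    by rewrite lee_fin /g.
  exact: mg.
have G_ge0 x : (0 <= G x)%E by apply: nneseries_ge0 => p _ _; rewrite lee_fin /g.
have iG : mu.-integrable E G.
  apply/integrableP; split => //.
  under eq_integral do rewrite gee0_abs //.
  rewrite integral_nneseries //; last by move=> p x _; rewrite lee_fin /g.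
  apply: (@le_lt_trans _ _ (\sum_(0 <= p <oo) (2 * c / (2 ^ (p + 1))%:R)%:E)%E).
    by apply: lee_nneseries => // p _ _; apply: integral_ge0 => x _; rewrite lee_fin /g.
  have := @cvg_geometric_eseries_half R (2 * c) 0%N.
  by move=> /(cvg_lim (@ereal_hausdorff R)) ->; rewrite ltry.
apply: filterS (integrable_ae mE iG) => x /[apply] Gx.
suff : cvgn [sequence f (n + N)%N x]_n.
  by move=> /cvg_ex[l fl]; apply/cvg_ex; exists l; rewrite -(cvg_shiftn N).
set h := [sequence _]_n.
suff : cvgn (series (telescope h)).
  move=> cv; rewrite (_ : h = fun n => h 0%N + series (telescope h) n).
    by apply: is_cvgD => //; exact: is_cvg_cst.
  by apply/funext => n; rewrite -eq_sum_telescope.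
apply: normed_cvg; change (cvgn (series (g ^~ x))); apply: nondecreasing_is_cvgn.
  by apply/nondecreasing_seqP => n; rewrite !seriesEnat /= big_nat_recr //= lerDl /g.
exists (fine (G x)) => _ [n _ <-].
rewrite -lee_fin fineK // seriesEnat -sumEFin.
by apply: nneseries_lim_ge => k _ _; rewrite lee_fin /g.
Qed.

Lemma cvgn_Rintegral_dominated (E : set T) (f_ : nat -> T -> R) (f g : T -> R) :
  measurable E -> (forall k, measurable_fun E (f_ k)) -> measurable_fun E f ->
  {ae mu, forall x, E x -> f_ ^~ x @ \oo --> f x} ->
  mu.-integrable E (EFin \o g) ->
  {ae mu, forall x k, E x -> `|f_ k x| <= g x} ->
  \int[mu]_(x in E) f_ k x @[k --> \oo] --> \int[mu]_(x in E) f x.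
Proof.
move=> mE mf_ mf cf ig le_g.
have mf_E k : measurable_fun E (EFin \o f_ k) by apply/measurable_EFinP.
have mfE : measurable_fun E (EFin \o f) by apply/measurable_EFinP.
have cfE : {ae mu, forall x, E x -> (EFin \o f_ k) x @[k --> \oo] --> (EFin \o f) x}.
  by apply: filterS cf => x /[apply] cfx; apply/fine_cvgP; split; [exact: nearW|].
have le_gE : {ae mu, forall x k, E x -> (`|(EFin \o f_ k) x| <= (EFin \o g) x)%E}.
  by apply: filterS le_g => x lex k Ex /=; rewrite lee_fin; exact: lex.
have [i_f _ cvi] := dominated_convergence mE mf_E mfE cfE ig le_gE.
apply: fine_cvg; rewrite fineK //.
exact: integrable_fin_num.
Qed.

End integration.

Section lower_closure_core.
Context {d : measure_display} {T : measurableType d} {R : realType}.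
Variable mu : {measure set T -> \bar R}.
Variables (Dl : nat -> set T) (J : finType) (v : nat -> J -> T -> R) (P : pred J)
  (C : nat -> R).
Hypotheses (mDl : forall l, measurable (Dl l)) (Dl_fin : forall l, (mu (Dl l) < +oo)%E)
  (mv : forall k i, measurable_fun setT (v k i)) (v_ge0 : forall k i x, 0 <= v k i x)
  (vC : forall l k i, (\int[mu]_(x in Dl l) (v k i x)%:E <= (C l)%:E)%E).

(** The cut is common to all components, so a truncated vector is either an actual value of the
    sequence or zero. Clipping each component separately would produce vectors unrelated to the
    constraint sets. *)
Definition below k (M : nat) : set T := [set x | forall i, v k i x <= M%:R].

(* [Some M] indexes the truncation at height [M], [None] the function itself. *)
Definition state := option nat -> J -> T -> R.

Definition trunc_state k : state := fun a i x =>
  if a is Some M then v k i x * \1_(below k M) x else v k i x.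

Definition mid_state (y z : state) : state := fun a i x => (y a i x + z a i x) / 2.

(** The properties of the truncations that survive midpoints, and which therefore hold on the whole
    hull. *)
Definition good_state (y : state) : Prop :=
  [/\ forall a i, measurable_fun setT (y a i),
      forall a i x, 0 <= y a i x,
      forall M i x, y (Some M) i x <= M%:R,
      forall M i x, y (Some M) i x <= y (Some M.+1) i x /\ y (Some M) i x <= y None i x &
      forall l i, (\int[mu]_(x in Dl l) (y None i x)%:E <= (C l)%:E)%E].

Lemma measurable_below k M : measurable (below k M).
Proof.
rewrite (_ : below k M = \bigcap_(i in [set: J]) [set x | v k i x <= M%:R]).
  apply: fin_bigcap_measurable; first exact: finite_finset.
  move=> i _; rewrite -[X in measurable X]setTI.
  rewrite (_ : [set x | _] = v k i @^-1` `]-oo, M%:R]%classic); first exact: mv.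
  by apply/seteqP; split=> x /=; rewrite in_itv.
by apply/seteqP; split=> x /= vx i => [_|]; exact: vx.
Qed.

Lemma good_trunc k : good_state (trunc_state k).
Proof.
split=> [[M|] i|[M|] i x|M i x|M i x|l i] /=.
- apply: measurable_funM => //; apply: measurable_indic; exact: measurable_below.
- exact: mv.
- by rewrite mulr_ge0 // indicE.
- exact: v_ge0.
- rewrite indicE; have [xb|_] := boolP (x \in below k M); last by rewrite mulr0.
  by rewrite mulr1; move: xb; rewrite inE.
- split; last by rewrite ler_piMr // indicE lern1 leq_b1.
  rewrite ler_wpM2l // !indicE ler_nat; have [|//] := boolP (x \in below k M).
  rewrite inE => xM; rewrite mem_set // => i'.
  by apply: le_trans (xM i') _; rewrite ler_nat.
- exact: vC.
Qed.

Lemma good_mid y z : good_state y -> good_state z -> good_state (mid_state y z).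
Proof.
move=> [my y0 yM yS yC] [mz z0 zM zS zC]; split=> [a i|a i x|M i x|M i x|l i].
- by apply: measurable_funM => //; exact: measurable_funD.
- by rewrite /mid_state divr_ge0 ?addr_ge0.
- by rewrite /mid_state; have := yM M i x; have := zM M i x; lra.
- rewrite /mid_state; have [] := yS M i x; have [] := zS M i x; split; lra.
- have mE (s : state) : good_state s -> measurable_fun (Dl l) (fun x => (s None i x)%:E).
    by case=> ms _ _ _ _; apply/measurable_EFinP; apply: measurable_funTS.
  under eq_integral do rewrite /mid_state mulrC EFinM EFinD.
  rewrite ge0_integralZl_EFin //; last 2 first.
  + by move=> x _; rewrite -EFinD lee_fin addr_ge0.
  + by apply: emeasurable_funD; exact: mE.
  rewrite ge0_integralD //; [|by move=> x _; rewrite lee_fin|exact: mE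
    |by move=> x _; rewrite lee_fin|exact: mE].
  apply: (@le_trans _ _ (2^-1%:E * ((C l)%:E + (C l)%:E))%E).
    by apply: lee_wpmul2l; [rewrite lee_fin; lra|apply: leeD].
  by rewrite -EFinD -EFinM lee_fin; lra.
Qed.

Lemma good_integrable y M i l E : good_state y -> measurable E -> E `<=` Dl l ->
  mu.-integrable E (EFin \o y (Some M) i).
Proof.
move=> [my y0 yM _ _] mE EDl; apply: measurable_bounded_integrable => //.
- by apply: le_lt_trans (Dl_fin l); apply: le_measure; rewrite ?inE.
- exact: measurable_funTS.
- exists M%:R; split; first exact: num_real.
  by move=> r Mr x _ /=; rewrite ger0_norm // (le_trans (yM _ _ _)) // ltW.
Qed.

Lemma bounded_integrable (f : T -> R) (K : R) l E : measurable E -> E `<=` Dl l ->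
  measurable_fun setT f -> (forall x, `|f x| <= K) -> mu.-integrable E (EFin \o f).
Proof.
move=> mE EDl mf fK; apply: measurable_bounded_integrable => //.
- by apply: le_lt_trans (Dl_fin l); apply: le_measure; rewrite ?inE.
- exact: measurable_funTS.
- exists K; split; first exact: num_real.
  by move=> r Kr x _ /=; apply: le_trans (fK x) (ltW Kr).
Qed.

(** Enumerating heights, components and pieces by one index lets a single application of [mazur]
    make all the truncations Cauchy along the same sequence. *)
Let code (a : nat) : option (nat * J * nat) := unpickle a.

Let sq_int (a : nat) (y : state) : R :=
  if code a is Some (M, i, l) then \int[mu]_(x in Dl l) (y (Some M) i x ^+ 2) else 0.

Let sq_integrable (f : T -> R) (K : R) l : measurable_fun setT f ->
  (forall x, `|f x| <= K) -> mu.-integrable (Dl l) (EFin \o (fun x => f x ^+ 2)).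
Proof.
move=> mf fK; apply: (@bounded_integrable _ (K ^+ 2) l) => //.
  exact: measurable_funX.
by move=> x; rewrite normrX lerXn2r ?nnegrE // (le_trans _ (fK x)).
Qed.

Let good_bound y M i x : good_state y -> `|y (Some M) i x| <= M%:R.
Proof. by case=> _ y0 yM _ _; rewrite ger0_norm. Qed.

Let sq_int_le (a : nat) y : good_state y -> sq_int a y <=
  if code a is Some (M, i, l) then M%:R ^+ 2 * fine (mu (Dl l)) else 0.
Proof.
move=> gy; rewrite /sq_int; case: (code a) => // -[[M i] l].
have [my y0 yM _ _] := gy.
rewrite -Rintegral_cst //; apply: le_Rintegral => //.
- apply: (@sq_integrable _ M%:R) => // x; exact: good_bound.
- apply: (@bounded_integrable _ (M%:R ^+ 2) l) => // x.
  by rewrite ger0_norm ?exprn_ge0.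
- by move=> x _; rewrite lerXn2r ?nnegrE.
Qed.

Let defectE a M i l y z : good_state y -> good_state z -> code a = Some (M, i, l) ->
  defect mid_state sq_int a y z =
  \int[mu]_(x in Dl l) ((y (Some M) i x - z (Some M) i x) ^+ 2).
Proof.
move=> gy gz ca; rewrite /defect /sq_int ca.
have sqi s : good_state s ->
    mu.-integrable (Dl l) (EFin \o (fun x => s (Some M) i x ^+ 2)).
  move=> gs; apply: (@sq_integrable _ M%:R); first by case: gs.
  by move=> x; exact: good_bound.
have i2 s k : good_state s ->
    mu.-integrable (Dl l) (EFin \o (fun x => k * s (Some M) i x ^+ 2)).
  by move=> gs; exact: (integrableZl (mDl l) k (sqi s gs)).
have gm := good_mid gy gz.
rewrite -!RintegralZl //; try exact: sqi.
rewrite -RintegralD //; try exact: i2.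
rewrite -RintegralB //; last 2 first.
- exact: (integrableD (mDl l) (i2 _ 2 gy) (i2 _ 2 gz)).
- exact: i2.
by apply: eq_Rintegral => x _; rewrite /mid_state; field.
Qed.

Lemma fast_hull : exists W : nat -> state,
  (forall p, tail_hull mid_state trunc_state p (W p)) /\
  forall M i l, {ae mu, forall x, Dl l x -> cvgn (fun p => W p (Some M) i x)}.
Proof.
have [||u [uT uC]] := @mazur R state mid_state good_state sq_int _ trunc_state
    good_trunc good_mid _ sq_int_le.
- move=> a y gy; rewrite /sq_int; case: (code a) => // -[[M i] l].
  by apply: Rintegral_ge0 => x _; exact: sqr_ge0.
- move=> a y z gy gz; case ca : (code a) => [[[M i] l]|].
    by rewrite (defectE gy gz ca); apply: Rintegral_ge0 => x _; exact: sqr_ge0.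
  by rewrite /defect /sq_int ca; lra.
have /choice[N NP] (ap : nat * nat) : exists N, forall i j, (N <= i)%N -> (N <= j)%N ->
    defect mid_state sq_int ap.1 (u i) (u j) <= 8^-1 ^+ ap.2.
  by apply: uC; rewrite exprn_gt0.
(* Diagonal extraction: from index p on, the functionals with code at most p have increments below
   [8^-1 ^+ p]. Summing the thresholds makes K monotone, and the extra p keeps the p-th term in the
   p-th tail hull. *)
pose K p := (\sum_(p' < p.+1) \sum_(a < p'.+1) N (a : nat, p' : nat) + p)%N.
have KS p : (K p <= K p.+1)%N by rewrite /K [in leqRHS]big_ord_recr /=; lia.
have NK a p : (a <= p)%N -> (N (a, p) <= K p)%N.
  move=> ap; rewrite /K big_ord_recr /= [X in (_ <= _ + X + _)%N](bigD1 (inord a)) //=.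
  by rewrite inordK //; lia.
have pK p : (p <= K p)%N by rewrite /K; lia.
have gu p : good_state (u p).
  exact: (tail_hull_sub good_trunc good_mid (uT p)).
exists (u \o K); split=> [p|M i l]; first exact: (tail_hullS (pK p) (uT (K p))).
have ca : code (pickle (M, i, l)) = Some (M, i, l) by rewrite /code pickleK.
apply: (@ae_cvgn_fast_L2 _ _ _ _ _ _ (pickle (M, i, l))) => //.
  by move=> p; apply: measurable_funTS; case: (gu (K p)) => my _ _ _ _; exact: my.
move=> p ap.
have := NP (pickle (M, i, l), p) _ _ (leq_trans (NK _ _ ap) (KS p)) (NK _ _ ap).
rewrite (defectE (gu _) (gu _) ca) -lee_fin /Rintegral fineK //.
apply: integrable_fin_num => //; apply: (@sq_integrable _ (M%:R + M%:R)).
  by apply: measurable_funB; have [] := gu (K p); have [] := gu (K p.+1).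
by move=> x; apply: (le_trans (ler_normB _ _)); apply: lerD; exact: good_bound.
Qed.

End lower_closure_core.

Lemma measurable_fun_limn_einf {d : measure_display} {T : measurableType d}
    {R : realType} (D : set T) (f : nat -> T -> \bar R) :
  (forall k, measurable_fun D (f k)) -> measurable_fun D (fun x => limn_einf (f ^~ x)).
Proof.
move=> mf; rewrite (_ : (fun x => _) = (fun x => - limn_esup ((fun k => \- f k) ^~ x))%E).
  apply: measurableT_comp => //; apply: measurable_fun_limn_esup => k.
  exact: measurableT_comp.
apply/funext => x; rewrite -limn_einfN; congr limn_einf.
by apply/funext => k /=; rewrite oppeK.
Qed.

Lemma limn_einf_ub {R : realType} (u : nat -> \bar R) (c : \bar R) :
  (forall k, (u k <= c)%E) -> (limn_einf u <= c)%E.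
Proof.
move=> uc; rewrite limn_einf_lim; apply: lime_le; first exact: is_cvg_einfs.
by apply: nearW => k; apply: le_trans (uc k); apply: ereal_inf_lbound; exists k => /=.
Qed.

Lemma limn_einf_lb {R : realType} (u : nat -> \bar R) (c : \bar R) :
  (forall k, (c <= u k)%E) -> (c <= limn_einf u)%E.
Proof.
move=> uc; rewrite limn_einf_lim; apply: lime_ge; first exact: is_cvg_einfs.
by apply: nearW => k; apply: le_ereal_inf_tmp => _ [j _ <-].
Qed.

Section truncated_limits.
Context {d : measure_display} {T : measurableType d} {R : realType}.
Variable mu : {measure set T -> \bar R}.
Variables (Dl : nat -> set T) (J : finType) (v : nat -> J -> T -> R) (C : nat -> R).
Hypotheses (mDl : forall l, measurable (Dl l)) (Dl_fin : forall l, (mu (Dl l) < +oo)%E)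
  (mv : forall k i, measurable_fun setT (v k i)) (v_ge0 : forall k i x, 0 <= v k i x)
  (vC : forall l k i, (\int[mu]_(x in Dl l) (v k i x)%:E <= (C l)%:E)%E).

Local Notation good := (@good_state d T R mu Dl J C).
Local Notation hull := (tail_hull (@mid_state d T R J) (trunc_state v)).

Lemma good_hull p y : hull p y -> good y.
Proof.
apply: tail_hull_sub; [exact: good_trunc|exact: good_mid].
Qed.

Lemma good_integrable_None y i l E : good y -> measurable E -> E `<=` Dl l ->
  mu.-integrable E (EFin \o y None i).
Proof.
move=> [my y0 _ _ yC] mE EDl; apply: (integrableS (mDl l)) => //.
apply/integrableP; split; first by apply/measurable_EFinP; exact: measurable_funTS.
under eq_integral do rewrite gee0_abs ?lee_fin //.
exact: le_lt_trans (yC l i) (ltry _).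
Qed.

Lemma good_integrable_all y a i l E : good y -> measurable E -> E `<=` Dl l ->
  mu.-integrable E (EFin \o y a i).
Proof.
case: a => [M|] gy mE EDl; first exact: (good_integrable mDl Dl_fin M i gy mE EDl).
exact: (@good_integrable_None _ _ l).
Qed.

Lemma Rintegral_mid y z a i l E : good y -> good z -> measurable E -> E `<=` Dl l ->
  \int[mu]_(x in E) mid_state y z a i x =
  (\int[mu]_(x in E) y a i x + \int[mu]_(x in E) z a i x) / 2.
Proof.
move=> gy gz mE EDl; rewrite /mid_state.
have iy := good_integrable_all a i gy mE EDl; have iz := good_integrable_all a i gz mE EDl.
under eq_Rintegral do rewrite mulrC.
rewrite RintegralZl //; last exact: (integrableD mE iy iz).
by rewrite RintegralD // mulrC.
Qed.

Variable W : nat -> @state d T R J.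
Hypotheses (W_hull : forall p, hull p (W p))
  (W_cvg : forall M i l, {ae mu, forall x, Dl l x -> cvgn (fun p => W p (Some M) i x)}).

(** The lower limit is defined and measurable everywhere, so no null set has to be removed; the
    absolute value keeps the function nonnegative also where the sequence diverges. Wherever the
    sequence converges, this is its limit. *)
Definition trunc_lim (M : nat) i x : R :=
  `|fine (limn_einf (fun p => (W p (Some M) i x)%:E))|.

Definition full_lim i x : R := `|fine (limn_einf (fun M => (trunc_lim M i x)%:E))|.

Lemma trunc_lim_ge0 M i x : 0 <= trunc_lim M i x. Proof. exact: normr_ge0. Qed.

Lemma full_lim_ge0 i x : 0 <= full_lim i x. Proof. exact: normr_ge0. Qed.

Local Hint Resolve trunc_lim_ge0 full_lim_ge0 : core.

Let gW p : good (W p). Proof. exact: good_hull (W_hull p). Qed.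

Let mW p a i : measurable_fun setT (W p a i). Proof. by case: (gW p). Qed.

Let W_ge0 p a i x : 0 <= W p a i x. Proof. by case: (gW p). Qed.

Lemma measurable_trunc_lim M i : measurable_fun setT (trunc_lim M i).
Proof.
apply: measurableT_comp => //; apply: measurableT_comp => //.
by apply: measurable_fun_limn_einf => p; apply/measurable_EFinP.
Qed.

Lemma measurable_full_lim i : measurable_fun setT (full_lim i).
Proof.
apply: measurableT_comp => //; apply: measurableT_comp => //.
apply: measurable_fun_limn_einf => p; apply/measurable_EFinP.
exact: measurable_trunc_lim.
Qed.

Lemma trunc_lim_cvg M i x : cvgn (fun p => W p (Some M) i x) ->
  W p (Some M) i x @[p --> \oo] --> trunc_lim M i x.
Proof.
move=> /cvg_ex[l Wl]; suff -> : trunc_lim M i x = l by [].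
rewrite /trunc_lim (cvg_limn_einf_sup (l := l%:E)) /=; last first.
  by apply/fine_cvgP; split => //; exact: nearW.
by rewrite ger0_norm //; apply: cvgr_to_ge Wl _; exact: nearW.
Qed.

Lemma ae_trunc_lim l : {ae mu, forall x, Dl l x -> forall M i,
  W p (Some M) i x @[p --> \oo] --> trunc_lim M i x}.
Proof.
pose Q a x := if unpickle a is Some (M, i) then
   Dl l x -> cvgn (fun p => W p (Some M) (i : J) x) else True.
have : {ae mu, forall x, forall a, Q a x}.
  apply: ae_foralln => a; rewrite /Q; case: unpickle => [[M i]|]; first exact: W_cvg.
  exact: aeW.
apply: filterS => x Qx Dx M i; apply: trunc_lim_cvg.
by have := Qx (pickle (M, i)); rewrite /Q pickleK; exact.
Qed.

Lemma trunc_lim_bound l : {ae mu, forall x, Dl l x -> forall M i,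
  trunc_lim M i x <= M%:R /\ trunc_lim M i x <= trunc_lim M.+1 i x}.
Proof.
apply: filterS (ae_trunc_lim l) => x /[apply] Wx M i; split.
  by apply: cvgr_to_le (Wx M i) _; apply: nearW => p; case: (gW p).
by apply: ler_cvg_to (Wx M i) (Wx M.+1 i) _; apply: nearW => p; case: (gW p) => _ _ _ /(_ M i x)[].
Qed.

Lemma cvg_int_trunc l E M i : measurable E -> E `<=` Dl l ->
  \int[mu]_(x in E) W p (Some M) i x @[p --> \oo] --> \int[mu]_(x in E) trunc_lim M i x.
Proof.
move=> mE EDl; apply: (@cvgn_Rintegral_dominated _ _ _ _ _ _ _ (cst M%:R)) => //.
- by move=> k; exact: measurable_funTS.
- by apply: measurable_funTS; exact: measurable_trunc_lim.
- by apply: filterS (ae_trunc_lim l) => x Wx /EDl /Wx; exact.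
- apply: (bounded_integrable mDl Dl_fin (K := M%:R) (l := l)) => // x.
  by rewrite ger0_norm.
- by apply: aeW => x k _; rewrite ger0_norm //; case: (gW k).
Qed.

Lemma int_trunc_le l M i : \int[mu]_(x in Dl l) trunc_lim M i x <= C l.
Proof.
have cvl := @cvg_int_trunc l _ M i (mDl l) (@subset_refl _ (Dl l)).
apply: (cvgr_to_le cvl).
apply: nearW => p; have [_ _ _ WS WC] := gW p.
rewrite -lee_fin; apply: le_trans (WC l i).
rewrite /Rintegral fineK; last first.
  by apply: integrable_fin_num => //; exact: (good_integrable_all (Some M) i (gW p) (mDl l) (@subset_refl _ (Dl l))).
apply: ge0_le_integral => //.
- by move=> x _; rewrite lee_fin.
- by apply/measurable_EFinP; exact: measurable_funTS.
- by apply/measurable_EFinP; exact: measurable_funTS.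
- by move=> x _; rewrite lee_fin; case: (WS M i x).
Qed.

Lemma trunc_lim_integrable l E M i : measurable E -> E `<=` Dl l ->
  mu.-integrable E (EFin \o trunc_lim M i).
Proof.
move=> mE EDl; apply: (integrableS (mDl l)) => //.
have ci : mu.-integrable (Dl l) (EFin \o cst M%:R).
  apply: (bounded_integrable mDl Dl_fin (K := M%:R) (l := l)) => // x.
  by rewrite ger0_norm.
have mt : measurable_fun (Dl l) (EFin \o trunc_lim M i).
  by apply/measurable_EFinP; apply: measurable_funTS; exact: measurable_trunc_lim.
apply/integrableP; split => //.
have /integrableP[_] := ci; apply: le_lt_trans.
apply: ae_ge0_le_integral => //.
- by apply: measurableT_comp.
- by apply: measurableT_comp => //; case/integrableP: ci.
by apply: filterS (trunc_lim_bound l) => x tx Dx /=; rewrite lee_fin !ger0_norm //; case: (tx Dx M i).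
Qed.

(** Fatou's lemma bounds the integral of the lower limit by [C l], so it is finite almost
    everywhere; the truncated limits increase with the height, so the lower limit is a limit. *)
Lemma full_lim_integrable_cvg l i :
  mu.-integrable (Dl l) (EFin \o full_lim i) /\
  {ae mu, forall x, Dl l x -> trunc_lim M i x @[M --> \oo] --> full_lim i x}.
Proof.
pose F x := limn_einf (fun M => (trunc_lim M i x)%:E).
have mF : measurable_fun setT F.
  apply: measurable_fun_limn_einf => M; apply/measurable_EFinP.
  exact: measurable_trunc_lim.
have F_ge0 x : (0 <= F x)%E by apply: limn_einf_lb => M; rewrite lee_fin.
have iF : mu.-integrable (Dl l) F.
  apply/integrableP; split; first exact: measurable_funTS.
  under eq_integral do rewrite gee0_abs //.
  apply: (@le_lt_trans _ _ (C l)%:E); last exact: ltry.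
  apply: le_trans (@fatou _ _ _ mu _ (mDl l) (fun M x => (trunc_lim M i x)%:E) _ _) _.
  - by move=> M; apply/measurable_EFinP; apply: measurable_funTS; exact: measurable_trunc_lim.
  - by move=> M x _; rewrite lee_fin.
  apply: limn_einf_ub => M; have := int_trunc_le l M i.
  rewrite -lee_fin /Rintegral fineK //; apply: integrable_fin_num => //.
  exact: (@trunc_lim_integrable l).
have Ffin := integrable_ae (mDl l) iF.
split.
  apply/integrableP; split.
    by apply/measurable_EFinP; apply: measurable_funTS; exact: measurable_full_lim.
  have /integrableP[_] := iF; apply: le_lt_trans; apply: ae_ge0_le_integral => //.
  - apply: measurableT_comp => //; apply/measurable_EFinP; apply: measurable_funTS.
    exact: measurable_full_lim.
  - by apply: measurableT_comp => //; exact: measurable_funTS.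
  - apply: filterS Ffin => x Fx Dx /=; rewrite /full_lim normr_id.
    by rewrite -/(F x); move: (Fx Dx); case: (F x).
move: Ffin (trunc_lim_bound l); apply: filterS2 => x Ffin tx Dx.
have /ereal_nondecreasing_is_cvgn tcv :
    {homo (fun M => (trunc_lim M i x)%:E) : M N / (M <= N)%N >-> (M <= N)%E}.
  by apply/nondecreasing_seqP => M; rewrite lee_fin; case: (tx Dx M i).
have FE : F x = (full_lim i x)%:E.
  by rewrite /full_lim -/(F x) ger0_norm ?fineK ?fine_ge0 ?Ffin.
have : (trunc_lim M i x)%:E @[M --> \oo] --> (full_lim i x)%:E.
  by rewrite -FE /F is_cvg_limn_einfE.
by move=> /fine_cvgP[].
Qed.

Lemma cvg_int_full l E i : measurable E -> E `<=` Dl l ->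
  \int[mu]_(x in E) trunc_lim M i x @[M --> \oo] --> \int[mu]_(x in E) full_lim i x.
Proof.
move=> mE EDl; have [iF cF] := full_lim_integrable_cvg l i.
apply: (@cvgn_Rintegral_dominated _ _ _ _ _ _ _ (full_lim i)) => //.
- by move=> k; apply: measurable_funTS; exact: measurable_trunc_lim.
- by apply: measurable_funTS; exact: measurable_full_lim.
- by apply: filterS cF => x cx /EDl.
- exact: integrableS iF.
move: cF (trunc_lim_bound l); apply: filterS2 => x cx tx M /EDl Dx.
rewrite ger0_norm // -(cvg_lim _ (cx Dx)) //.
apply: (@nondecreasing_cvgn_le _ (fun M => trunc_lim M i x)).
  by apply/nondecreasing_seqP => N; case: (tx Dx N i).
by apply/cvg_ex; exists (full_lim i x); exact: cx.
Qed.

End truncated_limits.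

Section truncation_error.
Context {d : measure_display} {T : measurableType d} {R : realType}.
Variable mu : {measure set T -> \bar R}.
Variables (Dl : nat -> set T) (J : finType) (v : nat -> J -> T -> R) (C : nat -> R).
Hypotheses (mDl : forall l, measurable (Dl l)) (Dl_fin : forall l, (mu (Dl l) < +oo)%E)
  (mv : forall k i, measurable_fun setT (v k i)) (v_ge0 : forall k i x, 0 <= v k i x)
  (vC : forall l k i, (\int[mu]_(x in Dl l) (v k i x)%:E <= (C l)%:E)%E).

Local Notation good := (@good_state d T R mu Dl J C).
Local Notation hull := (tail_hull (@mid_state d T R J) (trunc_state v)).

(** At a point removed by the truncation, either the i-th component exceeds [c0] and uniform
    integrability applies, or it is at most c while some component exceeds M, so that it is at most
    c / M times the sum of all components. The integral of the latter is small for large M. Both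
    sides are linear in the state, so the estimate passes from the sequence to its hull, with a
    height that depends neither on the state nor on E. *)
Lemma truncation_error i l (e : R) : 0 < e ->
  (forall e' : R, 0 < e' -> exists c : R, forall k,
    (\int[mu]_(x in Dl l `&` [set x | (c < v k i x)%R]) (v k i x)%:E <= e'%:E)%E) ->
  exists M0, forall M, (M0 <= M)%N -> forall y, hull 0 y -> forall E, measurable E ->
    E `<=` Dl l ->
    \int[mu]_(x in E) y None i x <= \int[mu]_(x in E) y (Some M) i x + e.
Proof.
move=> e0 UI; have [c0 c0P] := UI _ (divr_gt0 e0 (ltr0Sn _ 1)).
pose c := Num.max c0 0; have c_ge0 : 0 <= c by rewrite le_max lexx orbT.
have C_ge0 : 0 <= C l.
  by rewrite -lee_fin; apply: le_trans (vC l 0 i); apply: integral_ge0 => x _; rewrite lee_fin.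
(* Chosen so that M > B gives c / M * (#|J| * C l) <= e / 2. *)
pose B : R := c * (#|J|%:R * C l) * 2 / e.
have B_ge0 : 0 <= B by rewrite divr_ge0 ?mulr_ge0 // ltW.
exists (Num.bound B) => M M0 y.
have BM : B < M%:R.
  by apply: lt_le_trans (archi_boundP B_ge0) _; rewrite ler_nat.
have M_gt0 : 0 < M%:R :> R by exact: le_lt_trans BM.
elim=> [_ [k _ <-] E mE EDl|{}y z hy IHy hz IHz E mE EDl]; last first.
  have gy := good_hull mDl mv v_ge0 vC hy; have gz := good_hull mDl mv v_ge0 vC hz.
  rewrite !(Rintegral_mid mDl Dl_fin _ _ gy gz mE EDl).
  by have := IHy E mE EDl; have := IHz E mE EDl; lra.
have gk := good_trunc mv v_ge0 vC k.
have i1 := good_integrable_all mDl Dl_fin None i gk mE EDl.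
have i2 := good_integrable_all mDl Dl_fin (Some M) i gk mE EDl.
rewrite -lee_fin EFinD /Rintegral !fineK ?integrable_fin_num //.
pose vgt := (fun x => (v k i x)%:E) \_ [set x | c0 < v k i x].
pose s x : \bar R := ((c / M%:R)%:E * (\sum_(j : J) (v k j x)%:E))%E.
have mvE j A : measurable_fun A (fun x => (v k j x)%:E).
  by apply/measurable_EFinP; exact: measurable_funTS.
have mgt : measurable [set x | c0 < v k i x].
  rewrite -[X in measurable X]setTI.
  rewrite (_ : [set x | _] = v k i @^-1` `]c0, +oo[%classic); first exact: mv.
  by apply/seteqP; split=> x /=; rewrite in_itv andbT.
have mvgt A : measurable_fun A vgt.
  apply: (measurable_funS (E := setT)) => //.
  by apply/(measurable_restrictT _ _).1.
have ms A : measurable_fun A s.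
  apply: emeasurable_funM => //; apply: emeasurable_sum => j; exact: mvE.
have vgt_ge0 x : (0 <= vgt x)%E by rewrite /vgt patchE; case: ifP => // _; rewrite lee_fin.
have sum_ge0 x : (0 <= \sum_(j : J) (v k j x)%:E)%E.
  by apply: sume_ge0 => j _; rewrite lee_fin.
have cM_ge0 : (0 <= (c / M%:R)%:E)%E by rewrite lee_fin divr_ge0.
have s_ge0 x : (0 <= s x)%E by apply: mule_ge0.
have tr_ge0 x : (0 <= (trunc_state v k (Some M) i x)%:E)%E.
  by rewrite lee_fin; case: gk.
have mtr A : measurable_fun A (fun x => (trunc_state v k (Some M) i x)%:E).
  by apply/measurable_EFinP; apply: measurable_funTS; case: gk.
apply: (@le_trans _ _ (\int[mu]_(x in E)
   ((trunc_state v k (Some M) i x)%:E + (vgt x + s x)))%E).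
  apply: ge0_le_integral => //.
  - by move=> x _; rewrite lee_fin; exact: v_ge0.
  - exact: mvE.
  - by apply: emeasurable_funD => //; exact: emeasurable_funD.
  move=> x _ /=; rewrite indicE; have [xb|xNb] := boolP (x \in below v k M).
    by rewrite mulr1 leeDl // adde_ge0.
  rewrite mulr0 add0e; have [cv|vc] := ltP c0 (v k i x).
    by rewrite /vgt patchE mem_set // leeDl.
  apply: le_trans (leeDr _ (vgt_ge0 x)).
  have /existsNP[j /negP] : ~ forall j, v k j x <= M%:R by move=> xb; rewrite mem_set in xNb.
  rewrite -ltNge => Mv; rewrite /s sumEFin -EFinM lee_fin.
  apply: (@le_trans _ _ (c / M%:R * v k j x)).
    apply: (@le_trans _ _ (c / M%:R * M%:R)).
      by rewrite divfK ?gt_eqF // le_max vc.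
    by apply: ler_wpM2l; [rewrite divr_ge0|exact: ltW].
  apply: ler_wpM2l; first by rewrite divr_ge0.
  by rewrite (bigD1 j) //= lerDl sumr_ge0.
rewrite ge0_integralD //; last 2 first.
- by move=> x _; rewrite adde_ge0.
- exact: emeasurable_funD.
apply: leeD => //; rewrite ge0_integralD //.
have -> : e%:E = ((e / 2)%:E + (e / 2)%:E)%E by rewrite -EFinD; congr EFin; field.
apply: leeD.
  apply: le_trans (ge0_subset_integral _ _ _ _ _ EDl) _ => //.
  by rewrite /vgt -integral_mkcondr; exact: c0P.
apply: le_trans (ge0_subset_integral _ _ _ _ _ EDl) _ => //.
rewrite ge0_integralZl_EFin //; last first.
  by apply: emeasurable_sum => j; exact: mvE.
rewrite ge0_integral_sum //; last by move=> j x _; rewrite lee_fin.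
apply: (@le_trans _ _ ((c / M%:R)%:E * \sum_(j : J) (C l)%:E)%E).
  by apply: lee_wpmul2l => //; apply: lee_sum => j _; exact: vC.
rewrite sumEFin sumr_const -EFinM lee_fin -mulr_natl.
have Be : B * e <= M%:R * e by rewrite ler_pM2r // ltW.
have BE : B * e = c * (#|J|%:R * C l) * 2 by rewrite /B; field; rewrite gt_eqF.
by rewrite mulrAC ler_pdivrMr //; lra.
Qed.

End truncation_error.

Section lower_closure.
Context {d : measure_display} {T : measurableType d} {R : realType}.
Variable mu : {measure set T -> \bar R}.
Variables (Dl : nat -> set T) (I : finType) (v : nat -> I -> T -> R) (C : nat -> R)
  (P : pred I).
Hypotheses (mDl : forall l, measurable (Dl l)) (Dl_fin : forall l, (mu (Dl l) < +oo)%E)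
  (mv : forall k i, measurable_fun setT (v k i)) (v_ge0 : forall k i x, 0 <= v k i x)
  (vC : forall l k i, (\int[mu]_(x in Dl l) (v k i x)%:E <= (C l)%:E)%E)
  (UI : forall i, P i -> forall l (e : R), 0 < e -> exists c : R, forall k,
    (\int[mu]_(x in Dl l `&` [set x | (c < v k i x)%R]) (v k i x)%:E <= e%:E)%E).

(* The extra constant component [None] records the weight that a convex
   combination of truncations gives to the untruncated points. *)
Let v1 k (j : option I) x : R := if j is Some i then v k i x else 1.

Let mv1 k j : measurable_fun setT (v1 k j).
Proof. by case: j => [i|]; [exact: mv|exact: measurable_cst]. Qed.

Let v1_ge0 k j x : 0 <= v1 k j x.
Proof. by case: j => [i|]; [exact: v_ge0|exact: ler01]. Qed.

Let v1C l k j : (\int[mu]_(x in Dl l) (v1 k j x)%:E <= (`|C l| + fine (mu (Dl l)))%:E)%E.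
Proof.
case: j => [i|] /=.
  apply: le_trans (vC l k i) _; rewrite lee_fin.
  by apply: le_trans (ler_norm _) _; rewrite lerDl fine_ge0.
rewrite (integral_cst mu (mDl l) 1%:E) mul1e -[leLHS]fineK; last first.
  by rewrite ge0_fin_numE.
by rewrite lee_fin lerDr.
Qed.

Local Notation hull := (tail_hull (@mid_state d T R (option I)) (trunc_state v1)).

Let UI1 j : (if j is Some i then P i else true) -> forall l (e : R), 0 < e ->
  exists c : R, forall k,
    (\int[mu]_(x in Dl l `&` [set x | (c < v1 k j x)%R]) (v1 k j x)%:E <= e%:E)%E.
Proof.
case: j => [i|] Pi l e e0; first exact: UI.
exists 1 => k /=; rewrite (_ : _ `&` _ = set0) ?integral_set0 ?lee_fin ?ltW //.
by apply/seteqP; split => x //= [_]; rewrite ltxx.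
Qed.

Definition closed_set_ffun (S : set (I -> R)) :=
  forall x, (forall e, 0 < e -> exists2 b, S b & forall i, `|x i - b i| <= e) -> S x.

Definition convex_set_ffun (S : set (I -> R)) :=
  forall x y (t : R), S x -> S y -> 0 <= t -> t <= 1 ->
    S (fun i => t * x i + (1 - t) * y i).

(** The surviving terms of the combination are near S and carry total weight [th], the removed ones
    contribute zero. Hence the value is [th] times something near S, unless everything was removed.
    A midpoint of two such values uses the convex combination with weights p / (p + q) and q / (p +
    q). *)
Lemma scaled_approx (S : set (I -> R)) (e : R) (M K : nat) y x :
  convex_set_ffun S ->
  (forall k, (K <= k)%N -> (forall i, v k i x <= M%:R) ->
    exists2 b, S b & forall i, `|v k i x - b i| <= e) ->
  (0 < M)%N ->
  hull K y -> let th := y (Some M) None x in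
    0 <= th /\ if th == 0 then forall i, y (Some M) (Some i) x = 0
    else exists2 b, S b & forall i, `|y (Some M) (Some i) x - th * b i| <= th * e.
Proof.
move=> convS near_S M0; elim=> [_ [k /= Kk <-]|{}y z hy [y0 IHy] hz [z0 IHz]].
  rewrite /= indicE; have [|xb] := boolP (x \in below v1 k M); last first.
    by rewrite mulr0 eqxx; split=> // i; rewrite mulr0.
  rewrite inE mulr1 => xb; rewrite oner_eq0; split => //.
  have [b Sb bP] := near_S k Kk (fun i => xb (Some i)).
  by exists b => // i; rewrite mulr1 !mul1r.
set p := y (Some M) None x in y0 IHy *; set q := z (Some M) None x in z0 IHz *.
have -> : mid_state y z (Some M) None x = (p + q) / 2 by [].
have mE i : mid_state y z (Some M) (Some i) x =
  (y (Some M) (Some i) x + z (Some M) (Some i) x) / 2 by [].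
split; first by rewrite divr_ge0 ?addr_ge0.
move: IHy IHz; have [p_eq0|p_neq0] := eqVneq p 0; have [q_eq0|q_neq0] := eqVneq q 0.
- by rewrite p_eq0 q_eq0 addr0 mul0r eqxx => y_eq0 z_eq0 i; rewrite mE y_eq0 z_eq0 addr0 mul0r.
- rewrite p_eq0 add0r => y_eq0 [b Sb bP].
  rewrite mulf_eq0 (negbTE q_neq0) invr_eq0 pnatr_eq0 /=; exists b => // i.
  rewrite mE y_eq0 add0r (_ : _ - _ = (z (Some M) (Some i) x - q * b i) / 2); last by field.
  by rewrite normrM (ger0_norm (x := 2^-1)) //; have := bP i; lra.
- rewrite q_eq0 addr0 => [[b Sb bP] z_eq0].
  rewrite mulf_eq0 (negbTE p_neq0) invr_eq0 pnatr_eq0 /=; exists b => // i.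
  rewrite mE z_eq0 addr0 (_ : _ - _ = (y (Some M) (Some i) x - p * b i) / 2); last by field.
  by rewrite normrM (ger0_norm (x := 2^-1)) //; have := bP i; lra.
move=> [b Sb bP] [c Sc cP].
have p_gt0 : 0 < p by rewrite lt_def p_neq0.
have q_gt0 : 0 < q by rewrite lt_def q_neq0.
have pq0 : p + q != 0 by rewrite gt_eqF // addr_gt0.
rewrite mulf_eq0 (negbTE pq0) invr_eq0 pnatr_eq0 /=.
exists (fun i => p / (p + q) * b i + (1 - p / (p + q)) * c i).
  apply: convS => //; first by rewrite divr_ge0 // addr_ge0.
  by rewrite ler_pdivrMr ?addr_gt0 // mul1r lerDl.
move=> i; rewrite mE.
rewrite (_ : _ - _ = ((y (Some M) (Some i) x - p * b i) +
   (z (Some M) (Some i) x - q * c i)) / 2); last by field.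
rewrite normrM (ger0_norm (x := 2^-1)) //.
have := le_trans (ler_normD _ _) (lerD (bP i) (cP i)); lra.
Qed.

(** Components outside P can lose mass in the limit, so a linear inequality passes to it only if
    their coefficients are nonpositive. In the last clause S is quantified after the null set and
    may therefore depend on x; nearness to S is asked only of values bounded by a fixed M, which
    leaves room for a compactness argument. *)
Lemma lower_closure : exists w : I -> T -> R,
  [/\ forall i, measurable_fun setT (w i),
      forall i x, 0 <= w i x,
      forall l i, mu.-integrable (Dl l) (EFin \o w i),
      forall l E (lam : I -> R) a K, measurable E -> E `<=` Dl l ->
        (forall i, ~~ P i -> lam i <= 0) ->
        (forall k, (K <= k)%N -> a <= \sum_(i : I) lam i * \int[mu]_(x in E) v k i x) ->
        a <= \sum_(i : I) lam i * \int[mu]_(x in E) w i x &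
      forall l, {ae mu, forall x, Dl l x -> forall S : set (I -> R),
        convex_set_ffun S -> closed_set_ffun S ->
        (forall (M : nat) e, 0 < e -> exists K, forall k, (K <= k)%N ->
          (forall i, v k i x <= M%:R) ->
          exists2 b, S b & forall i, `|v k i x - b i| <= e) ->
        S (w ^~ x)}].
Proof.
have [W [W_hull W_cvg]] := fast_hull mDl Dl_fin mv1 v1_ge0 v1C.
pose w0 := full_lim W.
have HI := full_lim_integrable_cvg mDl Dl_fin mv1 v1_ge0 v1C W_hull W_cvg.
have HT := cvg_int_trunc mDl Dl_fin mv1 v1_ge0 v1C W_hull W_cvg.
have HF := cvg_int_full mDl Dl_fin mv1 v1_ge0 v1C W_hull W_cvg.
have HA := ae_trunc_lim mDl mv1 v1_ge0 v1C W_hull W_cvg.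
have gW p := good_hull mDl mv1 v1_ge0 v1C (W_hull p).
have hW0 p : hull 0 (W p) by exact: (tail_hullS (leq0n p) (W_hull p)).
have iW l E p a j (mE : measurable E) (EDl : E `<=` Dl l) :=
  good_integrable_all mDl Dl_fin a j (gW p) mE EDl.
have err j (Pj : if j is Some i then P i else true) l (e : R) (e0 : 0 < e) :=
  truncation_error mDl Dl_fin mv1 v1_ge0 v1C e0 (UI1 Pj l).
have W_le p M j E l : measurable E -> E `<=` Dl l ->
    \int[mu]_(x in E) W p (Some M) j x <= \int[mu]_(x in E) W p None j x.
  move=> mE EDl; apply: le_Rintegral => //; [exact: iW EDl|exact: iW EDl|].
  by move=> x _; have [_ _ _ WS _] := gW p; case: (WS M j x).
(* The weight never exceeds 1 along the sequence. As the constant 1 is uniformly integrable,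
   [truncation_error] shows that the limit weight has integral at least the measure of E, so it
   equals 1 almost everywhere. *)
have weight1 l : {ae mu, forall x, Dl l x -> w0 None x = 1}.
  have [i0 c0] := HI l None.
  have W1 y : hull 0 y -> forall x, y None None x = 1.
    elim=> [_ [k _ <-] //|{}y z _ yx _ zx x].
    by rewrite /mid_state yx zx; lra.
  have le1 : {ae mu, forall x, Dl l x -> w0 None x <= 1}.
    move: c0 (HA l); apply: filterS2 => x c0 cW Dx.
    apply: cvgr_to_le (c0 Dx) _; apply: nearW => M.
    apply: cvgr_to_le (cW Dx M None) _; apply: nearW => p.
    rewrite -(W1 (W p) (hW0 p) x); have [_ _ _ WS _] := gW p; by case: (WS M None x).
  have mw0 : measurable_fun setT (w0 None).
    exact: (measurable_full_lim mDl mv1 v1_ge0 v1C W_hull).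
  pose E := Dl l `&` [set x | w0 None x <= 1].
  have mE : measurable E.
    apply: measurableI => //; rewrite -[X in measurable X]setTI.
    rewrite (_ : [set x | _] = w0 None @^-1` `]-oo, 1]%classic); first exact: mw0.
    by apply/seteqP; split=> x /=; rewrite in_itv.
  have EDl : E `<=` Dl l by move=> x [].
  have int_le : \int[mu]_(x in E) 1 <= \int[mu]_(x in E) w0 None x.
    apply/ler_addgt0Pr => e e0; have [M0 M0P] := err None erefl l e e0.
    rewrite -lerBlDr; apply: cvgr_to_ge (HF l E None mE EDl) _.
    exists M0 => // M /= M0M.
    apply: cvgr_to_ge (HT l E M None mE EDl) _; apply: nearW => p.
    rewrite lerBlDr; apply: le_trans (M0P M M0M (W p) (hW0 p) E mE EDl).
    have -> // : \int[mu]_(x in E) 1 = \int[mu]_(x in E) W p None None x.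
    by apply: eq_Rintegral => x _; rewrite (W1 _ (hW0 p)).
  have i1 : mu.-integrable E (EFin \o cst 1).
    by apply: (bounded_integrable mDl Dl_fin (K := 1) (l := l)) => // x; rewrite normr1.
  have iE : mu.-integrable E (EFin \o w0 None) by exact: integrableS i0.
  pose f1 x : R := 1 - w0 None x.
  have iB : mu.-integrable E (EFin \o f1) by exact: (integrableB mE i1 iE).
  have : (\int[mu]_(x in E) `|(EFin \o f1) x| = 0)%E.
    apply/eqP; rewrite eq_le integral_ge0 // andbT.
    rewrite (eq_integral (EFin \o f1)); last first.
      by move=> x; rewrite inE => -[_ /= xE]; rewrite ger0_norm // subr_ge0.
    rewrite -[leLHS]fineK ?integrable_fin_num // lee_fin.
    by have := RintegralB mE i1 iE; rewrite /Rintegral /= => ->; rewrite subr_le0.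
  move/(ae_eq_integral_abs _ mE (measurable_int _ iB)).
  move: le1; apply: filterS2 => x le1 eq1 Dx.
  have /eq1 : E x by split=> //=; exact: le1.
  by move=> [] /eqP; rewrite subr_eq0 eq_sym => /eqP.
exists (fun i => w0 (Some i)); split.
- by move=> i; exact: (measurable_full_lim mDl mv1 v1_ge0 v1C W_hull).
- by move=> i x; exact: full_lim_ge0.
- by move=> l i; case: (HI l (Some i)).
- move=> l E lam a K mE EDl lam_le0 a_le.
  have a_hull y : hull K y ->
      a <= \sum_(i : I) lam i * \int[mu]_(x in E) y None (Some i) x.
    elim=> [_ [k Kk <-]|{}y z hy IHy hz IHz]; first exact: a_le.
    have gy := good_hull mDl mv1 v1_ge0 v1C hy; have gz := good_hull mDl mv1 v1_ge0 v1C hz.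
    rewrite (eq_bigr (fun i => 2^-1 * (lam i * \int[mu]_(x in E) y None (Some i) x) +
       2^-1 * (lam i * \int[mu]_(x in E) z None (Some i) x))); last first.
      by move=> i _; rewrite (Rintegral_mid mDl Dl_fin _ _ gy gz mE EDl); field.
    by rewrite big_split /= -!mulr_sumr; lra.
  pose L : R := \sum_(i : I) `|lam i|.
  have L_ge0 : 0 <= L by apply: sumr_ge0.
  apply/ler_addgt0Pr => e e0; pose e' := e / (L + 1).
  have e'0 : 0 < e' by rewrite divr_gt0 // ltr_wpDl.
  have /choice[M0 M0P] i : exists M0, P i -> forall M, (M0 <= M)%N ->
      forall p, \int[mu]_(x in E) W p None (Some i) x <=
        \int[mu]_(x in E) W p (Some M) (Some i) x + e'.
    have [Pi|_] := boolP (P i); last by exists 0%N.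
    have [M0 M0P] := err (Some i) Pi l e' e'0.
    by exists M0 => _ M M0M p; exact: (M0P M M0M (W p) (hW0 p) E mE EDl).
  rewrite -lerBlDr; apply: (@cvgr_to_ge _ \oo _ _
      (fun M => \sum_(i : I) lam i * \int[mu]_(x in E) trunc_lim W M (Some i) x)).
    apply: cvg_big => [|i _]; [exact: add_continuous|apply: cvgM; [exact: cvg_cst|exact: HF EDl]].
  exists (\sum_(i : I) M0 i)%N => // M /= M0M.
  apply: (@cvgr_to_ge _ \oo _ _
      (fun p => \sum_(i : I) lam i * \int[mu]_(x in E) W p (Some M) (Some i) x)).
    apply: cvg_big => [|i _]; [exact: add_continuous|apply: cvgM; [exact: cvg_cst|exact: HT EDl]].
  exists K => // p /= Kp; rewrite lerBlDr.
  apply: le_trans (a_hull _ (tail_hullS Kp (W_hull p))) _.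
  apply: (@le_trans _ _ (\sum_(i : I) (lam i * \int[mu]_(x in E) W p (Some M) (Some i) x +
      `|lam i| * e'))).
    (* For a nonpositive coefficient, truncating already changes the sum in the right direction. A
       positive one belongs to P, where the truncation costs at most [e']. *)
    apply: ler_sum => i _; have [lam0|lam0] := leP (lam i) 0.
      apply: ler_wpDr; first by rewrite mulr_ge0 // ltW.
      by rewrite ler_wnM2l // (W_le _ _ _ _ _ mE EDl).
    have Pi : P i by apply: contraTT lam0 => /lam_le0; rewrite leNgt.
    rewrite gtr0_norm // -mulrDr ler_pM2l //; apply: M0P => //.
    by apply: leq_trans M0M; rewrite (bigD1 i) //= leq_addr.
  rewrite big_split /= lerD2l -mulr_suml -/L /e' mulrA ler_pdivrMr ?ltr_wpDl //.
  by rewrite mulrDr mulr1 mulrC lerDl ltW.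
move=> l.
have HIall : {ae mu, forall x, forall j, Dl l x -> trunc_lim W M j x @[M --> \oo] --> w0 j x}.
  by apply: filter_forall => j; case: (HI l j).
move: HIall (weight1 l) (HA l); apply: filterS3 => x t_w0 w01 W_t Dx S convS closS near_S.
apply: closS => e e0.
have {}w01 := w01 Dx; have {}W_t := W_t Dx; have {}t_w0 j := t_w0 j Dx.
have th_gt0 : \forall M \near \oo, 0 < trunc_lim W M None x.
  by apply: (cvgr_gt _ (t_w0 None)); rewrite w01.
(* Division by the weight undoes the scaling in [scaled_approx] and is harmless in the limit, where
   the weight is 1. It remains to let first p and then M grow, at a cost of [e / 4] each. *)
have quot_w0 i : trunc_lim W M (Some i) x / trunc_lim W M None x @[M --> \oo] --> w0 (Some i) x.
  rewrite -[w0 _ _]divr1 -w01; apply: cvgM; first exact: t_w0.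
  by apply: cvgV; [rewrite w01 oner_eq0|exact: t_w0].
have e4 : 0 < e / 4 by rewrite divr_gt0.
have quot_near : \forall M \near \oo, forall i,
    `|w0 (Some i) x - trunc_lim W M (Some i) x / trunc_lim W M None x| < e / 4.
  by apply: filter_forall => i; have /cvgrPdist_lt h := quot_w0 i; exact: h.
have [M [M_gt0 th0 quotM]] : exists M, [/\ (0 < M)%N, 0 < trunc_lim W M None x & forall i,
    `|w0 (Some i) x - trunc_lim W M (Some i) x / trunc_lim W M None x| < e / 4].
  have [M [[M_gt0 th0] qM]] := filter_ex (filterI (filterI (nbhs_infty_gt 0%N) th_gt0) quot_near).
  by exists M.
have [K near_K] := near_S M (e / 4) e4.
have p_gt0 : \forall p \near \oo, 0 < W p (Some M) None x.
  exact: (cvgr_gt _ (W_t M None)).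
have quot_near_p : \forall p \near \oo, forall i, `|trunc_lim W M (Some i) x /
    trunc_lim W M None x - W p (Some M) (Some i) x / W p (Some M) None x| < e / 4.
  apply: filter_forall => i.
  have : W p (Some M) (Some i) x / W p (Some M) None x @[p --> \oo] -->
      trunc_lim W M (Some i) x / trunc_lim W M None x.
    by apply: cvgM; [exact: W_t|apply: cvgV; [rewrite gt_eqF|exact: W_t]].
  by move=> /cvgrPdist_lt h; exact: h.
have [p [[Kp p0] qp]] := filter_ex (filterI (filterI (nbhs_infty_ge K) p_gt0) quot_near_p).
have [_] := scaled_approx convS near_K M_gt0 (tail_hullS Kp (W_hull p)).
rewrite gt_eqF // => -[b Sb bP]; exists b => // i.
have : `|W p (Some M) (Some i) x / W p (Some M) None x - b i| <= e / 4.
  rewrite -(ler_pM2l p0) -{1}(gtr0_norm p0) -normrM mulrBr mulrCA divff ?gt_eqF // mulr1.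
  exact: bP.
move: (quotM i) (qp i); rewrite !ltr_norml !ler_norml => /andP[? ?] /andP[? ?] /andP[? ?].
by apply/andP; split; lra.
Qed.

End lower_closure.

(** * Measurable selection *)

Definition agree_upto (n : nat) (s s' : nat -> nat) := forall i, (i < n)%N -> s' i = s i.

Lemma agree_uptoS m n s s' : (m <= n)%N -> agree_upto n s s' -> agree_upto m s s'.
Proof. by move=> mn h i im; apply: h; exact: leq_trans mn. Qed.

Section suslin_sets.
Context {d : measure_display} {X : measurableType d}.

Definition locally_constant2 (A : (nat -> nat) -> (nat -> nat) -> set X) :=
  forall s r, exists n, forall s' r', agree_upto n s s' -> agree_upto n r r' ->
    A s' r' = A s r.

(* The witness [r] is that of a Souslin operation whose pieces depend on finitely
   many terms of [r] and of the point [p.2] of the Baire space. *)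
Definition suslin (E : set (X * (nat -> nat))) :=
  exists A : nat -> (nat -> nat) -> (nat -> nat) -> set X,
  [/\ forall n, locally_constant2 (A n), forall n s r, measurable (A n s r) &
      E = [set p | exists r, forall n, A n p.2 r p.1]].

Lemma suslin_loc_const (A : (nat -> nat) -> set X) (k : nat) :
  (forall s s', agree_upto k s s' -> A s' = A s) -> (forall s, measurable (A s)) ->
  suslin [set p | A p.2 p.1].
Proof.
move=> cA mA; exists (fun _ s _ => A s); split=> //.
  by move=> _ s r; exists k => s' r' ss' _; exact: cA.
by apply/seteqP; split=> p /=; [move=> ?; exists (fun=> 0%N)|case=> _ /(_ 0%N)].
Qed.

(** The first term of the witness names a member of the union, the remaining terms are a witness for
    that member. *)
Lemma suslin_bigcup (E : nat -> set (X * (nat -> nat))) :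
  (forall i, suslin (E i)) -> suslin (\bigcup_i E i).
Proof.
move=> /choice[A AP].
exists (fun n s r => A (r 0%N) n s (fun k => r k.+1)); split.
- move=> n s r; have [/(_ n) lA _ _] := AP (r 0%N).
  have [k kP] := lA s (fun k => r k.+1).
  exists k.+1 => s' r' ss' rr'; rewrite (rr' 0%N) //; apply: kP.
    exact: agree_uptoS ss'.
  by move=> i ik; exact: rr'.
- by move=> n s r; case: (AP (r 0%N)).
apply/seteqP; split=> [p [i _]|p [r rP]].
  have [_ _ ->] := AP i => -[r rP].
  by exists (fun k => if k is k'.+1 then r k' else i).
exists (r 0%N) => //; have [_ _ ->] := AP (r 0%N).
by exists (fun k => r k.+1).
Qed.

(** Witnesses for all members are interleaved into one sequence by the pairing [code]; a single
    piece still looks at finitely many terms only. *)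
Lemma suslin_bigcap (E : nat -> set (X * (nat -> nat))) :
  (forall i, suslin (E i)) -> suslin (\bigcap_i E i).
Proof.
move=> /choice[A AP].
pose code (i k : nat) : nat := pickle (i, k).
exists (fun n s r => if (unpickle n : option (nat * nat)) is Some (i, j)
  then A i j s (fun k => r (code i k)) else setT); split.
- move=> n s r; case: unpickle => [[i j]|]; last by exists 0%N.
  have [/(_ j) lA _ _] := AP i.
  have [k kP] := lA s (fun k => r (code i k)).
  exists (k + \sum_(a < k) (code i a).+1)%N => s' r' ss' rr'; apply: kP.
    by apply: agree_uptoS ss'; rewrite leq_addr.
  move=> a ak; apply: rr'.
  by rewrite (bigD1 (Ordinal ak)) //=; lia.
- move=> n s r; case: unpickle => [[i j]|//]; by case: (AP i).
apply/seteqP; split=> [p Ep|p [r rP] i _].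
  have /choice[r rP] : forall i, exists r, forall n, A i n p.2 r p.1.
    by move=> i; have := Ep i Logic.I; have [_ _ ->] := AP i.
  exists (fun n => if (unpickle n : option (nat * nat)) is Some (i, k) then r i k else 0%N).
  move=> n; case: unpickle => [[i j]|//].
  rewrite (_ : (fun k => _) = r i); first exact: rP.
  by apply/funext => k; rewrite /code pickleK.
have [_ _ ->] := AP i; exists (fun k => r (code i k)) => j.
by have := rP (code i j); rewrite /code pickleK.
Qed.

(** Closure under complements is built in, so these sets form a sigma-algebra and only its
    generators have to be checked by hand. *)
Definition bisuslin : set (set (X * (nat -> nat))) :=
  [set E | suslin E /\ suslin (~` E)].

Lemma bisuslin_sigma_algebra : sigma_algebra setT bisuslin.
Proof.
split.
- split; first exact: (@suslin_loc_const (fun=> set0) 0%N).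
  rewrite setC0; exact: (@suslin_loc_const (fun=> setT) 0%N).
- by move=> E [sE sCE]; rewrite setTD; split => //; rewrite setCK.
move=> E EP; split; first by apply: suslin_bigcup => i; case: (EP i).
by rewrite setC_bigcup; apply: suslin_bigcap => i; case: (EP i).
Qed.

Lemma bisuslin_loc_const (A : (nat -> nat) -> set X) (k : nat) :
  (forall s s', agree_upto k s s' -> A s' = A s) -> (forall s, measurable (A s)) ->
  bisuslin [set p | A p.2 p.1].
Proof.
move=> cA mA; split; first exact: suslin_loc_const cA mA.
apply: (@suslin_loc_const (fun s => ~` A s) k) => [s s' /cA ->//|s].
exact: measurableC.
Qed.

End suslin_sets.

(** * Measurable choice of a branch in a scheme of measurable sets *)

Section scheme_selection.
Context {d : measure_display} {X : measurableType d} {R : realType}.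
Variable mu : {measure set X -> \bar R}.
Variables (F : seq nat -> set X) (D : set X) (a : \bar R).
Hypotheses (mF : forall l, measurable (F l)) (F_rcons : forall l j, F (rcons l j) `<=` F l)
  (mD : measurable D) (D_fin : (mu D < +oo)%E) (aD : (a < mu D)%E)
  (D_sol : {ae mu, forall x, D x -> exists z, forall N, F (mkseq z N) x}).

(** A substitute for outer measure above [a], since the sets W below are not known to be
    measurable. *)
Definition big (W : set X) := forall H, measurable H -> W `<=` H -> (a < mu H)%E.

(** Continuity of outer measure from below. If every [W i] had a measurable superset [H i] of
    measure at most a, the intersections of the [H j] with j >= i would still contain [W i], since W
    increases; they increase with i, so their union would have measure at most a. *)
Lemma big_bigcup (W : nat -> set X) :
  (forall i j, (i <= j)%N -> W i `<=` W j) -> big (\bigcup_i W i) -> exists i, big (W i).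
Proof.
move=> ndW bigW; apply: contrapT => /forallNP nbig.
have /choice[H HP] i : exists H, [/\ measurable H, W i `<=` H & (mu H <= a)%E].
  have /existsNP[H /not_implyP[mH /not_implyP[WH /negP aH]]] := nbig i.
  by exists H; split => //; rewrite leNgt.
pose G i := \bigcap_j H (i + j)%N.
have mG i : measurable (G i) by apply: bigcapT_measurable => j; case: (HP (i + j)%N).
have ndG : {homo G : i j / (i <= j)%N >-> (i <= j)%O}.
  move=> i j ij; apply/subsetPset => x Gx k _.
  by have := Gx (j - i + k)%N Logic.I; rewrite addnA subnKC.
have mUG : measurable (\bigcup_i G i) by exact: bigcupT_measurable.
have := bigW _ mUG; rewrite ltNge => /(_ _)/negP; apply; last first.
  rewrite -(cvg_lim _ (nondecreasing_cvg_mu mG mUG ndG)) //.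
  apply: lime_le.
    by apply/cvg_ex; eexists; exact: (nondecreasing_cvg_mu mG mUG ndG).
  apply: nearW => i /=; have [mH _ Ha] := HP (i + 0)%N; apply: le_trans Ha.
  by apply: le_measure; rewrite ?inE // => x; exact.
by apply: bigcupS_bigcup; [] || move=> x [i _ Wx]; exists i => // j _; have [_ WH _] := HP (i + j)%N; apply/WH/ndW/Wx; exact: leq_addr.
Qed.

Definition solutions_below (l : seq nat) : set X :=
  [set x | D x /\ exists z, (forall i, (i < size l)%N -> (z i <= nth 0%N l i)%N) /\
    forall N, F (mkseq z N) x].

Lemma big_solutions : big (solutions_below [::]).
Proof.
move=> H mH sH; apply: lt_le_trans aD _.
have [N [mN N0 NP]] := D_sol.
have : D `<=` H `|` N.
  move=> x Dx; have [|xN] := pselect (exists z, forall N, F (mkseq z N) x).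
    by move=> [z zP]; left; apply: sH; split => //; exists z.
  by right; apply: NP => /= h; apply: xN; exact: h.
move=> DHN; apply: le_trans (le_measure mu _ _ DHN) _; rewrite ?inE //; first exact: measurableU.
apply: le_trans (measureU2 mu mH mN) _.
by rewrite [X in (_ + X)%E]N0 adde0.
Qed.

Lemma big_solutions_rcons l : big (solutions_below l) ->
  exists t, big (solutions_below (rcons l t)).
Proof.
move=> bl; apply: big_bigcup => [i j ij x [Dx [z [zl zP]]]|].
  split=> //; exists z; split=> // k; rewrite size_rcons => kl.
  have := zl k; rewrite size_rcons => /(_ kl); rewrite !nth_rcons.
  by case: ifP => // _; case: ifP => // _ /leq_trans; exact.
move=> H mH sH; apply: bl => // x [Dx [z [zl zP]]]; apply: sH.
exists (z (size l)) => //; split=> //; exists z; split=> // k.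
rewrite size_rcons ltnS leq_eqVlt nth_rcons => /orP[/eqP ->|kl].
  by rewrite ltnn eqxx.
by rewrite kl; exact: zl.
Qed.

(** The digits are bounded one after the other, each bound large enough to keep the set of solutions
    [big]. Below [tau] the tree is finitely branching. *)
Lemma exists_big_bound : exists tau : nat -> nat,
  forall N, big (solutions_below (mkseq tau N)).
Proof.
have /choice[f fP] l : exists t, big (solutions_below l) -> big (solutions_below (rcons l t)).
  have [/big_solutions_rcons[t tP]|nb] := pselect (big (solutions_below l)).
    by exists t.
  by exists 0%N.
pose L := fix L n := if n is n'.+1 then rcons (L n') (f (L n')) else [::].
exists (fun n => f (L n)) => N.
rewrite (_ : mkseq _ N = L N).
  by elim: N => [|N IH] /=; [exact: big_solutions|exact: fP].
by elim: N => //= N IH; rewrite mkseqS IH.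
Qed.

Section bounded_branches.
Variable tau : nat -> nat.
Hypothesis big_tau : forall N, big (solutions_below (mkseq tau N)).

Definition bounded_seq (l : seq nat) := forall i, (i < size l)%N -> (nth 0%N l i <= tau i)%N.

(** Only finite extensions of every length are required. This involves countably many measurable
    sets, and finite branching turns it into the existence of an infinite branch. *)
Definition extendible (l : seq nat) : set X :=
  [set x | D x /\ forall N, (size l <= N)%N -> exists l',
    [/\ size l' = N, bounded_seq l', take (size l) l' = l & F l' x]].

Lemma measurable_extendible l : measurable (extendible l).
Proof.
rewrite (_ : extendible l = D `&` \bigcap_N \bigcup_(l' : seq nat)
  [set x | (size l <= N)%N -> [/\ size l' = N, bounded_seq l', take (size l) l' = l & F l' x]]).
  apply: measurableI => //; apply: bigcapT_measurable => N.
  apply: countable_bigcupT_measurable => // l'.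
  have [lN|lN] := boolP (size l <= N)%N; last by rewrite (_ : [set x | _] = setT) //; apply/seteqP; split.
  have [[h1 h2 h3]|h] := pselect [/\ size l' = N, bounded_seq l' & take (size l) l' = l].
    by rewrite (_ : [set x | _] = F l') //; apply/seteqP; split=> [x []|x Fx].
  rewrite (_ : [set x | _] = set0) //; apply/seteqP; split=> [x /(_ isT)[]|//] h1 h2 h3 _.
  exact: h.
apply/seteqP; split=> [x [Dx ex]|x [Dx ex]]; split => // N.
  have [lN|lN] := boolP (size l <= N)%N; last by exists [::].
  by have [l' l'P] := ex N lN; exists l'.
by move=> lN; have [l' _ /(_ lN) l'P] := ex N Logic.I; exists l'.
Qed.

Lemma F_take l N : F l `<=` F (take N l).
Proof.
elim/last_ind: l => [//|l j IH] x Fx.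
have [Nl|lN] := ltnP N (size (rcons l j)); last by rewrite take_oversize.
rewrite -cats1 takel_cat; last by rewrite size_rcons in Nl.
by apply: IH; exact: F_rcons Fx.
Qed.

Lemma extendible_rcons l x : extendible l x -> exists j, extendible (rcons l j) x.
Proof.
move=> [Dx ex]; apply: contrapT => /forallNP nex.
have /choice[M MP] j : exists N, (size (rcons l j) <= N)%N /\ ~ exists l',
    [/\ size l' = N, bounded_seq l', take (size (rcons l j)) l' = rcons l j & F l' x].
  have /not_andP[//|/existsNP[N /not_implyP[jN nN]]] := nex j.
  by exists N.
(* The argument of Koenig's lemma: a bounded extension longer than all the lengths at which the
   finitely many admissible next digits fail would contradict one of these failures. *)
pose K := ((size l).+1 + \sum_(j < (tau (size l)).+1) M j)%N.
have [|l' [sl' bl' tl' Fl']] := ex K; first by rewrite /K; lia.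
have lK : (size l < K)%N by rewrite /K; lia.
pose j := nth 0%N l' (size l).
have jt : (j < (tau (size l)).+1)%N by rewrite ltnS; apply: bl'; rewrite sl'.
have MK : (M j <= K)%N by rewrite /K (bigD1 (Ordinal jt)) //=; lia.
have [jM []] := MP j; exists (take (M j) l'); split.
- by rewrite size_takel // sl'.
- move=> i; rewrite size_takel ?sl' // => iM; rewrite nth_take //.
  by apply: bl'; rewrite sl'; exact: leq_trans MK.
- rewrite take_takel // size_rcons (take_nth 0%N) ?sl' //.
  by rewrite tl'.
exact: F_take.
Qed.

(** The points with a bounded path of length N decrease with N and contain
    [solutions_below (mkseq tau N)], so they have measure above a. Continuity from above, available
    because D has finite measure, keeps the non-strict inequality. *)
Lemma measure_extendible_nil : (a <= mu (extendible [::]))%E.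
Proof.
pose B N : set X := [set x | D x /\ exists l', [/\ size l' = N, bounded_seq l' & F l' x]].
have mB N : measurable (B N).
  rewrite (_ : B N = D `&` \bigcup_(l' : seq nat)
     [set x | [/\ size l' = N, bounded_seq l' & F l' x]]).
    apply: measurableI => //; apply: countable_bigcupT_measurable => // l'.
    have [[h1 h2]|h] := pselect (size l' = N /\ bounded_seq l').
      by rewrite (_ : [set x | _] = F l') //; apply/seteqP; split=> [x []|x Fx].
    by rewrite (_ : [set x | _] = set0) //; apply/seteqP; split=> [x []|//] h1 h2; case: h.
  by apply/seteqP; split=> [x [Dx [l' l'P]]|x [Dx [l' _ l'P]]]; split => //; exists l'.
have BS : {homo B : m n / (m <= n)%N >-> (n <= m)%O}.
  move=> m n mn; apply/subsetPset => x [Dx [l' [sl' bl' Fl']]]; split => //.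
  exists (take m l'); split; first by rewrite size_takel // sl'.
    move=> i; rewrite size_takel ?sl' // => im; rewrite nth_take //.
    by apply: bl'; rewrite sl'; exact: leq_trans mn.
  exact: F_take.
have BE : extendible [::] = \bigcap_N B N.
  apply/seteqP; split=> [x [Dx ex] N _|x Bx].
    by have [//|l' [sl' bl' _ Fl']] := ex N; split => //; exists l'.
  split; first by case: (Bx 0%N Logic.I).
  by move=> N _; have [_ [l' [sl' bl' Fl']]] := Bx N Logic.I; exists l'; split; rewrite ?take0.
have mBc : measurable (\bigcap_N B N) by exact: bigcapT_measurable.
have B0 : (mu (B 0%N) < +oo)%E.
  by apply: le_lt_trans D_fin; apply: le_measure; rewrite ?inE // => x [].
have cB := nonincreasing_cvg_mu B0 mB mBc BS.
rewrite BE -(cvg_lim _ cB) //; apply: lime_ge; first by apply/cvg_ex; eexists; exact: cB.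
apply: nearW => N /=; apply/ltW/(big_tau (N := N)) => // x [Dx [z [zl zP]]]; split => //.
exists (mkseq z N); split; [exact: size_mkseq| |exact: zP].
move=> i; rewrite size_mkseq => iN; rewrite nth_mkseq //.
by have := zl i; rewrite size_mkseq nth_mkseq //; exact.
Qed.

(** The least digit is a canonical choice: the points choosing j are those extendible by j but by no
    smaller digit, which is a measurable set. *)
Definition next_digit (l : seq nat) (x : X) : nat :=
  if pselect (exists j, `[< extendible (rcons l j) x >]) is left ex then ex_minn ex else 0%N.

Fixpoint branch_prefix n (x : X) : seq nat :=
  if n is n'.+1 then rcons (branch_prefix n' x) (next_digit (branch_prefix n' x) x)
  else [::].

Definition branch (x : X) n := next_digit (branch_prefix n x) x.

Lemma mkseq_branch x n : mkseq (branch x) n = branch_prefix n x.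
Proof. by elim: n => //= n IH; rewrite mkseqS IH. Qed.

Lemma extendible_next l x : extendible l x -> extendible (rcons l (next_digit l x)) x.
Proof.
move=> /extendible_rcons[j ej]; rewrite /next_digit.
case: pselect => [ex|[]]; last by exists j; apply/asboolP.
by case: ex_minnP => k /asboolP.
Qed.

Lemma extendible_branch n x : extendible [::] x -> extendible (branch_prefix n x) x.
Proof. by move=> ex; elim: n => //= n; exact: extendible_next. Qed.

Lemma branch_solution x n : extendible [::] x -> F (mkseq (branch x) n) x.
Proof.
move=> /(extendible_branch n); rewrite mkseq_branch => -[_ /(_ _ (leqnn _))].
by move=> [l' [sl' _ tl' Fl']]; rewrite -tl' -sl' take_size.
Qed.

Lemma measurable_branch_prefix n l :
  measurable (extendible [::] `&` [set x | branch_prefix n x = l]).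
Proof.
elim: n l => [|n IH] l /=.
  have [->|ln] := eqVneq l [::].
    by rewrite (_ : [set x | _] = setT) ?setIT; [exact: measurable_extendible|apply/seteqP].
  rewrite (_ : [set x | _] = set0) ?setI0 //; apply/seteqP; split=> // x /= h.
  by rewrite h eqxx in ln.
case/lastP: l => [|l j].
  rewrite (_ : [set x | _] = set0) ?setI0 //; apply/seteqP; split=> // x /= /(congr1 size).
  by rewrite size_rcons.
rewrite (_ : _ `&` _ = (extendible [::] `&` [set x | branch_prefix n x = l]) `&`
   (extendible (rcons l j) `\` \bigcup_(i in [set i | (i < j)%N]) extendible (rcons l i))).
  apply: measurableI => //; apply: measurableD; first exact: measurable_extendible.
  by apply: bigcup_measurable => i _; exact: measurable_extendible.
apply/seteqP; split=> [x [e0 /= /eqP]|x [[e0 /= bl] [ej nej]]].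
  rewrite eqseq_rcons => /andP[/eqP bl /eqP nj]; split => //.
  have el := extendible_branch n e0; have := extendible_next el; rewrite nj bl => ej.
  split => // -[i ij ei]; move: nj; rewrite /next_digit bl; case: pselect => [ex|[]]; last first.
    by exists i; apply/asboolP.
  case: ex_minnP => k _ kmin kj; have := kmin i; rewrite kj => /(_ (asboolT ei)).
  by rewrite leqNgt; move: ij => /= ->.
split => //; rewrite bl; congr rcons; rewrite /next_digit; case: pselect => [ex|[]]; last first.
  by exists j; apply/asboolP.
case: ex_minnP => k /asboolP ek kmin; apply/eqP; rewrite eqn_leq kmin ?asboolT //=.
by rewrite leqNgt; apply/negP => kj; apply: nej; exists k.
Qed.

Lemma measurable_branch n j : measurable (extendible [::] `&` [set x | branch x n = j]).
Proof.
rewrite (_ : _ `&` _ = \bigcup_(l : seq nat)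
   (extendible [::] `&` [set x | branch_prefix n.+1 x = rcons l j])).
  by apply: countable_bigcupT_measurable => // l; exact: measurable_branch_prefix.
apply/seteqP; split=> [x [e0 /= <-]|x [l _ [e0 /= /eqP]]]; first by exists (branch_prefix n x).
by rewrite eqseq_rcons => /andP[_ /eqP <-].
Qed.

End bounded_branches.

Lemma scheme_selection : exists B (z : X -> nat -> nat), [/\ measurable B, B `<=` D, (a <= mu B)%E,
  forall n j, measurable (B `&` [set x | z x n = j]) &
  forall x, B x -> forall N, F (mkseq (z x) N) x].
Proof.
have [tau tauP] := exists_big_bound.
exists (extendible tau [::]), (branch tau); split.
- exact: measurable_extendible.
- by move=> x [].
- exact: measure_extendible_nil.
- exact: measurable_branch.
- by move=> x ex N; exact: branch_solution.
Qed.

End scheme_selection.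

(** The point of the Baire space and the Souslin witness are merged into one sequence, at even and
    odd places. A branch of the resulting scheme provides both at once. *)
Lemma suslin_selection {d : measure_display} {X : measurableType d} {R : realType}
    (mu : {measure set X -> \bar R}) (E : set (X * (nat -> nat))) (D : set X) (a : \bar R) :
  suslin E -> measurable D -> (mu D < +oo)%E -> (a < mu D)%E ->
  {ae mu, forall x, D x -> exists s, E (x, s)} ->
  exists B (s : X -> nat -> nat), [/\ measurable B, B `<=` D, (a <= mu B)%E,
    forall n j, measurable (B `&` [set x | s x n = j]) & forall x, B x -> E (x, s x)].
Proof.
move=> [A [lA mA EE]] mD D_fin aD Dsol.
pose A1 n z := A n (fun i => z i.*2) (fun i => z i.*2.+1).
have lA1 n z : exists k, forall z', agree_upto k z z' -> A1 n z' = A1 n z.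
  have [k kP] := lA n (fun i => z i.*2) (fun i => z i.*2.+1).
  by exists (k + k)%N => z' zz'; apply: kP => i ik; apply: zz'; lia.
(* A finite prefix may not yet fix the n-th piece. Such a piece is left out of [F l] and enters at a
   longer prefix, which exists by local constancy. *)
pose determined n (l : seq nat) := forall z, agree_upto (size l) (nth 0%N l) z -> A1 n z = A1 n (nth 0%N l).
pose F l := \bigcap_(n in [set n | (n <= size l)%N /\ determined n l]) A1 n (nth 0%N l).
have F_branch z x : (forall N, F (mkseq z N) x) <-> forall n, A1 n z x.
  have agN N : agree_upto (size (mkseq z N)) (nth 0%N (mkseq z N)) z.
    by move=> i; rewrite size_mkseq => iN; rewrite nth_mkseq.
  split=> [Fz n|Az N n [/= _ dn]]; last by rewrite -(dn z).
  have [k kP] := lA1 n z.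
  have agk z' : agree_upto (maxn k n) (nth 0%N (mkseq z (maxn k n))) z' -> agree_upto k z z'.
    move=> h i ik; rewrite h; last by rewrite leq_max ik.
    by rewrite nth_mkseq // leq_max ik.
  have eqn : A1 n (nth 0%N (mkseq z (maxn k n))) = A1 n z by apply: kP; apply: agk.
  rewrite -eqn; apply: (Fz (maxn k n)); split; first by rewrite size_mkseq leq_maxr.
  by move=> z'; rewrite size_mkseq => /agk /kP ->.
have mF l : measurable (F l) by apply: bigcap_measurableType => n _; exact: mA.
have F_rcons l j : F (rcons l j) `<=` F l.
  move=> x Fx n [/= nl dn]; rewrite -(dn (nth 0%N (rcons l j))); last first.
    by move=> i il; rewrite nth_rcons il.
  apply: Fx; split; first by rewrite size_rcons; exact: leqW.
  move=> z zl; rewrite !dn //.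
    by move=> i il; rewrite nth_rcons il.
  by move=> i il; rewrite zl ?nth_rcons ?il // size_rcons; exact: leqW.
have [|B [z [mB BD aB mz zP]]] := @scheme_selection _ _ _ mu F D a mF F_rcons mD D_fin aD.
  apply: filterS Dsol => x sx /sx[s]; rewrite EE => -[r rP].
  exists (fun i => if odd i then r i./2 else s i./2); apply/F_branch => n.
  rewrite /A1 (_ : (fun i => _) = s); last by apply/funext => i; rewrite odd_double doubleK.
  rewrite (_ : (fun i => _) = r); first exact: rP.
  by apply/funext => i; rewrite /= odd_double /= uphalf_double.
exists B, (fun x i => z x i.*2); split=> //.
move=> x Bx; rewrite EE; exists (fun i => z x i.*2.+1).
by apply/F_branch; exact: zP.
Qed.

(** Given a dense sequence, every open set is a countable union of balls centred at its terms with
    radii 1 / (k + 1). *)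
Lemma measurable_borel_ball {d : measure_display} {Y : measurableType d} {R : realType}
    (V : normedModType R) (q : nat -> V) (D : set Y) (F : Y -> V) :
  (forall v e, 0 < e -> exists i, ball (q i) e v) ->
  (forall i e, 0 < e -> measurable (D `&` F @^-1` ball (q i) e)) ->
  measurable_fun D (F : Y -> borel_type V).
Proof.
move=> dq mb; apply: (@measurability _ _ Y (borel_type V) D F (@open V)); first by [].
move=> _ [G oG <-].
rewrite (_ : _ `&` _ = \bigcup_(p : nat * nat)
   if pselect (ball (q p.1) p.2.+1%:R^-1 `<=` G)
   then D `&` F @^-1` ball (q p.1) p.2.+1%:R^-1 else set0).
  apply: countable_bigcupT_measurable => // p; case: (pselect _) => ? /=; last exact: measurable0.
  by apply: mb; rewrite invr_gt0.
apply/seteqP; split=> [y [Dy Gy]|y [p _]]; last first.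
  by case: (pselect _) => //= pO [Dy Fy]; split => //; exact: pO.
have /nbhs_ballP[e /= e0 eO] := open_nbhs_nbhs (conj oG Gy).
have [n _ nP] := near_infty_natSinv_lt (PosNum (divr_gt0 e0 (ltr0Sn R 1))).
have {}nP : n.+1%:R^-1 < e / 2 :> R by apply: nP => /=.
have [|i qi] := dq (F y) n.+1%:R^-1; first by rewrite invr_gt0.
exists (i, n) => //=; case: (pselect _) => // -[]; move=> z qz; apply: eO.
have h : ball (q i) (e / 2) (F y) by apply: le_ball qi; exact: ltW.
have h' : ball (q i) (e / 2) z by apply: le_ball qz; exact: ltW.
by rewrite (splitr e); apply: (ball_triangle (ball_sym h)).
Qed.

Lemma dense_rV (R : realType) (m : nat) : exists q : nat -> 'rV[R]_m,
  forall v e, 0 < e -> exists i, ball (q i) e v.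
Proof.
exists (fun i => if (unpickle i : option 'rV[rat]_m) is Some c then map_mx ratr c else 0).
move=> v e e0.
have /choice[c cP] j : exists r : rat, ball (ratr r : R) e (v 0 j).
  have [r] := @rat_in_itvoo R (v 0 j - e) (v 0 j + e) ltac:(lra).
  rewrite in_itv /= => /andP[rl ru]; exists r; rewrite /ball /= ltr_norml.
  by apply/andP; split; lra.
exists (pickle (\row_j c j)); rewrite pickleK; split => // i j.
by rewrite !mxE ord1.
Qed.

Lemma dense_prod (R : realType) (V W : normedModType R) (q : nat -> V) (q' : nat -> W) :
  (forall v e, 0 < e -> exists i, ball (q i) e v) ->
  (forall v e, 0 < e -> exists i, ball (q' i) e v) ->
  exists p : nat -> (V * W)%type, forall v e, 0 < e -> exists i, ball (p i) e v.
Proof.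
move=> dq dq'; exists (fun i => if (unpickle i : option (nat * nat)) is Some (j, k)
  then (q j, q' k) else (0, 0)).
move=> [v w] e e0; have [j vj] := dq v e e0; have [k wk] := dq' w e e0.
by exists (pickle (j, k)); rewrite pickleK; split.
Qed.

Lemma measurable_continuous_borel (R : realType) (V : normedModType R) (g : V -> R) :
  continuous g -> measurable_fun setT (g : borel_type V -> R).
Proof.
move=> cg; apply: (@measurability _ _ _ _ _ _ _ (RGenOpens.measurableE R)).
move=> _ [_ [a [b ->]] <-]; rewrite setTI; apply: sub_sigma_algebra.
by apply: open_comp => // x _; exact: cg.
Qed.

Lemma continuous_coord_rV (R : realType) (m : nat) (j : 'I_m) :
  continuous (fun v : 'rV[R]_m => v 0 j).
Proof. by apply: coord_continuous. Qed.

Section measurable_rV.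
Context {d : measure_display} {Y : measurableType d} {R : realType} {m : nat}.

Lemma measurable_rV (D : set Y) (F : Y -> 'rV[R]_m) : measurable D ->
  (forall j, measurable_fun D (fun y => F y 0 j)) ->
  measurable_fun D (F : Y -> borel_type 'rV[R]_m).
Proof.
move=> mD mF; have [q dq] := dense_rV R m.
apply: (measurable_borel_ball dq) => i e e0.
rewrite (_ : _ `&` _ = D `&` \bigcap_(j in [set: 'I_m])
   (D `&` (fun y => F y 0 j) @^-1` `](q i 0 j - e), (q i 0 j + e)[%classic)).
  apply: measurableI => //; apply: fin_bigcap_measurable; first exact: finite_finset.
  by move=> j _; exact: mF.
apply/seteqP; split=> [y [Dy Fy]|y [Dy Fy]]; split=> //.
  move=> j _; split => //=; rewrite in_itv /=; have [_ /(_ 0 j)] := Fy.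
  by rewrite /ball /= ltr_norml => /andP[? ?]; apply/andP; split; lra.
split=> // k j; have [_ /=] := Fy j Logic.I; rewrite in_itv /= ord1 /ball /= ltr_norml.
by move=> /andP[? ?]; apply/andP; split; lra.
Qed.

Lemma measurable_rV_coord (D : set Y) (F : Y -> 'rV[R]_m) (j : 'I_m) :
  measurable_fun D (F : Y -> borel_type 'rV[R]_m) -> measurable_fun D (fun y => F y 0 j).
Proof.
move=> mF; apply: (@measurableT_comp _ _ _ _ _ _ (fun v : borel_type 'rV[R]_m => v 0 j)) => //.
by apply: measurable_continuous_borel; exact: continuous_coord_rV.
Qed.

End measurable_rV.

Lemma measurable_borel_pair {d : measure_display} {Y : measurableType d} {R : realType}
   (V W : normedModType R) (q : nat -> V) (q' : nat -> W) (D : set Y) (F : Y -> V) (G : Y -> W) :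
  (forall v e, 0 < e -> exists i, ball (q i) e v) ->
  (forall v e, 0 < e -> exists i, ball (q' i) e v) -> measurable D ->
  measurable_fun D (F : Y -> borel_type V) -> measurable_fun D (G : Y -> borel_type W) ->
  measurable_fun D ((fun y => (F y, G y)) : Y -> borel_type (V * W)%type).
Proof.
move=> dq dq' mD mF mG; have [p dp] := dense_prod dq dq'.
apply: (measurable_borel_ball dp) => i e e0.
rewrite (_ : _ `&` _ = (D `&` F @^-1` ball (p i).1 e) `&` (D `&` G @^-1` ball (p i).2 e)).
  apply: measurableI; [apply: mF|apply: mG] => //; apply: sub_sigma_algebra; exact: ball_open.
apply/seteqP; split=> [y [Dy [/= Fy Gy]]|y [[Dy Fy] [_ Gy]]]; split => //.
Qed.

Section baire_param.
Context {R : realType} {m : nat}.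

Definition rat_enum (k : nat) : R :=
  if (unpickle k : option rat) is Some r then ratr r else 0.

(** The terms of s at the codes of (j, k) list rational approximations of the j-th coordinate.
    Taking a lower limit makes the decoding total and measurable in each digit of s, while every
    vector is still reached. *)
Definition baire_rV (s : nat -> nat) : 'rV[R]_m :=
  \row_j fine (limn_einf (fun k => (rat_enum (s (pickle (val j, k))))%:E)).

Lemma baire_rV_surj v : exists s, baire_rV s = v.
Proof.
have /choice[c cP] (p : 'I_m * nat) : exists k, `|rat_enum k - v 0 p.1| < p.2.+1%:R^-1.
  have : 0 < p.2.+1%:R^-1 :> R by rewrite invr_gt0.
  move: (p.2.+1%:R^-1) => e e0.
  have [r] := @rat_in_itvoo R (v 0 p.1 - e) (v 0 p.1 + e) ltac:(lra).
  rewrite in_itv /= => /andP[rl ru]; exists (pickle r); rewrite /rat_enum pickleK ltr_norml.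
  by apply/andP; split; lra.
exists (fun k => if (unpickle k : option (nat * nat)) is Some (j, k')
  then (if insub j is Some j' then c (j', k') else 0%N) else 0%N).
apply/rowP => j; rewrite mxE.
have -> : (fun k => (rat_enum (if (unpickle (pickle (val j, k)) : option (nat * nat)) is Some (j, k')
  then (if insub j is Some j' then c (j', k') else 0%N) else 0%N))%:E) =
  (fun k => (rat_enum (c (j, k)))%:E).
  by apply/funext => k; rewrite pickleK valK.
rewrite (cvg_limn_einf_sup (l := (v 0 j)%:E)) //.
apply/fine_cvgP; split; first exact: nearW.
apply/cvgrPdist_lt => e e0; have [n _ nP] := near_infty_natSinv_lt (PosNum e0).
by exists n => // k /= nk; rewrite distrC; apply: lt_trans (cP (j, k)) (nP _ nk).
Qed.

Lemma measurable_baire_rV {d : measure_display} {Y : measurableType d} (D : set Y)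
    (z : Y -> nat -> nat) : measurable D ->
  (forall n j, measurable (D `&` [set y | z y n = j])) ->
  measurable_fun D ((fun y => baire_rV (z y)) : Y -> borel_type 'rV[R]_m).
Proof.
move=> mD mz; apply: measurable_rV => // j.
under eq_fun do rewrite mxE.
apply: measurableT_comp => //; apply: measurable_fun_limn_einf => k; apply/measurable_EFinP.
move=> _ B mB; rewrite (_ : _ `&` _ = \bigcup_(i in [set i | B (rat_enum i)])
  (D `&` [set y | z y (pickle (val j, k)) = i])).
  by apply: bigcup_measurable => i _.
apply/seteqP; split=> [y [Dy By]|y [i /= Bi [Dy zy]]]; last by split=> //=; rewrite zy.
by exists (z y (pickle (val j, k))).
Qed.

End baire_param.

Section measurable_selection.
Context {d : measure_display} {X : measurableType d} {R : realType} {m : nat}.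
Variable mu : {measure set X -> \bar R}.
Local Notation V := 'rV[R]_m.
Variable E : set (X * V).
Hypothesis mE : measurable (E : set (X * borel_type V)).

(** The decoding is measurable for the sigma-algebra of bisuslin sets, so preimages of all
    product-measurable sets lie in it; no description of E beyond measurability is required. *)
Lemma suslin_preimage : suslin [set p : X * (nat -> nat) | E (p.1, baire_rV p.2)].
Proof.
pose Z := g_sigma_algebraType (@bisuslin d X).
suff : measurable ([set p : X * (nat -> nat) | E (p.1, baire_rV p.2)] : set Z).
  by rewrite /measurable /= sigma_algebra_id => [[]|]; last exact: bisuslin_sigma_algebra.
have mpair : measurable_fun setT ((fun p => (p.1, baire_rV p.2)) : Z -> X * borel_type V).
  apply: measurable_fun_pair.
    move=> _ B mB; rewrite setTI; apply: sub_sigma_algebra.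
    exact: (@bisuslin_loc_const _ _ (fun=> B) 0%N).
  apply: measurable_baire_rV => // n j; rewrite setTI; apply: sub_sigma_algebra.
  rewrite (_ : [set y | _] = [set p | (if p.2 n == j then setT else set0) p.1]); last first.
    by apply/seteqP; split=> p /=; [move=> ->; rewrite eqxx|case: eqP].
  apply: (@bisuslin_loc_const _ _ (fun s => if s n == j then setT else set0) n.+1) => [s s' ss'|s].
    by rewrite ss'.
  by case: ifP.
have := mpair measurableT _ mE; rewrite setTI; exact.
Qed.

Lemma selection_piece (D : set X) (a : \bar R) :
  measurable D -> (mu D < +oo)%E -> (a < mu D)%E ->
  {ae mu, forall x, D x -> exists v, E (x, v)} ->
  exists B (u : X -> V), [/\ measurable B, B `<=` D, (a <= mu B)%E,
    measurable_fun B (u : X -> borel_type V) & forall x, B x -> E (x, u x)].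
Proof.
move=> mD D_fin aD Dsol.
have [|B [s [mB BD aB ms sE]]] := suslin_selection suslin_preimage mD D_fin aD.
  by apply: filterS Dsol => x sx /sx[v Ev]; have [s sv] := baire_rV_surj v; exists s => /=; rewrite sv.
exists B, (fun x => baire_rV (s x)); split=> //; first exact: measurable_baire_rV.
Qed.

(* Aumann's measurable selection theorem. *)
Lemma measurable_selection (Dl : nat -> set X) :
  (forall l, measurable (Dl l)) -> (forall l, (mu (Dl l) < +oo)%E) ->
  {ae mu, forall x, (\bigcup_l Dl l) x -> exists v, E (x, v)} ->
  exists u : X -> V, measurable_fun setT (u : X -> borel_type V) /\
    {ae mu, forall x, (\bigcup_l Dl l) x -> E (x, u x)}.
Proof.
move=> mDl Dl_fin Dsol.
(* Each piece misses at most 1 / (k + 1) of the measure of [Dl l], so that all pieces together cover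
   [Dl l] up to a null set. *)
have pieces (p : nat * nat) : exists Bu : set X * (X -> V), [/\ measurable Bu.1,
    (mu (Dl p.1) - p.2.+1%:R^-1%:E <= mu Bu.1)%E, Bu.1 `<=` Dl p.1,
    measurable_fun Bu.1 (Bu.2 : X -> borel_type V) & forall x, Bu.1 x -> E (x, Bu.2 x)].
  have [||||B [u [mB BD aB mu_ sE]]] := @selection_piece (Dl p.1) (mu (Dl p.1) - p.2.+1%:R^-1%:E)%E.
  - exact: mDl.
  - exact: Dl_fin.
  - by rewrite lteBlDr // lteDl ?lte_fin ?invr_gt0 // ge0_fin_numE.
  - by apply: filterS Dsol => x sx Dx; apply: sx; exists p.1.
  by exists (B, u).
have [Bu BuP] := choice pieces.
pose C k := if (unpickle k : option (nat * nat)) is Some p then (Bu p).1 else set0.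
pose w k := if (unpickle k : option (nat * nat)) is Some p then (Bu p).2 else (fun=> 0).
have mC k : measurable (C k) by rewrite /C; case: unpickle => // p; case: (BuP p).
have mw k : measurable_fun (C k) (w k : X -> borel_type V).
  by rewrite /C /w; case: unpickle => [p|]; [case: (BuP p)|exact: measurable_fun_set0].
have wE k x : C k x -> E (x, w k x).
  by rewrite /C /w; case: unpickle => [p|//]; case: (BuP p) => _ _ _ _; exact.
pose u x : V := if pselect (exists k, `[< C k x >]) is left ex then w (ex_minn ex) x else 0.
have uw k : {in seqDU C k, w k =1 u}.
  move=> x; rewrite inE => -[Cx]; rewrite -bigcup_mkord => nCx; rewrite /u; case: pselect => [ex|[]]; last first.
    by exists k; apply/asboolP.
  case: ex_minnP => i /asboolP Ci imin; congr (w _ x); apply/eqP; rewrite eqn_leq.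
  rewrite imin ?asboolT // andbT leqNgt; apply/negP => ik; apply: nCx.
  by exists i.
have mS k : measurable (seqDU C k).
  by apply: measurableD => //; exact: bigsetU_measurable.
have mU : measurable (\bigcup_k C k) by exact: bigcupT_measurable.
exists u; split.
  rewrite -(setUv (\bigcup_k C k)); apply/measurable_funU => //; first exact: measurableC.
  split.
    rewrite seqDU_bigcup_eq; apply/measurable_fun_bigcup => k; first exact: mS.
    apply: (@eq_measurable_fun _ _ X (borel_type V) _ (w k) u (uw k)).
    apply: measurable_funS (mw k) => //.
    exact: subset_seqDU.
  apply: (@eq_measurable_fun _ _ X (borel_type V) _ (cst 0) u) => // x; rewrite inE => nC.
  rewrite /u; case: (pselect _) => ex //; case: nC.
  by case: ex => k /asboolP Ck; exists k.
have uE x : (\bigcup_k C k) x -> E (x, u x).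
  move=> [k _ Ck]; rewrite /u; case: pselect => [ex|[]]; last by exists k; apply/asboolP.
  by case: ex_minnP => i /asboolP Ci _; exact: wE.
have neg l : mu.-negligible (Dl l `\` \bigcup_k C k).
  apply/negligibleP; first exact: measurableD.
  apply/eqP; rewrite eq_le measure_ge0 andbT; apply/lee_addgt0Pr => e e0; rewrite add0e.
  have [n _ nP] := near_infty_natSinv_lt (PosNum e0).
  have [mB aB BD _ _] := BuP (l, n).
  apply: (@le_trans _ _ (mu (Dl l `\` (Bu (l, n)).1))).
    apply: le_measure; rewrite ?inE; [exact: measurableD|exact: measurableD|].
    by move=> x [Dx nC]; split=> // Bx; apply: nC; exists (pickle (l, n)) => //; rewrite /C pickleK.
  rewrite measureD //= setIidr //.
  apply: (@le_trans _ _ n.+1%:R^-1%:E); last by rewrite lee_fin; apply/ltW/nP => /=.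
  rewrite leeBlDr; last by rewrite ge0_fin_numE //; apply: le_lt_trans (Dl_fin l); apply: le_measure; rewrite ?inE.
  by rewrite addeC -leeBlDr //; exact: aB.
have := negligible_bigcup neg; apply: negligibleS => x /= /not_implyP[[l _ Dx] nE].
by exists l => //; split => // Cx; apply: nE; exact: uE.
Qed.

End measurable_selection.

(** * Absolutely continuous functions *)

Section lebesgue_borel.
Context {R : realType}.
Local Notation LT := (lebesgue_type R).
Local Notation BT := (measurableTypeR R).
Local Notation lambda := (@lebesgue_measure R).

Lemma lebE (A : set R) : leb R A = lambda A. Proof. by []. Qed.

Lemma leb_complete : measure_is_complete (leb R).
Proof. exact: completed_lebesgue_measure_is_complete. Qed.

Lemma borel_lebesgue (A : set R) : measurable (A : set BT) -> measurable (A : set LT).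
Proof. exact: sub_caratheodory. Qed.

Definition to_borel (x : LT) : BT := x.

Lemma measurable_to_borel : measurable_fun setT to_borel.
Proof. by move=> _ B mB; rewrite setTI; exact: borel_lebesgue. Qed.

Lemma lebesgue_borelU_negligible (A : set R) : measurable (A : set LT) ->
  exists B N, [/\ measurable (B : set BT), lambda.-negligible N & B `|` N = A].
Proof.
rewrite -completed_caratheodory_measurable g_sigma_completed_algebra_genE.
by move=> [B mB [N nN BN]]; exists B, N.
Qed.

Lemma leb_negligibleP (N : set R) : (leb R).-negligible N <-> lambda.-negligible N.
Proof.
split=> [[A [mA A0 NA]]|[A [mA A0 NA]]]; last first.
  by exists A; split => //; exact: borel_lebesgue.
have [B [M [mB nM BM]]] := lebesgue_borelU_negligible mA.
apply: (@negligibleS _ BT R lambda A N NA); rewrite -BM; apply: negligibleU => //.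
exists B; split => //; apply/eqP; rewrite eq_le measure_ge0 andbT.
apply: (@le_trans _ _ (leb R A)); last by rewrite A0.
apply: (@le_measure _ _ LT (leb R) B A); rewrite ?inE //; first exact: borel_lebesgue.
by rewrite -BM; exact: subsetUl.
Qed.

Lemma leb_aeP (P : R -> Prop) : {ae leb R, forall x, P x} <-> {ae lambda, forall x, P x}.
Proof. exact: leb_negligibleP. Qed.

Lemma ge0_integral_leb (D : set R) (f : R -> \bar R) : measurable (D : set BT) ->
  measurable_fun (D : set BT) f -> (forall x, D x -> (0 <= f x)%E) ->
  (\int[leb R]_(x in D) f x = \int[lambda]_(x in D) f x)%E.
Proof.
move=> mD mf f0.
have := @ge0_integral_pushforward _ _ _ _ _ _ measurable_to_borel (leb R) D f mD mf
  (fun x Dx => f0 x (set_mem Dx)).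
rewrite (eq_measure_integral lambda) => [h| |? A _ _]; last exact: lebE.
  have DE : to_borel @^-1` D = D by [].
  by rewrite h DE; apply: eq_integral.
exact: measurable_to_borel.
Qed.

Lemma integral_leb (D : set R) (f : R -> \bar R) : measurable (D : set BT) ->
  measurable_fun (D : set BT) f ->
  (\int[leb R]_(x in D) f x = \int[lambda]_(x in D) f x)%E.
Proof.
move=> mD mf; rewrite [LHS]integralE [RHS]integralE; congr (_ - _)%E.
- by apply: ge0_integral_leb => //; exact: measurable_funepos.
- by apply: ge0_integral_leb => //; exact: measurable_funeneg.
Qed.

(** Each rational sublevel set is Borel up to a null set. The countably many exceptional sets lie in
    one Borel null set, on which h is replaced by 0. *)
Lemma lebesgue_fun_borel (h : R -> R) : measurable_fun setT (h : LT -> R) ->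
  exists h' : R -> R, measurable_fun setT (h' : BT -> R) /\ {ae lambda, forall x, h x = h' x}.
Proof.
move=> mh.
have /choice[BN BNP] (r : rat) : exists BN : set R * set R,
    [/\ measurable (BN.1 : set BT), lambda.-negligible BN.2 &
        BN.1 `|` BN.2 = [set x | h x < ratr r]].
  have [|B [N BNr]] := @lebesgue_borelU_negligible [set x | h x < ratr r].
    rewrite -[X in measurable X]setTI (_ : [set x | _] = h @^-1` `]-oo, ratr r[%classic).
      exact: mh.
    by apply/seteqP; split=> x /=; rewrite in_itv.
  by exists (B, N).
have : lambda.-negligible (\bigcup_k if (unpickle k : option rat) is Some r then (BN r).2 else set0).
  apply: negligible_bigcup => k; case: unpickle => [r|]; first by case: (BNP r).
  exact: negligible_set0.
move=> [M [mM M0 NM]].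
have BM r x : ~ M x -> (BN r).1 x <-> h x < ratr r.
  move=> nM; have [_ _ E] := BNP r; have -> : (h x < ratr r) = [set x | h x < ratr r] x :> Prop by [].
  rewrite -E; split=> [|[//|Nx]]; first by left.
  exfalso; apply: nM; apply: NM; exists (pickle r); first by [].
  by rewrite pickleK.
pose h' := patch (fun=> 0) (~` M) h : R -> R.
exists h'; split; last first.
  exists M; split => // x /= hh'; apply: contrapT => nM; apply: hh'.
  by rewrite /h' patchE mem_set.
apply/(measurable_restrictT _ (measurableC mM)).
apply: (@measurability _ _ BT R (~` M) h _ (RGenInftyO.measurableE R)).
move=> _ [_ [c ->] <-].
rewrite (_ : _ `&` _ = ~` M `&` \bigcup_(r in [set r : rat | ratr r <= c]) (BN r).1).
  apply: measurableI; first exact: measurableC.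
  rewrite bigcup_mkcond; apply: countable_bigcupT_measurable => // r.
  by case: ifP => // _; case: (BNP r).
apply/seteqP; split=> [x [nM /=]|x [nM [r /= rc /(BM r x nM)]]]; last first.
  by split=> //=; rewrite in_itv /=; exact: lt_le_trans rc.
rewrite in_itv /= => hc; split=> //.
have [r] := rat_in_itvoo hc; rewrite in_itv /= => /andP[hr rc].
by exists r => /=; [exact: ltW|apply/BM].
Qed.

End lebesgue_borel.

Section zero_derivative.
Context {R : realType}.
Implicit Types (a b c e t u w : R) (y : R -> R).

Lemma zero_derivative_near y c e : 0 < e -> is_derive c (1 : R) y 0 ->
  exists2 d, 0 < d & forall t, `|t - c| < d -> `|y t - y c| <= e * `|t - c|.
Proof.
move=> e0 [dy dy0].
have : h^-1 *: ((y \o shift c) (h *: (1 : R)) - y c) @[h --> 0^'] --> 'D_1 y c by exact: dy.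
rewrite dy0 => /cvgrPdist_lt /(_ _ e0) /nbhs_ballP[d /= d0 dP].
exists d => // t td; have [->|tc] := eqVneq t c; first by rewrite !subrr normr0 mulr0.
have tc0 : t - c != 0 by rewrite subr_eq0.
have := dP (t - c); rewrite /ball /= sub0r normrN => /(_ td tc0).
rewrite /shift /= [_ *: (1 : R)]mulr1 subrK sub0r normrN normrZ normfV => h.
by rewrite mulrC -ler_pdivrMl ?normr_gt0 // ltW.
Qed.

Definition ordered_intervals (G : set R) a b (l : seq (R * R)) : Prop :=
  (forall p, p \in l -> [/\ a <= p.1, p.1 <= p.2, p.2 <= b & `]p.1, p.2[%classic `<=` G]) /\
  pairwise (fun p q : R * R => p.2 <= q.1) l.

Lemma ordered_intervals_nth G a b l (i : 'I_(size l)) : ordered_intervals G a b l ->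
  let p := nth (0, 0) l i in [/\ a <= p.1, p.1 <= p.2, p.2 <= b & `]p.1, p.2[%classic `<=` G].
Proof. by move=> [lP _]; apply: lP; exact: mem_nth. Qed.

Lemma ordered_intervals_trivIset G a b l : ordered_intervals G a b l ->
  trivIset [set: nat] (fun i => `](nth (0, 0) l i).1, (nth (0, 0) l i).2[%classic).
Proof.
move=> [_ /(pairwiseP (0, 0)) lP]; apply/trivIsetP.
suff disj i j : (i < j)%N ->
    `](nth (0, 0) l i).1, (nth (0, 0) l i).2[%classic `&`
    `](nth (0, 0) l j).1, (nth (0, 0) l j).2[%classic = set0.
  move=> i j _ _; rewrite neq_ltn => /orP[|] ij; first exact: disj.
  by rewrite setIC; exact: disj.
move=> ij; apply/seteqP; split=> // x []; rewrite /= !in_itv /= => /andP[_ x1] /andP[x2 x3].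
have [jl|lj] := ltnP j (size l); last by move: (lt_trans x2 x3); rewrite nth_default //= ltxx.
have := lP i j; rewrite !inE jl (ltn_trans ij jl) => /(_ isT isT ij) le12.
by have := lt_trans (lt_le_trans x1 le12) x2; rewrite ltxx.
Qed.

Lemma ordered_intervals_length (G : set R) a b l :
  measurable (G : set (measurableTypeR R)) -> ordered_intervals G a b l ->
  ((\sum_(i < size l) ((nth (0, 0) l i).2 - (nth (0, 0) l i).1))%:E <= lebesgue_measure G)%E.
Proof.
move=> mG lP; pose F i : set R := `](nth (0, 0) l i).1, (nth (0, 0) l i).2[%classic.
apply: (@le_trans _ _ (lebesgue_measure (\big[setU/set0]_(i < size l) F i))).
  rewrite measure_bigsetU; last 2 first.
  - by move=> i; exact: measurable_itv.
  - exact: ordered_intervals_trivIset lP.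
  rewrite -sumEFin; apply: lee_sum => i _.
  have [_ p12 _ _] := ordered_intervals_nth i lP.
  apply: (@le_trans _ _ (@lebesgue_measure R (F i))) => //.
  rewrite /F lebesgue_measure_itv /= lte_fin; case: ifPn => // p21.
  by rewrite lee_fin subr_le0 leNgt.
apply: (@le_measure _ _ (measurableTypeR R) lebesgue_measure); rewrite ?inE //.
  by apply: bigsetU_measurable => i _; exact: measurable_itv.
rewrite -bigcup_mkord => x [i /= il].
by have [_ _ _] := ordered_intervals_nth (Ordinal il) lP; exact.
Qed.

(* Cousin-type argument: up to [e * length], the increment of [y] is carried by
   disjoint intervals inside a small open set containing the bad points. *)
Lemma ac_zero_derivative y a b : a <= b -> abs_continuous_on a b y ->
  {ae leb R, forall t, a <= t -> t <= b -> is_derive t (1 : R) y 0} -> y b = y a.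
Proof.
move=> ab acy ae0; apply/eqP; rewrite -subr_eq0 -normr_le0.
apply/ler_addgt0Pr => e0 e0_gt0; rewrite add0r.
pose e := e0 / (b - a + 1).
have ba1 : 0 < b - a + 1 by rewrite ltr_wpDl // subr_ge0.
have e_gt0 : 0 < e by rewrite divr_gt0.
have [d d_gt0 dP] := acy e e_gt0.
have /leb_negligibleP[M [mM M_null NM]] := ae0.
have M0 : @lebesgue_measure R M = 0%E := M_null.
have M_fin : (@lebesgue_measure R M < +oo)%E by rewrite M0.
have [G [oG MG GMd]] := lebesgue_regularity_outer mM M_fin d_gt0.
have mG : measurable (G : set (measurableTypeR R)) by exact: open_measurable.
have Gd : (lebesgue_measure G < d%:E)%E.
  apply: le_lt_trans GMd; rewrite -{1}(setDUK MG).
  apply: le_trans (measureU2 _ mM (measurableD mG mM)) _.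
  by rewrite [X in (X + _)%E](_ : _ = 0%E) ?add0e.
have step c : a <= c -> c <= b -> exists2 dl, 0 < dl & forall u w, c - dl < u -> u <= c ->
    c <= w -> w < c + dl -> `|y w - y u| <= e * (w - u) \/ `]u, w[%classic `<=` G.
  move=> ac cb; have [Gc|nGc] := pselect (G c).
    have /nbhs_ballP[dl /= dl0 dlG] := open_nbhs_nbhs (conj oG Gc).
    exists dl => // u w cu uc cw wc; right => x; rewrite /= in_itv /= => /andP[ux xw].
    by apply: dlG; rewrite /ball /= ltr_norml; apply/andP; split; lra.
  have dc : is_derive c (1 : R) y 0.
    by apply: contrapT => nd; apply/nGc/MG/NM => /= h; apply: nd; exact: h.
  have [dl dl0 dlP] := zero_derivative_near e_gt0 dc.
  exists dl => // u w cu uc cw wc; left.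
  have hw : `|y w - y c| <= e * (w - c).
    by have := dlP w; rewrite ger0_norm ?subr_ge0 //; apply; lra.
  have hu : `|y u - y c| <= e * (c - u).
    by have := dlP u; rewrite distrC ger0_norm ?subr_ge0 //; apply; lra.
  rewrite distrC in hu; have := le_trans (ler_normD _ _) (lerD hw hu).
  by rewrite addrA subrK; move=> /le_trans; apply; lra.
pose Pl c := exists l, ordered_intervals G a c l /\
  `|y c - y a| <= e * (c - a) + \sum_(i < size l) `|y (nth (0, 0) l i).2 - y (nth (0, 0) l i).1|.
have Pa : Pl a by exists [::]; split; [|rewrite big_ord0 !subrr normr0 mulr0 addr0].
have oi_weak u w l : u <= w -> ordered_intervals G a u l -> ordered_intervals G a w l.
  move=> uw [lP pl]; split=> // p /lP[? ? pu ?]; split => //; exact: le_trans uw.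
have extend u w : a <= u -> u <= w -> Pl u ->
    `|y w - y u| <= e * (w - u) \/ `]u, w[%classic `<=` G -> Pl w.
  move=> au uw [l [lP yl]] [yw|wG].
    exists l; split; first exact: oi_weak lP.
    rewrite -(subrK (y u) (y w)) -addrA.
    by apply: le_trans (ler_normD _ _) _; lra.
  exists (rcons l (u, w)); split.
    have [lP1 lP2] := lP; split.
      move=> p; rewrite mem_rcons inE => /orP[/eqP ->|/lP1[? ? pu ?]]; split => //=.
      exact: le_trans uw.
    rewrite pairwise_rcons lP2 andbT; apply/allP => p /lP1[_ _ pu _]; exact: pu.
  rewrite size_rcons big_ord_recr /= nth_rcons ltnn eqxx /=.
  rewrite (eq_bigr (fun i : 'I_(size l) => `|y (nth (0, 0) l i).2 - y (nth (0, 0) l i).1|)); last first.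
    by move=> i _; rewrite nth_rcons ltn_ord.
  rewrite -(subrK (y u) (y w)) -addrA subrK.
  have : e * (u - a) <= e * (w - a) by rewrite ler_pM2l // lerD2r.
  by have := ler_normD (y w - y u) (y u - y a); lra.
have Pb : Pl b.
  (* [step] applied at the supremum of S connects a point of S just before it to a point beyond it,
     unless the supremum is b. *)
  pose S := [set c | [/\ a <= c, c <= b & Pl c]].
  have Sa : S a by split.
  have supS : has_sup S by split; [exists a|exists b => c []].
  have aS : a <= sup S by apply: ub_le_sup => //; case: supS.
  have Sb : sup S <= b by apply: ge_sup => [|c []]; [exists a|].
  have [dl dl0 dlP] := step _ aS Sb.
  have [u [au ub Pu] ult] := sup_adherent dl0 supS.
  have uS : u <= sup S by apply: ub_le_sup; [case: supS|split].
  pose w := Num.min b (sup S + dl / 2).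
  have Sw : sup S <= w by rewrite le_min Sb /=; lra.
  have wS : w < sup S + dl by rewrite gt_min; apply/orP; right; lra.
  have Pw : Pl w by apply: extend (dlP u w ult uS Sw wS) => //; exact: le_trans Sw.
  have : w <= sup S.
    by apply: ub_le_sup; [case: supS|split => //; [exact: le_trans Sw|rewrite ge_min lexx]].
  rewrite /w ge_min => /orP[bS|]; last by lra.
  by have <- : w = b by apply/eqP; rewrite eq_le ge_min lexx /= le_min lexx /=; lra.
have [l [lP yl]] := Pb.
have : \sum_(i < size l) `|y (nth (0, 0) l i).2 - y (nth (0, 0) l i).1| < e.
  apply: (dP (size l) (fun i => (nth (0, 0) l i).1) (fun i => (nth (0, 0) l i).2)).
  - by move=> i; have [] := ordered_intervals_nth i lP.
  - apply/trivIsetP => i j _ _ ij.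
    by have /trivIsetP/(_ i j Logic.I Logic.I ij) := ordered_intervals_trivIset lP.
  - by rewrite -lte_fin; apply: le_lt_trans (ordered_intervals_length mG lP) Gd.
have eE : e * (b - a) + e = e0 by rewrite /e; field; rewrite gt_eqF.
by move: yl; lra.
Qed.

End zero_derivative.

(** Split |h| at a height M. The excess over M has small integral on all of D by dominated
    convergence, and the rest contributes at most M times the measure of E. *)
Lemma integral_small_sets {d : measure_display} {T : measurableType d} {R : realType}
    (mu : {measure set T -> \bar R}) (D : set T) (h : T -> R) (e : R) :
  measurable D -> mu.-integrable D (EFin \o h) -> 0 < e ->
  exists2 dl : R, 0 < dl & forall E, measurable E -> E `<=` D -> (mu E < dl%:E)%E ->
    (\int[mu]_(x in E) `|h x|%:E < e%:E)%E.
Proof.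
move=> mD ih e0.
have mh : measurable_fun D h by apply/measurable_EFinP; exact: measurable_int ih.
have mabs : measurable_fun D (fun x => `|h x|) by exact: measurableT_comp.
pose big M x : R := Num.max (`|h x| - M%:R) 0.
have mbig M : measurable_fun D (big M).
  by apply: measurable_maxr => //; exact: measurable_funB.
have big_ge0 M x : 0 <= big M x by rewrite /big le_max lexx orbT.
have big_le M x : `|big M x| <= `|h x|.
  by rewrite ger0_norm // /big ge_max normr_ge0 andbT gerBl.
have : \int[mu]_(x in D) big M x @[M --> \oo] --> \int[mu]_(x in D) (fun=> 0) x.
  apply: (@cvgn_Rintegral_dominated _ _ _ _ _ _ _ (fun x => `|h x|)) => //.
  - apply: aeW => x Dx; apply: cvg_near_cst.
    exists (Num.bound `|h x|) => // M /= hM; rewrite /big max_r // subr_le0.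
    by apply: ltW; apply: lt_le_trans (archi_boundP _) _; rewrite ?ler_nat.
  - exact: integrable_norm.
  - exact: aeW.
rewrite Rintegral_cst // mul0r => /cvgrPdist_lt /(_ (e / 2)) [|M _ MP]; first by rewrite divr_gt0.
have {MP}bigM : `|\int[mu]_(x in D) big M x| < e / 2.
  by have := MP M (leqnn M); rewrite sub0r normrN.
exists (e / 2 / (M%:R + 1)); first by rewrite !divr_gt0 // ltr_wpDl.
move=> E mE ED muE.
have ibig : mu.-integrable D (EFin \o big M).
  apply: le_integrable (integrable_norm ih) => //; first exact/measurable_EFinP.
  by move=> x _ /=; rewrite lee_fin normr_id.
apply: (@le_lt_trans _ _ (\int[mu]_(x in E) ((big M x)%:E + M%:R%:E))%E).
  apply: ge0_le_integral => //.
  - by apply/measurable_EFinP; exact: measurable_funS mabs.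
  - apply: emeasurable_funD => //; apply/measurable_EFinP; exact: measurable_funS (mbig M).
  - move=> x _; by rewrite -EFinD lee_fin -lerBlDr /big le_max lexx.
rewrite ge0_integralD //; last 2 first.
- by move=> x _; rewrite lee_fin.
- by apply/measurable_EFinP; exact: measurable_funS (mbig M).
have -> : e%:E = ((e / 2)%:E + (e / 2)%:E)%E by rewrite -EFinD; congr EFin; field.
have muE0 : mu E \is a fin_num by rewrite ge0_fin_numE //; apply: lt_trans muE _; exact: ltry.
apply: lte_leD.
- rewrite integral_cst // -[mu E]fineK // fin_numM //.
- apply: (@le_lt_trans _ _ (\int[mu]_(x in D) (big M x)%:E)%E).
    apply: ge0_subset_integral => //; first exact/measurable_EFinP.
    by move=> x _; rewrite lee_fin.
  rewrite -[X in (X < _)%E]fineK ?integrable_fin_num // lte_fin.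
  by apply: le_lt_trans bigM; exact: ler_norm.
rewrite integral_cst //; move: muE; rewrite -[mu E]fineK // lte_fin => muE.
rewrite -EFinM lee_fin.
apply: (@le_trans _ _ (M%:R * (e / 2 / (M%:R + 1)))); first by rewrite ler_wpM2l // ltW.
by rewrite mulrA ler_pdivrMr ?ltr_wpDl // mulrC ler_wpM2l ?divr_ge0 ?(ltW e0) // lerDl.
Qed.

Section borel_primitive.
Context {R : realType}.
Local Notation lambda := (@lebesgue_measure R).
Variable h : R -> R.
Hypotheses (h_neg : forall x, x < 0 -> h x = 0)
  (ih : forall T, 0 < T -> lambda.-integrable `[0, T] (EFin \o h))
  (mh : measurable_fun setT h).

Let F t : R := \int[lambda]_(x in `[0, t]) h x.

Lemma primitive_increment s r : 0 <= s -> s <= r ->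
  (`|F r - F s|%:E <= \int[lambda]_(x in `]s, r[) `|h x|%:E)%E.
Proof.
move=> s0 sr; have ir : lambda.-integrable `[0, r] (EFin \o h).
  apply: integrableS (ih (ltr_wpDl (le_trans s0 sr) (@ltr01 R))) => //.
  by apply: subset_itvl; rewrite bnd_simp lerDl.
have -> : F r - F s = \int[lambda]_(x in `]s, r]) h x.
  by rewrite /F Rintegral_itvB ?bnd_simp.
have isr : lambda.-integrable `]s, r] (EFin \o h).
  by apply: integrableS ir => //; apply: subset_itvr; rewrite bnd_simp.
have ma A : measurable_fun A (fun x => `|h x|%:E).
  by apply/measurable_EFinP; apply: measurableT_comp => //; exact: measurable_funTS.
rewrite integral_itv_bndo_bndc //.
apply: (@le_trans _ _ (\int[lambda]_(x in `]s, r]) `|h x|)%:E).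
  by rewrite lee_fin; exact: le_normr_Rintegral.
rewrite /Rintegral fineK //; apply: integrable_fin_num => //.
exact: (integrable_norm isr).
Qed.

Lemma primitive_ac a b : 0 <= a -> a <= b -> abs_continuous_on a b F.
Proof.
move=> a0 ab e e0.
have b1 : 0 < b + 1 by rewrite ltr_wpDl // (le_trans a0).
have mI : measurable (`[0, b + 1]%classic : set (measurableTypeR R)) by exact: measurable_itv.
have [dl dl0 dlP] := integral_small_sets mI (ih b1) e0.
exists dl => // k s r sr trI sum_lt.
have F_mono (c : R -> \bar R) : measurable_fun setT c -> (forall x, (0 <= c x)%E) ->
   (\int[lambda]_(x in \big[setU/set0]_(i <- index_enum 'I_k) `]s i, r i[%classic) c x =
    \sum_(i <- index_enum 'I_k) \int[lambda]_(x in `]s i, r i[%classic) c x)%E.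
  move=> mc c0; rewrite ge0_integral_bigsetU //.
  - exact: index_enum_uniq.
  - by apply: sub_trivIset trI => i _.
  - exact: measurable_funTS.
rewrite -lte_fin; apply: (@le_lt_trans _ _
    (\sum_(i < k) \int[lambda]_(x in `]s i, r i[%classic) `|h x|%:E)%E).
  rewrite -sumEFin; apply: lee_sum => i _; have [as_ [sr_ rb]] := sr i.
  by apply: primitive_increment => //; exact: le_trans as_.
have mU : measurable (\big[setU/set0]_(i <- index_enum 'I_k) `]s i, r i[%classic : set (measurableTypeR R)).
  by apply: bigsetU_measurable => i _; exact: measurable_itv.
rewrite -F_mono //; last by apply/measurable_EFinP; exact: measurableT_comp.
apply: dlP => //.
  rewrite -bigcup_seq => x [i _] /=; rewrite !in_itv /= => /andP[sx xr].
  have [as_ [sr_ rb]] := sr i.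
  by apply/andP; split; [apply: le_trans a0 (le_trans as_ (ltW sx))|lra].
apply: (@le_lt_trans _ _ (\int[lambda]_(x in \big[setU/set0]_(i <- index_enum 'I_k)
    `]s i, r i[%classic) (cst 1%:E) x)%E).
  by rewrite integral_cst // mul1e.
rewrite F_mono // -lte_fin in sum_lt *; apply: le_lt_trans sum_lt.
rewrite -sumEFin; apply: lee_sum => i _; rewrite integral_cst // mul1e.
apply: (@le_trans _ _ (lambda `]s i, r i[%classic)) => //.
rewrite lebesgue_measure_itv /= lte_fin; case: ifPn => // _.
by rewrite lee_fin subr_ge0; have [_ []] := sr i.
Qed.

(** Since h vanishes on the negative half-line, integrability on the intervals from 0 makes it
    locally integrable on the whole line, where Lebesgue's differentiation theorem applies. *)
Lemma primitive_derive : {ae lambda, forall t : R, 0 < t -> is_derive t (1 : R) F (h t)}.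
Proof.
have loc : locally_integrable setT h.
  split => //; first exact: openT.
  move=> K _ /[dup] cK /compact_bounded[M [_ MP]].
  have mK := compact_measurable cK.
  pose N := Num.max (M + 1) 1.
  have N0 : 0 < N by rewrite lt_max ltr01 orbT.
  have KN x : K x -> x <= N.
    move=> Kx; apply: le_trans (ler_norm x) _; apply: MP => //.
    by rewrite lt_max ltrDl ltr01.
  pose hN : R -> \bar R := (fun x : R => `|h x|%:E) \_ `[0, N]%classic.
  rewrite (_ : (\int[lambda]_(x in K) _ = \int[lambda]_(x in K) hN x)%E); last first.
    apply: eq_integral => x; rewrite inE => Kx; rewrite /hN patchE; case: ifPn => //.
    rewrite notin_setE /= in_itv /= => /negP; rewrite negb_and (KN x Kx) orbF -ltNge => x0.
    by rewrite h_neg // normr0.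
  rewrite -integral_mkcondr.
  have /integrableP[_] := ih N0; apply: le_lt_trans.
  apply: ge0_subset_integral => //.
  - by apply: measurableI.
  - by apply/measurable_EFinP; apply: measurableT_comp => //; exact: measurable_funTS.
move: (lebesgue_differentiation loc).
apply: filterS; first exact: (ae_filter_ringOfSetsType lambda).
move=> t lt t0; have t1 : 0 < t + 1 by rewrite ltr_wpDl // ltW.
have tt1 : t < t + 1 by rewrite ltrDl.
have [|dF F'] := @FTC1_lebesgue_pt R h (BLeft 0) t (t + 1) tt1 (ih t1) _ lt.
  by rewrite lte_fin.
exact: (DeriveDef dF (etrans (esym (derive1E F t)) F')).
Qed.

End borel_primitive.

#[global] Instance leb_ae_filter (R : realType) : @Filter R (almost_everywhere (leb R)).
Proof. exact: (ae_filter_ringOfSetsType (leb R)). Qed.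

#[global] Instance lebesgue_ae_filter (R : realType) :
  @Filter R (almost_everywhere (@lebesgue_measure R)).
Proof. exact: (ae_filter_ringOfSetsType (@lebesgue_measure R)). Qed.

Section lebesgue_primitive.
Context {R : realType}.
Local Notation LT := (lebesgue_type R).
Local Notation lambda := (@lebesgue_measure R).
Variable h : R -> R.
Hypotheses (mh : measurable_fun setT (h : LT -> R))
  (ih : forall T, 0 < T -> (leb R).-integrable (`[0, T]%classic : set LT) (EFin \o h)).

Definition primitive t : R := \int[leb R]_(x in `[0, t]%classic) h x.

Lemma borel_version : exists h0 : R -> R,
  [/\ measurable_fun setT h0, forall x, x < 0 -> h0 x = 0,
      forall T, 0 < T -> lambda.-integrable `[0, T] (EFin \o h0),
      forall t, primitive t = \int[lambda]_(x in `[0, t]) h0 x &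
      {ae leb R, forall x : R, 0 <= x -> h x = h0 x}].
Proof.
have [h' [mh' hh']] := lebesgue_fun_borel mh.
pose h0 : R -> R := h' \_ `[0, +oo[%classic.
have mh0 : measurable_fun setT h0.
  apply/(measurable_restrictT _ _).1 => //; exact: measurable_funTS.
have mh0L : measurable_fun setT (h0 : LT -> R).
  exact: (measurableT_comp mh0 measurable_to_borel).
have aeh : {ae leb R, forall x : R, 0 <= x -> h x = h0 x}.
  apply/leb_aeP; apply: filterS hh' => x hx x0; by rewrite /h0 patchE mem_set //= in_itv /= x0.
have aeI t : ae_eq (leb R) (`[0, t]%classic : set LT) h h0.
  apply: filterS aeh => x hx; rewrite /= in_itv /= => /andP[x0 _]; exact: hx.
have mI t : measurable (`[0, t]%classic : set LT) by apply: borel_lebesgue; exact: measurable_itv.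
have mIB t : measurable (`[0, t]%classic : set (measurableTypeR R)) by exact: measurable_itv.
exists h0; split => //.
- by move=> x x0; rewrite /h0 patchE; case: ifPn => //; rewrite inE /= in_itv /= andbT leNgt x0.
- move=> T T0; apply/integrableP; split; first by apply/measurable_EFinP; exact: measurable_funTS.
  have /integrableP[_] := ih T0; apply: le_lt_trans; rewrite le_eqVlt; apply/orP; left; apply/eqP.
  rewrite -[LHS]ge0_integral_leb //; last first.
    by apply: measurableT_comp => //; apply/measurable_EFinP; exact: measurable_funTS.
  apply: ae_eq_integral; first exact: mI.
  + by apply: measurableT_comp => //; apply/measurable_EFinP; exact: measurable_funTS.
  + by apply: measurableT_comp => //; apply/measurable_EFinP; exact: measurable_funTS.
  + by apply: filterS (aeI T) => x /[apply] /= ->.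
- move=> t; rewrite /primitive /Rintegral; congr fine.
  rewrite -integral_leb //; last by apply/measurable_EFinP; exact: measurable_funTS.
  apply: ae_eq_integral; first exact: mI.
  + by apply/measurable_EFinP; exact: measurable_funTS.
  + by apply/measurable_EFinP; exact: measurable_funTS.
  + by apply: filterS (aeI t) => x /[apply] ->.
Qed.

Lemma primitive0 : primitive 0 = 0.
Proof.
have [h0 [_ _ _ -> _]] := borel_version.
by rewrite set_itv1 Rintegral_set1.
Qed.

Lemma leb_primitive_ac : locally_abs_continuous primitive.
Proof.
have [h0 [mh0 h0_neg ih0 E _]] := borel_version.
rewrite (_ : primitive = fun t => \int[lambda]_(x in `[0, t]) h0 x); last exact/funext.
by move=> a b; exact: primitive_ac.
Qed.

Lemma leb_primitive_derive :
  {ae leb R, forall t : R, 0 < t -> is_derive t (1 : R) primitive (h t)}.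
Proof.
have [h0 [mh0 h0_neg ih0 E aeh]] := borel_version.
rewrite (_ : primitive = fun t => \int[lambda]_(x in `[0, t]) h0 x); last exact/funext.
have /leb_aeP := primitive_derive h0_neg ih0 mh0.
move: aeh; apply: filterS2 => t hh0 d t0; rewrite hh0 ?ltW //; exact: d.
Qed.

End lebesgue_primitive.

Lemma leb_set1 (R : realType) (c : R) : (leb R).-negligible [set c].
Proof.
by apply/leb_negligibleP; exists [set c]; split => //; exact: lebesgue_measure_set1.
Qed.

Lemma ac_sub (R : realType) (V : normedModType R) (a b : R) (x y : R -> V) :
  abs_continuous_on a b x -> abs_continuous_on a b y ->
  abs_continuous_on a b (fun t => x t - y t).
Proof.
move=> acx acy e e0; have e2 : 0 < e / 2 by rewrite divr_gt0.
have [d d0 dP] := acx _ e2; have [d' d'0 d'P] := acy _ e2.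
exists (Num.min d d'); first by rewrite lt_min d0.
move=> k s r sr tr; rewrite lt_min => /andP[sd sd'].
have := dP k s r sr tr sd; have := d'P k s r sr tr sd' => h1 h2.
apply: (@le_lt_trans _ _ (\sum_(i < k) `|x (r i) - x (s i)| + \sum_(i < k) `|y (r i) - y (s i)|)).
  rewrite -big_split; apply: ler_sum => i _ /=.
  rewrite (_ : _ - _ = (x (r i) - x (s i)) - (y (r i) - y (s i))); first exact: ler_normB.
  by rewrite !opprB addrACA [RHS]addrACA [- y (r i) - _]addrC.
lra.
Qed.

(** The difference between x and the primitive of h is absolutely continuous with derivative zero
    almost everywhere, hence constant. *)
Lemma ac_ftc (R : realType) (x h : R -> R) :
  locally_abs_continuous x -> measurable_fun setT (h : lebesgue_type R -> R) ->
  (forall T, 0 < T -> (leb R).-integrable (`[0, T]%classic : set (lebesgue_type R)) (EFin \o h)) ->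
  {ae leb R, forall t : R, 0 <= t -> is_derive t (1 : R) x (h t)} ->
  forall t, 0 <= t -> x t - x 0 = primitive h t.
Proof.
move=> acx mh ih dx t t0.
suff : x t - primitive h t = x 0 - primitive h 0.
  by rewrite (primitive0 mh ih) subr0 => /eqP; rewrite subr_eq addrC -subr_eq => /eqP.
apply: (@ac_zero_derivative _ (fun t => x t - primitive h t)) => //.
  by apply: ac_sub; [exact: acx|exact: leb_primitive_ac].
have n0 : {ae leb R, forall s : R, s <> 0}.
  apply: negligibleS (leb_set1 (0 : R)) => s /= /contrapT; exact.
move: n0 dx (leb_primitive_derive mh ih).
apply: filterS3 => s s0 dxs dps sge0 st.
have sgt0 : 0 < s by rewrite lt_def sge0 andbT; apply/eqP.
by have := is_deriveB (dxs sge0) (dps sgt0); rewrite subrr.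
Qed.

(** * Pointwise compactness of bounded equicontinuous trajectories *)

Section pointwise_compactness.
Context {R : realType} {n : nat}.
Local Notation V := 'rV[R]_n.
Variables (x : nat -> R -> V) (C : R -> R).
Hypotheses (xC : forall k t, 0 <= t -> `|x k t| <= C t)
  (equi : forall T e : R, 0 < T -> 0 < e -> exists2 d, 0 < d & forall k s t, 0 <= s -> s <= T ->
    0 <= t -> t <= T -> `|t - s| < d -> `|x k t - x k s| <= e).

Let clip (t : R) : R := Num.max t 0.

(** Tychonoff's theorem gives a cluster point in the product over all times. Its neighbourhoods test
    finitely many times at once; [clip] moves negative times to 0, since bounds are available on the
    half-line only. *)
Lemma pointwise_cluster : exists f : R -> V, forall (s : seq R) e K, 0 < e ->
  exists2 k, (K <= k)%N & forall t, t \in s -> `|x k (clip t) - f t| < e.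
Proof.
pose A (t : R) : set V := [set v | `|v| <= C (clip t)].
have cA t : compact (A t).
  apply: bounded_closed_compact.
    by exists (C (clip t)); split; [exact: num_real|move=> r Cr v Av; exact: le_trans Av (ltW Cr)].
  rewrite (_ : A t = (fun v : V => `|v|) @^-1` [set r | r <= C (clip t)]) //.
  by apply: closed_comp; [move=> v _; exact: norm_continuous|exact: closed_le].
have cAll := @tychonoff R (fun=> V) A cA.
pose y k : prod_topology (fun _ : R => V) := fun t => x k (clip t).
have [|f [_ cf]] := cAll (y @ \oo) _.
  exists 0%N => // k _ t; apply: xC; by rewrite /clip le_max lexx orbT.
exists f => s e K e0; pose pf : prod_topology (fun _ : R => V) := f.
have FF : @Filter (prod_topology (fun _ : R => V)) (nbhs pf) by exact: nbhs_filter.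
have : nbhs pf [set g : prod_topology (fun _ : R => V) | forall t, t \in s -> `|g t - f t| < e].
  elim: s => [|t s IH]; first by apply: (@filterS _ _ FF _ _ _ (@filterT _ _ FF)) => g _ t.
  have ft : nbhs pf [set g : prod_topology (fun _ : R => V) | `|g t - f t| < e].
    have /cvgrPdist_lt/(_ _ e0) h := @proj_continuous R (fun=> V) t pf.
    by apply: (@filterS _ _ FF _ _ _ h) => g; rewrite /= distrC.
  apply: (@filterS2 _ _ FF _ _ _ _ ft IH) => g gt gs r; rewrite inE => /orP[/eqP -> //|]; exact: gs.
move=> nf; have [] := cf (y @` [set k | (K <= k)%N]) _ _ nf.
  by exists K => // k Kk; exists k.
by move=> _ [[k Kk <-] yk]; exists k.
Qed.

Lemma pointwise_subsequence : exists (sigma : nat -> nat) (f : R -> V),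
  (forall j, (j <= sigma j)%N) /\ forall t, 0 <= t -> x (sigma j) t @[j --> \oo] --> f t.
Proof.
have [f fP] := pointwise_cluster.
pose r i : R := if (unpickle i : option rat) is Some q then ratr q else 0.
have /choice[sigma sP] j : exists k, (j <= k)%N /\
    forall i, (i <= j)%N -> `|x k (clip (r i)) - f (r i)| < j.+1%:R^-1.
  have [|k jk kP] := fP (map r (iota 0 j.+1)) j.+1%:R^-1 j; first by rewrite invr_gt0.
  by exists k; split => // i ij; apply: kP; apply/map_f; rewrite mem_iota.
exists sigma, f; split=> [j|t t0]; first by case: (sP j).
apply/cvgrPdist_lt => e e0.
have e8 : 0 < e / 8 by rewrite divr_gt0.
have T0 : 0 < t + 1 by rewrite ltr_wpDl.
have [d d0 dP] := equi T0 e8.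
have td : t < t + Num.min d 1 by rewrite ltrDl lt_min d0 ltr01.
have [q] := rat_in_itvoo td; rewrite in_itv /= => /andP[tq qd].
pose rq : R := ratr q.
have rq0 : 0 <= rq by exact: ltW (le_lt_trans t0 tq).
have clipE u : 0 <= u -> clip u = u by move=> u0; rewrite /clip max_l.
have qT : rq <= t + 1 by apply: ltW; apply: lt_le_trans qd _; rewrite lerD2l ge_min lexx orbT.
have qtd : `|rq - t| < d.
  rewrite ger0_norm ?subr_ge0 ?(ltW tq) // ltrBlDl; apply: lt_le_trans qd _.
  by rewrite lerD2l ge_min lexx.
have near_q k : `|x k rq - x k t| <= e / 8.
  by apply: dP => //; rewrite lerDl.
(* Equicontinuity passes to the cluster point: a single trajectory that is close to f at both [rq]
   and t suffices. *)
have f_q : `|f rq - f t| < e / 2.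
  have [k _ kP] := fP [:: rq; t] (e / 8) 0%N e8.
  have h1 := kP rq (mem_head _ _); have h2 : `|x k (clip t) - f t| < e / 8.
    by apply: kP; rewrite !inE eqxx orbT.
  rewrite !clipE // in h1 h2.
  have -> : f rq - f t = - (x k rq - f rq) + (x k rq - x k t) + (x k t - f t).
    by rewrite opprB !addrA !subrK.
  apply: le_lt_trans (ler_normD _ _) _; have := ler_normD (- (x k rq - f rq)) (x k rq - x k t).
  by rewrite normrN; have := near_q k; lra.
have [N _ NP] := near_infty_natSinv_lt (PosNum e8).
exists (maxn N (pickle q)) => // j /= Nj.
have [_ /(_ (pickle q))] := sP j.
rewrite /r pickleK -/rq clipE // => /(_ (leq_trans (leq_maxr _ _) Nj)) sq.
have jN : j.+1%:R^-1 < e / 8 by apply: NP => /=; exact: leq_trans (leq_maxl _ _) Nj.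
have -> : f t - x (sigma j) t = - (f rq - f t) + - (x (sigma j) rq - f rq) + (x (sigma j) rq - x (sigma j) t).
  by rewrite !opprB !addrA !subrK.
apply: le_lt_trans (ler_normD _ _) _.
have := ler_normD (- (f rq - f t)) (- (x (sigma j) rq - f rq)); rewrite !normrN.
by have := lt_trans sq jN; have := near_q (sigma j); move: f_q e0; clear; lra.
Qed.

End pointwise_compactness.

Lemma uniformly_integrable_le (R : realType) (V : Type) (nrm : V -> \bar R) (T : R)
    (F : set (R -> V)) : uniformly_integrable nrm T F ->
  forall e : R, 0 < e -> exists2 c : R, 0 < c & forall g, F g ->
    (\int[leb R]_(t in `[0%R, T]%classic `&` [set t | (c%:E < nrm (g t))%E]) nrm (g t)
      <= e%:E)%E.
Proof.
rewrite /uniformly_integrable; set S := (X in ereal_inf X) => UI e e0.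
have := @lb_ereal_inf_adherent R S e e0; rewrite UI add0e => /(_ isT)[x [c /= c0 <-] xe].
exists c => // g Fg; apply: le_trans (ltW xe).
by apply: ereal_sup_ubound; exists g.
Qed.

Lemma integral_le_tail {d : measure_display} {T : measurableType d} {R : realType}
    (mu : {measure set T -> \bar R}) (D : set T) (w : T -> \bar R) (c e : R) :
  measurable D -> (mu D < +oo)%E -> measurable_fun D w -> (forall x, D x -> (0 <= w x)%E) ->
  0 <= c -> (\int[mu]_(x in D `&` [set x | (c%:E < w x)%E]) w x <= e%:E)%E ->
  (\int[mu]_(x in D) w x <= (c * fine (mu D) + e)%:E)%E.
Proof.
move=> mD muD mw w0 c0 we.
have mB : measurable (D `&` [set x | (c%:E < w x)%E]).
  exact: measurable_lte.
have mC : measurable (D `\` (D `&` [set x | (c%:E < w x)%E])) by exact: measurableD.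
rewrite -[in leLHS](setDUK (_ : D `&` [set x | (c%:E < w x)%E] `<=` D)) //.
rewrite ge0_integral_setU //; last 3 first.
- by rewrite setDUK.
- by rewrite setDUK.
- by apply/disj_setPS => x [Bx [_ nBx]].
rewrite addrC EFinD; apply: leeD => //.
apply: (@le_trans _ _ (\int[mu]_(x in D `\` (D `&` [set x | (c%:E < w x)%E])) cst c%:E x)%E).
  apply: ge0_le_integral => //.
  - by move=> x [/w0].
  - by apply: measurable_funS mw => //; exact: subDsetl.
  - move=> x [Dx nBx]; rewrite leNgt; apply/negP => cw; exact: nBx.
rewrite integral_cst // EFinM fineK ?ge0_fin_numE //; apply: lee_wpmul2l => //.
by apply: le_measure; rewrite ?inE //; exact: subDsetl.
Qed.

Section row_vectors.
Context {R : realType} {n : nat}.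
Local Notation V := 'rV[R]_n.

Lemma norm_rV_le (v : V) (B : R) : 0 <= B -> (forall j, `|v 0 j| <= B) -> `|v| <= B.
Proof.
move=> B0 vB; rewrite [leLHS]/Num.norm /= mx_normrE; apply: bigmax_le => // -[i j] _ /=.
by rewrite ord1.
Qed.

Lemma norm_coord_le (v : V) j : `|v 0 j| <= `|v|.
Proof.
by rewrite [leRHS]/Num.norm /= mx_normrE; apply/bigmax_geP; right; exists (0, j).
Qed.

Lemma norm_rV_le_sum (v : V) : `|v| <= \sum_(j < n) `|v 0 j|.
Proof.
apply: norm_rV_le; first exact: sumr_ge0.
by move=> j; rewrite (bigD1 j) //= lerDl sumr_ge0.
Qed.

Lemma lac_coord (x : R -> V) j : locally_abs_continuous x ->
  locally_abs_continuous (fun t => x t 0 j).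
Proof.
move=> acx a b a0 ab e e0; have [d d0 dP] := acx a b a0 ab e e0; exists d => //.
move=> k s r sr tr sd; apply: le_lt_trans (dP k s r sr tr sd).
apply: ler_sum => i _; apply: le_trans (norm_coord_le (x (r i) - x (s i)) j).
by rewrite !mxE.
Qed.

Lemma lac_rV (x : R -> V) : (forall j, locally_abs_continuous (fun t => x t 0 j)) ->
  locally_abs_continuous x.
Proof.
move=> acx a b a0 ab e e0.
have en : 0 < e / (n%:R + 1) by rewrite divr_gt0 // ltr_wpDl.
have /choice[d dP] j : exists d, 0 < d /\ forall (k : nat) (s r : 'I_k -> R),
      (forall i, a <= s i /\ s i <= r i /\ r i <= b) ->
      trivIset [set: 'I_k] (fun i => `]s i, r i[%classic) ->
      \sum_(i < k) (r i - s i) < d ->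
      \sum_(i < k) `|x (r i) 0 j - x (s i) 0 j| < e / (n%:R + 1).
  by have [d d0 dP] := acx j a b a0 ab _ en; exists d.
exists (\big[Num.min/1]_(j < n) d j).
  by apply/bigmin_gtP; split=> // j _; case: (dP j).
move=> k s r sr tr sd.
apply: (@le_lt_trans _ _ (\sum_(i < k) \sum_(j < n) `|x (r i) 0 j - x (s i) 0 j|)).
  apply: ler_sum => i _; apply: le_trans (norm_rV_le_sum _) _.
  by apply: ler_sum => j _; rewrite !mxE.
rewrite exchange_big /=; apply: (@le_lt_trans _ _ (\sum_(j < n) e / (n%:R + 1))).
  apply: ler_sum => j _; apply: ltW; case: (dP j) => _; apply => //.
  by apply: lt_le_trans sd _; exact: bigmin_le.
have -> : \sum_(j < n) e / (n%:R + 1) = e / (n%:R + 1) * n%:R.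
  by rewrite sumr_const card_ord mulr_natr.
by rewrite mulrAC ltr_pdivrMr ?ltr_wpDl // ltr_pM2l // ltrDl.
Qed.

Lemma is_derive_coord (x : R -> V) (t : R) (v : V) j :
  is_derive t (1 : R) x v -> is_derive t (1 : R) (fun t => x t 0 j) (v 0 j).
Proof.
move=> [dx xv]; split; first by have /derivable_mxP := dx; exact.
by rewrite -xv (derive_mx dx) mxE.
Qed.

Lemma is_derive_rV (x : R -> V) (t : R) (v : V) :
  (forall j, is_derive t (1 : R) (fun t => x t 0 j) (v 0 j)) -> is_derive t (1 : R) x v.
Proof.
move=> dx; have d : derivable x t (1 : R).
  by apply/derivable_mxP => i j; rewrite ord1; case: (dx j).
split=> //; rewrite (derive_mx d); apply/rowP => j; rewrite mxE.
by case: (dx j).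
Qed.

End row_vectors.

Lemma lac_clip_continuous (R : realType) (y : R -> R) : locally_abs_continuous y ->
  continuous (fun t : R => y (Num.max t 0)).
Proof.
move=> acy t; pose clip (s : R) := Num.max s 0.
have clip0 s : 0 <= clip s by rewrite /clip le_max lexx orbT.
have clip_lip s : `|clip s - clip t| <= `|s - t|.
  rewrite /clip; case: (leP s 0) => s0; case: (leP t 0) => t0; rewrite ?subrr ?normr_ge0 //.
  - by rewrite normr0.
  - by rewrite sub0r normrN (gtr0_norm t0) distrC ger0_norm; lra.
  - by rewrite subr0 (gtr0_norm s0) ger0_norm; lra.
apply/cvgrPdist_lt => e e0.
have [|d d0 dP] := acy 0 (clip t + 1) (lexx _) _ e e0; first by rewrite addr_ge0.
exists (Num.min d 1) => /=; first by rewrite lt_min d0 ltr01.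
move=> s; rewrite /= lt_min => /andP[sd s1]; rewrite distrC in sd; rewrite distrC in s1.
have c1 := le_lt_trans (clip_lip s) s1; have c2 := le_lt_trans (clip_lip s) sd.
have cs : clip s <= clip t + 1 by have := le_lt_trans (ler_norm _) c1; lra.
have ct : clip t <= clip t + 1 by rewrite lerDl.
rewrite -/(clip s) -/(clip t).
have step p q : 0 <= p -> p <= q -> q <= clip t + 1 -> `|q - p| < d -> `|y q - y p| < e.
  move=> p0 pq qt qp; have := dP 1%N (fun=> p) (fun=> q); rewrite !big_ord1; apply.
  - by [].
  - by apply/trivIsetP => i j; rewrite !ord1 eqxx.
  - by rewrite ger0_norm ?subr_ge0 in qp.
have [st|ts] := leP (clip s) (clip t).
  by apply: step => //; rewrite distrC.
by rewrite distrC; apply: step => //; exact: ltW.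
Qed.

Lemma lac_clip_measurable (R : realType) (y : R -> R) : locally_abs_continuous y ->
  measurable_fun setT ((fun t : R => y (Num.max t 0)) : lebesgue_type R -> R).
Proof.
move=> acy; have mc := continuous_measurable_fun (lac_clip_continuous acy).
exact: (measurableT_comp mc measurable_to_borel).
Qed.

(** * Admissible processes and payoffs *)

Section process_measurability.
Context {R : realType} {n m : nat}.
Variables (A : R -> set 'rV[R]_n) (U : R -> 'rV[R]_n -> set 'rV[R]_m)
  (f : R * ('rV[R]_n * 'rV[R]_m) -> 'rV[R]_n)
  (f0 : R * ('rV[R]_n * 'rV[R]_m) -> \bar R).
Hypothesis hdata : standing_conditions A U f f0.
Local Notation LT := (lebesgue_type R).
Local Notation halfline := (`[0%R, +oo[%classic : set LT).

Lemma measurable_halfline : measurable halfline.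
Proof. by apply: borel_lebesgue; exact: measurable_itv. Qed.

Lemma measurable_state_control (x : R -> 'rV[R]_n) (u : R -> 'rV[R]_m) :
  locally_abs_continuous x -> measurable_fun halfline (u : _ -> borel_type 'rV[R]_m) ->
  measurable_fun setT ((fun t => (t, (x (Num.max t 0), (u \_ halfline) t))) :
    LT -> LT * borel_type ('rV[R]_n * 'rV[R]_m)%type).
Proof.
move=> acx mu; have [q dq] := dense_rV R n; have [q' dq'] := dense_rV R m.
apply: measurable_fun_pair; first exact: measurable_id.
apply: (@measurable_borel_pair _ LT R _ _ q q' setT (fun t => x (Num.max t 0))
  (u \_ halfline) dq dq' measurableT).
  apply: (@measurable_rV _ LT R n setT (fun t => x (Num.max t 0)) measurableT) => j.
  exact: (lac_clip_measurable (lac_coord j acx)).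
apply: (proj1 (@measurable_restrictT _ _ LT (borel_type 'rV[R]_m) halfline u measurable_halfline)).
exact: mu.
Qed.

(** The data are measurable on [graphU] only, and an admissible process stays in it for almost every
    time. Completeness of the Lebesgue measure extends measurability to the whole half-line. *)
Lemma process_measurable p : Omega A U f p ->
  (forall j, measurable_fun halfline (fun t => rhs f p t 0 j)) /\
  measurable_fun halfline (payoff_rate f0 p).
Proof.
case: p => x u [acx mu adm]; have [mgA mgU mf mf0 _] := hdata.
have mphi := measurable_state_control acx mu.
pose phi (t : R) := (t, (x (Num.max t 0), (u \_ halfline) t)).
have phiE t : 0 <= t -> phi t = (t, (x t, u t)).
  move=> t0; rewrite /phi patchE max_l //.
  by rewrite mem_set //= in_itv /= t0.
pose G : set LT := [set t | graphU A U (phi t)].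
have mG : measurable G by have := mphi measurableT _ mgU; rewrite setTI.
have aeG : {ae leb R, forall t : R, 0 <= t -> G t}.
  apply: filterS adm => t adt t0; have [At Ut _] := adt t0.
  by rewrite /G /= phiE.
have mfG : measurable_fun G ((fun t => f (phi t)) : LT -> borel_type 'rV[R]_n).
  apply: (measurable_comp mgU _ mf) => //; first by move=> _ [t Gt <-].
  exact: measurable_funTS.
have mf0G : measurable_fun G (fun t : LT => f0 (phi t)).
  apply: (measurable_comp mgU _ mf0) => //; first by move=> _ [t Gt <-].
  exact: measurable_funTS.
have restrict (g g' : LT -> \bar R) : measurable_fun G g ->
    (forall t, 0 <= t -> g t = g' t) -> measurable_fun halfline g'.
  move=> mg gg'; apply: (@ae_measurable_fun _ _ _ _ (@leb_complete R) halfline (g \_ G)).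
    apply: filterS aeG => t Gt; rewrite /= in_itv /= andbT => t0.
    by rewrite patchE mem_set; [exact: gg'|exact: Gt].
  apply: measurable_funTS; exact/(measurable_restrictT _ mG).
split=> [j|].
  apply/measurable_EFinP; apply: (restrict (fun t => (f (phi t) 0 j)%:E)).
    by apply/measurable_EFinP; exact: measurable_rV_coord.
  by move=> t t0; rewrite /= phiE.
by apply: (restrict (fun t => f0 (phi t))) => // t t0; rewrite phiE.
Qed.

Lemma measurable_sub_halfline (E : set LT) : measurable E -> E `<=` halfline ->
  forall d (Y : measurableType d) (g : LT -> Y), measurable_fun halfline g -> measurable_fun E g.
Proof. by move=> mE EH d Y g; apply: measurable_funS => //; exact: measurable_halfline. Qed.

End process_measurability.

Lemma cvge_between {R : realType} {I : Type} {F : set_system I} {FF : Filter F}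
    (phi : I -> \bar R) (L : \bar R) :
  (forall y : R, (y%:E < L)%E -> \forall i \near F, (y%:E < phi i)%E) ->
  (forall y : R, (L < y%:E)%E -> \forall i \near F, (phi i < y%:E)%E) ->
  phi i @[i --> F] --> L.
Proof.
move: L => [l| |] lo up; last 2 first.
- by apply/cvgeyPgt => y; apply: lo; exact: ltry.
- by apply/cvgeNyPlt => y; apply: up; exact: ltNyr.
have near_l e : 0 < e -> \forall i \near F, ((l - e)%:E < phi i < (l + e)%:E)%E.
  move=> e0; have := up (l + e); have := lo (l - e); rewrite !lte_fin ltrBlDr ltrDl e0.
  by move=> /(_ isT) h1 /(_ isT); apply: filterS2 h1 => i -> ->.
apply/fine_cvgP; split.
  apply: filterS (near_l 1 ltr01) => i /andP[pl pu].
  by rewrite fin_numE -ltNye -ltey (lt_trans (ltNyr _) pl) (lt_trans pu (ltry _)).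
apply/cvgrPdist_lt => e e0; apply: filterS (near_l e e0) => i /=.
case: (phi i) => [r| |] //=; rewrite ?lte_fin ?ltNge ?leNye ?leey ?andbF //.
move=> /andP[]; rewrite -!ltNge => h1 h2.
by rewrite ltr_norml; apply/andP; split; lra.
Qed.

Section almost_nonincreasing.
Context {R : realType}.
Variable phi : R -> \bar R.
Hypothesis phi_noninc : forall e : R, 0 < e -> exists T0 : R,
  forall T T' : R, T0 <= T -> T < T' -> (phi T' <= phi T + e%:E)%E.

Lemma almost_nonincreasing_cvg : cvg (phi T @[T --> +oo%R]).
Proof.
(* S consists of values that bound [phi] from above at all later times. Its infimum is the limit,
   possibly infinite. *)
pose S := [set (phi p.1 + p.2%:E)%E | p in [set p : R * R |
  forall T', p.1 < T' -> (phi T' <= phi p.1 + p.2%:E)%E]].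
suff cL : phi T @[T --> +oo%R] --> ereal_inf S by apply/cvg_ex; exists (ereal_inf S).
apply: cvge_between => y yL.
  have [e e0 ye] : exists2 e : R, 0 < e & (y%:E + e%:E < ereal_inf S)%E.
    move: yL; case: (ereal_inf S) => [l| |]; rewrite ?lte_fin ?ltNge ?leNye //.
      by move=> yl; exists ((l - y) / 2); rewrite ?lte_fin; lra.
    by move=> _; exists 1 => //; rewrite -EFinD ltry.
  have [T0 T0P] := phi_noninc e0; exists T0; split; first exact: num_real.
  move=> T /ltW T0T; have : (ereal_inf S <= phi T + e%:E)%E.
    by apply: ereal_inf_lbound; exists (T, e) => //= T' TT'; exact: T0P.
  by move=> /(lt_le_trans ye); rewrite lteD2rE.
have /ereal_inf_lt[_ [[T e] /= h <-] lty] := yL.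
exists T; split; first exact: num_real.
by move=> T' TT'; apply: le_lt_trans lty; exact: h.
Qed.

End almost_nonincreasing.

Lemma leb_itv_lty {R : realType} (T : R) : (leb R (`[0%R, T]%classic : set R) < +oo)%E.
Proof.
apply: (@le_lt_trans _ _ (lebesgue_measure (`[0%R, T]%classic : set R))) => //.
by rewrite lebesgue_measure_itv; case: ifP => // _; exact: ltry.
Qed.

Section payoff_structure.
Context {R : realType} {n m : nat}.
Variables (A : R -> set 'rV[R]_n) (U : R -> 'rV[R]_n -> set 'rV[R]_m)
  (f : R * ('rV[R]_n * 'rV[R]_m) -> 'rV[R]_n)
  (f0 : R * ('rV[R]_n * 'rV[R]_m) -> \bar R).
Hypothesis hdata : standing_conditions A U f f0.
Local Notation LT := (lebesgue_type R).

Lemma leb_measurable_itv (i : interval R) : measurable ([set` i] : set LT).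
Proof. by apply: borel_lebesgue; exact: measurable_itv. Qed.

Lemma rate_measurable_itv (b : bool) (T : R) (i : itv_bound R) p : 0 <= T -> Omega A U f p ->
  measurable_fun ([set` Interval (BSide b T) i] : set LT) (payoff_rate f0 p).
Proof.
move=> T0 Op; have [_ mr] := process_measurable hdata Op.
apply: (measurable_sub_halfline (leb_measurable_itv _) _ mr).
move=> t /= /andP[Tt _]; rewrite in_itv /= andbT; apply: le_trans T0 _.
by move: Tt; case: b => //; exact: ltW.
Qed.

Lemma payoff_cat p (T T' : R) : Omega A U f p -> 0 <= T -> T < T' ->
  payoff f0 0 T' p = (payoff f0 0 T p + payoff f0 T T' p)%E.
Proof.
move=> Op T0 TT'; rewrite /payoff.
have -> : `[0, T']%classic = `[0, T]%classic `|` `]T, T']%classic :> set R.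
  by rewrite -itv_bndbnd_setU ?bnd_simp //; exact: ltW.
rewrite integral_setU; last 4 first.
- exact: leb_measurable_itv.
- exact: leb_measurable_itv.
- rewrite -itv_bndbnd_setU ?bnd_simp //; last exact: ltW.
  exact: rate_measurable_itv.
- apply/disj_setPS => t [] /=; rewrite !in_itv /= => /andP[_ tT] /andP[Tt _].
  by have := lt_le_trans Tt tT; rewrite ltxx.
congr (_ + _)%E.
(* [payoff] integrates over closed intervals, so the shared endpoint T has to be put back; it is a
   null set. *)
rewrite -(@setU1itv _ _ _ T false); last by rewrite bnd_simp ltW.
have mT : measurable ([set T] : set LT) by rewrite -set_itv1; exact: leb_measurable_itv.
have mTT' := leb_measurable_itv `]T, T'].
rewrite integral_setU //; last 2 first.
- rewrite (@setU1itv _ _ _ T false); last by rewrite bnd_simp ltW.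
  exact: rate_measurable_itv.
- by apply/disj_setPS => t [/= ->]; rewrite in_itv /= ltxx.
rewrite [X in (_ = X + _)%E](_ : _ = 0%E) ?add0e //.
apply: null_set_integral => //; last exact: (@lebesgue_measure_set1 R T).
by rewrite -set_itv1; exact: rate_measurable_itv.
Qed.

Section positive_part.
Hypothesis h11 : forall T : R, 0 < T -> uniformly_integrable (@abse R) T
  [set ((payoff_rate f0 p) ^\+)%E | p in Omega A U f].

Lemma rate_pos_tail (T e : R) : 0 < T -> 0 < e -> exists2 c : R, 0 < c & forall p,
  Omega A U f p ->
  (\int[leb R]_(t in (`[0%R, T]%classic : set LT) `&`
       [set t | (c%:E < ((payoff_rate f0 p) ^\+)%E t)%E]) ((payoff_rate f0 p) ^\+)%E t <= e%:E)%E.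
Proof.
move=> T0 e0; have [c c0 cP] := uniformly_integrable_le (h11 T0) e0.
exists c => // p Op; have := cP _ (ex_intro2 _ _ p Op erefl); congr (_ <= _)%E.
under eq_integral do rewrite gee0_abs //.
by congr (integral _ _ _); apply/seteqP; split=> t [? /=]; rewrite gee0_abs.
Qed.

Lemma rate_pos_bound (T : R) : 0 < T -> exists2 C : R, 0 <= C & forall p, Omega A U f p ->
  (\int[leb R]_(t in `[0%R, T]) ((payoff_rate f0 p) ^\+)%E t <= C%:E)%E.
Proof.
move=> T0; have [c c0 cP] := rate_pos_tail T0 ltr01.
exists (c * fine (leb R (`[0%R, T]%classic : set R)) + 1).
  by rewrite addr_ge0 ?ler01 ?mulr_ge0 ?(ltW c0) ?fine_ge0.
move=> p Op; apply: (@integral_le_tail _ LT R (leb R) _ ((payoff_rate f0 p) ^\+)%E c 1).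
- exact: leb_measurable_itv.
- exact: leb_itv_lty.
- by apply: measurable_funepos; exact: rate_measurable_itv.
- by [].
- exact: ltW.
- exact: cP.
Qed.

Lemma payoff_bound (T : R) : 0 < T -> exists2 C : R, 0 <= C & forall p, Omega A U f p ->
  (payoff f0 0 T p <= C%:E)%E.
Proof.
move=> T0; have [C C0 CP] := rate_pos_bound T0; exists C => // p Op.
rewrite /payoff integralE; apply: le_trans (CP p Op).
by rewrite geeDl ?oppe_le0 //; exact: integral_ge0.
Qed.

End positive_part.

Section payoff_limit.
Hypothesis payoff_tail : forall e : R, 0 < e -> exists2 T0 : R, 0 < T0 &
  forall p, Omega A U f p -> forall T T' : R, T0 <= T -> T < T' -> (payoff f0 T T' p <= e%:E)%E.

Lemma payoff_noninc e : 0 < e -> exists2 T0 : R, 0 < T0 & forall p, Omega A U f p ->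
  forall T T' : R, T0 <= T -> T < T' -> (payoff f0 0 T' p <= payoff f0 0 T p + e%:E)%E.
Proof.
move=> e0; have [T0 T00 T0P] := payoff_tail e0; exists T0 => // p Op T T' T0T TT'.
rewrite (payoff_cat Op _ TT'); last exact: le_trans (ltW T00) T0T.
by rewrite leeD2l //; exact: T0P T0T TT'.
Qed.

Lemma payoff_cvg p : Omega A U f p -> J_exists f0 p.
Proof.
move=> Op; apply: almost_nonincreasing_cvg => e e0.
have [T0 _ T0P] := payoff_noninc e0; exists T0 => T T'; exact: T0P.
Qed.

(** The time [T0] is the same for all admissible processes. This uniformity lets finite-horizon
    bounds along a sequence speak about its payoffs J. *)
Lemma J_le_payoff e : 0 < e -> exists2 T0 : R, 0 < T0 & forall p, Omega A U f p ->
  forall T : R, T0 <= T -> (J f0 p <= payoff f0 0 T p + e%:E)%E.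
Proof.
move=> e0; have [T0 T00 T0P] := payoff_noninc e0; exists T0 => // p Op T T0T.
apply: lime_le; first exact: payoff_cvg.
exists T; split; first exact: num_real.
by move=> T'; exact: T0P.
Qed.

End payoff_limit.

(** The common consequence of the three tail conditions, and the form in which they are used. *)
Lemma payoff_tailP :
  [\/ (limf_esup (fun T : R =>
         ereal_sup [set ereal_sup [set payoff f0 T T' p | p in Omega A U f]
                   | T' in [set T' | (T < T')%R]]) +oo%R <= 0)%E,
      exists omega : R * R -> R,
      [/\ {within [set s : R * R | 0 <= s.1 /\ 0 <= s.2], continuous omega},
          forall T T' : R, 0 <= T -> 0 <= T' -> 0 <= omega (T, T'),
          omega @ filter_prod +oo%R +oo%R --> (0 : R) &
          forall T T' : R, 0 <= T -> T < T' ->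
            (ereal_sup [set payoff f0 T T' p | p in Omega A U f] <= (omega (T, T'))%:E)%E] |
      exists omega : R -> R,
      [/\ {within [set s : R | 0 <= s], continuous omega},
          forall T : R, 0 <= T -> 0 <= omega T,
          omega @ +oo%R --> (0 : R) &
          forall T : R, 0 <= T ->
            (ereal_sup
               [set ereal_sup [set payoff f0 T T' p | p in Omega A U f]
               | T' in [set T' | (T < T')%R]] <= (omega T)%:E)%E]] ->
  forall e : R, 0 < e -> exists2 T0 : R, 0 < T0 &
    forall p, Omega A U f p -> forall T T' : R, T0 <= T -> T < T' -> (payoff f0 T T' p <= e%:E)%E.
Proof.
have from_bound e (M : R) :
    (forall T T' : R, M < T -> 0 < T -> T < T' ->
      (ereal_sup [set payoff f0 T T' p | p in Omega A U f] <= e%:E)%E) ->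
    exists2 T0 : R, 0 < T0 & forall p, Omega A U f p ->
      forall T T' : R, T0 <= T -> T < T' -> (payoff f0 T T' p <= e%:E)%E.
  move=> MP; exists (Num.max M 0 + 1); first by rewrite ltr_wpDl // le_max lexx orbT.
  move=> p Op T T' MT TT'.
  have MT1 : Num.max M 0 < T by apply: lt_le_trans MT; rewrite ltrDl.
  move: MT1; rewrite gt_max => /andP[MT1 T0].
  by apply: le_trans (MP T T' MT1 T0 TT'); apply: ereal_sup_ubound; exists p.
case=> [sup0|[omega [_ _ om0 omP]]|[omega [_ _ om0 omP]]] e e0.
- have : (limf_esup (fun T : R =>
         ereal_sup [set ereal_sup [set payoff f0 T T' p | p in Omega A U f]
                   | T' in [set T' | (T < T')%R]]) +oo%R < e%:E)%E.
    by apply: le_lt_trans sup0 _; rewrite lte_fin.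
  rewrite limf_esupE => /ereal_inf_lt[_ [V [M [_ MV]] <-] Ve].
  apply: (from_bound _ M) => T T' MT _ TT'; apply: le_trans (ltW Ve).
  apply: le_trans (ereal_sup_ubound _); last by exists T; [exact: MV|reflexivity].
  by apply: ereal_sup_ubound; exists T'.
- have /cvgrPdist_lt/(_ e e0)[[P P'] /= [[M [_ MP]] [M' [_ MP']]] PP'] := om0.
  apply: (from_bound _ (Num.max M M')) => T T' + T0 TT'; rewrite gt_max => /andP[MT MT'].
  apply: le_trans (omP T T' (ltW T0) TT') _; rewrite lee_fin ltW //.
  have := PP' (T, T') (conj (MP T MT) (MP' T' (lt_trans MT' TT'))).
  by rewrite /= sub0r normrN; apply: le_lt_trans; exact: ler_norm.
- have /cvgrPdist_lt/(_ e e0)[M [_ MP]] := om0.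
  apply: (from_bound _ M) => T T' MT T0 TT'.
  apply: (@le_trans _ _ (omega T)%:E).
    by apply: le_trans (omP T (ltW T0)); apply: ereal_sup_ubound; exists T'.
  rewrite lee_fin ltW //; have := MP T MT.
  by rewrite /= sub0r normrN; apply: le_lt_trans; exact: ler_norm.
Qed.

End payoff_structure.

(** These coefficients write c times one signed component as a linear combination of positive and
    negative parts, the form that [lower_closure] accepts. *)
Lemma sum_signed (R : realType) (O : finType) (c : R) (o : O) (x : bool * O -> R) :
  \sum_(i : bool * O) (if i.2 == o then (if i.1 then c else - c) else 0) * x i =
  c * (x (true, o) - x (false, o)).
Proof.
rewrite (eq_bigr (fun i : bool * O =>
   (fun b o' => (if o' == o then (if b then c else - c) else 0) * x (b, o')) i.1 i.2)); last by case.
rewrite -(pair_bigA _ (fun b o' => (if o' == o then (if b then c else - c) else 0) * x (b, o'))) /=.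
have one b : \sum_(o' : O) (if o' == o then (if b then c else - c) else 0) * x (b, o') =
    (if b then c else - c) * x (b, o).
  rewrite (bigD1 o) //= eqxx big1 ?addr0 // => o' /negPf ->; exact: mul0r.
rewrite (eq_bigr _ (fun b _ => one b)) big_bool /=; ring.
Qed.

(** * Lower closure for signed components *)

Section signed_lower_closure.
Context {d : measure_display} {T : measurableType d} {R : realType}.
Variable mu : {measure set T -> \bar R}.
Variables (Dl : nat -> set T) (O : finType) (z : nat -> O -> T -> R) (C : nat -> R) (P : pred O).
Hypotheses (mDl : forall l, measurable (Dl l)) (Dl_fin : forall l, (mu (Dl l) < +oo)%E)
  (mz : forall k o, measurable_fun setT (z k o))
  (zC : forall l k o, (\int[mu]_(x in Dl l) `|z k o x|%:E <= (C l)%:E)%E).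

Let part (b : bool) (y : R) : R := Num.max (if b then y else - y) 0.

Hypothesis UI : forall b o, b || P o -> forall l (e : R), 0 < e -> exists c : R, forall k,
  (\int[mu]_(x in Dl l `&` [set x | (c < part b (z k o x))%R]) (part b (z k o x))%:E <= e%:E)%E.

Let part_ge0 b y : 0 <= part b y. Proof. by rewrite /part le_max lexx orbT. Qed.

Let part_le b y : part b y <= `|y|.
Proof. by rewrite /part ge_max normr_ge0 andbT; case: b; rewrite ?ler_norm // -normrN ler_norm. Qed.

Let partB y : part true y - part false y = y.
Proof. by rewrite /part; case: (leP y 0); case: (leP (- y) 0) => ? ?; lra. Qed.

Let mpart b k o : measurable_fun setT (fun x => part b (z k o x)).
Proof.
apply: measurable_maxr => //; case: b; first exact: mz.
exact: measurableT_comp.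
Qed.

(** Positive and negative parts become separate components. Negative parts outside P may lose mass,
    which can only raise the limit: lower bounds pass for every component, upper bounds for those in
    P, where both parts are uniformly integrable. *)
Lemma signed_lower_closure : exists h : O -> T -> R,
  [/\ forall o, measurable_fun setT (h o),
      forall l o, mu.-integrable (Dl l) (EFin \o h o),
      forall l E o a K, measurable E -> E `<=` Dl l ->
        (forall k, (K <= k)%N -> a <= \int[mu]_(x in E) z k o x) -> a <= \int[mu]_(x in E) h o x,
      forall l E o a K, P o -> measurable E -> E `<=` Dl l ->
        (forall k, (K <= k)%N -> \int[mu]_(x in E) z k o x <= a) -> \int[mu]_(x in E) h o x <= a &
      forall l, {ae mu, forall x, Dl l x -> forall S : set (O -> R),
        convex_set_ffun S -> closed_set_ffun S ->
        (forall (M : nat) e, 0 < e -> exists K, forall k, (K <= k)%N ->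
          (forall o, `|z k o x| <= M%:R) ->
          exists2 b, S b & forall o, `|z k o x - b o| <= e) ->
        S (h ^~ x)}].
Proof.
pose v k (i : bool * O) x := part i.1 (z k i.2 x).
have mv k i : measurable_fun setT (v k i) by exact: mpart.
have v0 k i x : 0 <= v k i x by exact: part_ge0.
have vC l k i : (\int[mu]_(x in Dl l) (v k i x)%:E <= (C l)%:E)%E.
  apply: le_trans (zC l k i.2); apply: ge0_le_integral => //.
  - by move=> x _; rewrite lee_fin.
  - by apply/measurable_EFinP; exact: measurable_funTS.
  - by apply/measurable_EFinP; apply: measurable_funTS; exact: measurableT_comp.
  - by move=> x _; rewrite lee_fin part_le.
have [|w [mw w0 iw Lw Sw]] := @lower_closure _ _ _ mu Dl _ v C
   (fun i : bool * O => i.1 || P i.2) mDl Dl_fin mv v0 vC.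
  by move=> [b o] /= bo l e e0; exact: UI.
pose h o x := w (true, o) x - w (false, o) x.
have ivE l E k i : measurable E -> E `<=` Dl l -> mu.-integrable E (EFin \o v k i).
  move=> mE EDl; apply: (integrableS (mDl l) mE EDl); apply/integrableP; split.
    by apply/measurable_EFinP; exact: measurable_funTS.
  apply: (@le_lt_trans _ _ (C l)%:E); last exact: ltry.
  apply: le_trans (vC l k i); under eq_integral do rewrite /= ger0_norm ?v0 //.
  exact: lexx.
have zE k E o l : measurable E -> E `<=` Dl l -> \int[mu]_(x in E) z k o x =
    \int[mu]_(x in E) v k (true, o) x - \int[mu]_(x in E) v k (false, o) x.
  move=> mE EDl; rewrite -RintegralB //; try exact: (ivE l).
  by apply: eq_Rintegral => x _; rewrite /v /= partB.
have hE E o l : measurable E -> E `<=` Dl l -> \int[mu]_(x in E) h o x =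
    \int[mu]_(x in E) w (true, o) x - \int[mu]_(x in E) w (false, o) x.
  by move=> mE EDl; rewrite -RintegralB //; apply: (integrableS (mDl l) mE EDl).
exists h; split.
- by move=> o; apply: measurable_funB.
- by move=> l o; rewrite /h; apply: (@eq_integrable _ _ _ mu (Dl l) (mDl l)
    ((EFin \o w (true, o)) \- (EFin \o w (false, o)))%E _ _ (integrableB (mDl l) (iw l _) (iw l _))).
- move=> l E o a K mE EDl a_le; rewrite (hE _ _ _ mE EDl) -[leRHS]mul1r
    -(sum_signed 1 o (fun i => \int[mu]_(x in E) w i x)).
  apply: (Lw l E _ a K mE EDl) => [[b o']|k Kk] /=.
    by rewrite negb_or => /andP[/negPf -> _]; case: ifP => // _; rewrite oppr_le0.
  by rewrite (sum_signed 1 o (fun i => \int[mu]_(x in E) v k i x)) mul1r -(zE _ _ _ _ mE EDl); exact: a_le.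
- move=> l E o a K Po mE EDl a_ge; rewrite (hE _ _ _ mE EDl) -lerN2 -[leRHS]mulN1r
    -(sum_signed (-1) o (fun i => \int[mu]_(x in E) w i x)).
  apply: (Lw l E _ _ K mE EDl) => [[b o']|k Kk] /=.
    by rewrite negb_or => /andP[_]; case: eqP => // ->; rewrite Po.
  by rewrite (sum_signed (-1) o (fun i => \int[mu]_(x in E) v k i x)) mulN1r -(zE _ _ _ _ mE EDl) lerN2; exact: a_ge.
move=> l; apply: filterS (Sw l) => x Sx Dx S convS closS near_S.
pose S' : set (bool * O -> R) := [set u | S (fun o => u (true, o) - u (false, o))].
apply: (Sx Dx S').
- move=> u u' t Su Su' t0 t1; rewrite /S' /=.
  rewrite (_ : (fun o => _) = fun o => t * (u (true, o) - u (false, o)) +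
      (1 - t) * (u' (true, o) - u' (false, o))); first exact: convS.
  by apply/funext => o; ring.
- move=> u near_u; apply: closS => e e0.
  have [|b Sb ub] := near_u (e / 2); first by rewrite divr_gt0.
  exists (fun o => b (true, o) - b (false, o)) => // o.
  have := ub (true, o); have := ub (false, o); rewrite !ler_norml => /andP[? ?] /andP[? ?].
  by apply/andP; split; lra.
- move=> M e e0; have [K KP] := near_S M e e0; exists K => k Kk vM.
  have [c|b Sb zb] := KP k Kk.
    have := vM (true, c); have := vM (false, c); rewrite /v /part /= !ge_max.
    by move=> /andP[? _] /andP[? _]; rewrite ler_norml; apply/andP; split; lra.
  (* The whole correction goes into the positive slot, so that the difference of the two slots is
     exactly b; membership in [S'] does not require the slots to be nonnegative. *)
  exists (fun i => if i.1 then v k i x + (b i.2 - z k i.2 x) else v k i x).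
    rewrite /S' /= (_ : (fun o => _) = b) //; apply/funext => o.
    by rewrite /v /=; have := partB (z k o x); lra.
  move=> [[] o] /=; last by rewrite subrr normr0 ltW.
  by rewrite opprD addrA subrr sub0r opprB; exact: zb.
Qed.

End signed_lower_closure.

(** * Stability of the sets [Q] under convergence of the states *)

Section pointwise_closure.
Context {R : realType} {n m : nat}.
Variables (A : R -> set 'rV[R]_n) (U : R -> 'rV[R]_n -> set 'rV[R]_m)
  (f : R * ('rV[R]_n * 'rV[R]_m) -> 'rV[R]_n)
  (f0 : R * ('rV[R]_n * 'rV[R]_m) -> \bar R).
Variables (t : R) (X : 'rV[R]_n).
Hypotheses (convQ : convex_set
    (Q U f f0 t X : set (convex_lmodType (R^o * 'rV[R]_n)%type)))
  (QE : Q U f f0 t X = \bigcap_(d in [set d : R | 0 < d])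
      closure (\bigcup_(chi' in A t `&` ball X d) Q U f f0 t chi')).

Definition rates_point (b : option 'I_n -> R) : R^o * 'rV[R]_n :=
  (b None, \row_j b (Some j)).

Let S : set (option 'I_n -> R) := [set b | Q U f f0 t X (rates_point b)].

Lemma rates_point_convex : convex_set_ffun S.
Proof.
move=> b b' s Sb Sb' s0 s1; rewrite /S /=.
have := convQ (Itv01 s0 s1) (mem_set Sb) (mem_set Sb'); rewrite inE; congr (Q U f f0 t X _).
by congr pair; apply/rowP => j; rewrite !mxE.
Qed.

Lemma rates_point_ball (b b' : option 'I_n -> R) (e : R) : 0 < e ->
  (forall c, `|b c - b' c| < e) -> ball (rates_point b) e (rates_point b').
Proof.
move=> e0 bb'; split; first exact: bb'.
by split => // i j; rewrite !mxE; exact: bb'.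
Qed.

Lemma rates_point_closed : closed_set_ffun S.
Proof.
move=> b near_b; rewrite /S /= QE => d d0 B /nbhs_ballP[e /= e0 eB].
have e2 : 0 < e / 2 by rewrite divr_gt0.
have [|b' Sb' bb'] := near_b (e / 4); first by rewrite divr_gt0.
move: Sb'; rewrite /S /= QE => /(_ d d0); apply.
apply/nbhs_ballP; exists (e / 2) => //= z b'z; apply: eB; rewrite [e]splitr.
apply: ball_triangle b'z; apply: rates_point_ball => // c.
by apply: le_lt_trans (bb' c) _; rewrite ltr_pM2l // ltf_pV2 ?posrE // ltr_nat.
Qed.

Variables (chi : nat -> 'rV[R]_n) (ups : nat -> 'rV[R]_m) (r : nat -> option 'I_n -> R).
Hypotheses (chiX : chi k @[k --> \oo] --> X) (Achi : forall k, A t (chi k))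
  (Uups : forall k, U t (chi k) (ups k))
  (r0 : forall k, ((r k None)%:E <= f0 (t, (chi k, ups k)))%E)
  (rf : forall k j, r k (Some j) = f (t, (chi k, ups k)) 0 j).

(** Rates bounded by M lie in a compact box. If infinitely many of them stayed away from [Q] at X,
    they would have a cluster point; it lies in the closure of the union of the [Q] over every ball
    around X, hence in [Q] at X by [QE], a contradiction. *)
Lemma rates_point_near (M : nat) (e : R) : 0 < e -> exists K, forall k, (K <= k)%N ->
  (forall c, `|r k c| <= M%:R) -> exists2 b, S b & forall c, `|r k c - b c| <= e.
Proof.
move=> e0; apply: contrapT => far.
pose bad : set nat := [set k | (forall c, `|r k c| <= M%:R) /\
  forall b, S b -> exists c, e < `|r k c - b c|].
have bad_often K : exists2 k, (K <= k)%N & bad k.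
  apply: contrapT => nbad; apply: far; exists K => k Kk rM; apply: contrapT => nb.
  apply: nbad; exists k => //; split=> // b Sb; apply: contrapT => nc; apply: nb; exists b => // c.
  by rewrite leNgt; apply/negP => ec; apply: nc; exists c.
(* The trace of the tails on [bad] plays the role of a subsequence. *)
pose F : set_system nat := within bad \oo.
have FF : ProperFilter F.
  split; last exact: within_filter.
  move=> [K _ KP]; have [k Kk bk] := bad_often K; exact: (KP k Kk bk).
pose z k := rates_point (r k).
pose box : set (R^o * 'rV[R]_n) := `[- M%:R, M%:R]%classic `*` [set v | `|v| <= M%:R].
have cbox : compact box.
  apply: compact_setX; first exact: segment_compact.
  apply: bounded_closed_compact.
    by exists M%:R; split; [exact: num_real|move=> c Mc v vM; exact: le_trans vM (ltW Mc)].
  rewrite (_ : [set _ | _] = (fun v : 'rV[R]_n => `|v|) @^-1` [set c | c <= M%:R]) //.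
  by apply: closed_comp; [move=> v _; exact: norm_continuous|exact: closed_le].
have [|q [_ cq]] := cbox (z @ F) _.
  exists 0%N => // k _ [rM _]; split=> /=.
    by rewrite in_itv /=; have := rM None; rewrite ler_norml.
  by apply: norm_rV_le => // j; rewrite mxE; exact: rM.
have q_near N K : nbhs q N -> exists2 k, (K <= k)%N & bad k /\ N (z k).
  move=> nN; have [] := cq (z @` [set k | (K <= k)%N /\ bad k]) N _ nN.
    by exists K => // k Kk bk; exists k.
  by move=> _ [[k [Kk bk] <-] Nk]; exists k.
have Qq : Q U f f0 t X q.
  rewrite QE => d /= d0 B nB.
  have [K _ KP] : \forall k \near \oo, ball X d (chi k) by exact: cvg_ball.
  have [k Kk [_ Bk]] := q_near B K nB.
  exists (z k); split => //; exists (chi k); first by split; [exact: Achi|exact: KP].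
  by exists (ups k) => //; split; [exact: r0|apply/rowP => j; rewrite mxE rf].
pose b c := if c is Some j then q.2 0 j else q.1.
have zb : rates_point b = q.
  by case: q @b {cq q_near Qq} => q1 q2; congr pair; apply/rowP => j; rewrite mxE.
have [k _ [[_ bk] [/= q1 q2]]] := q_near _ 0%N (nbhsx_ballx q _ e0).
have [|[j|]] := bk b; first by rewrite /S /= zb.
  have [_ /(_ 0 j)] := q2; rewrite mxE /b /= distrC => h1 h2.
  by have := lt_trans h1 h2; rewrite ltxx.
by move: q1; rewrite /ball /= /b distrC => h1 h2; have := lt_trans h1 h2; rewrite ltxx.
Qed.

End pointwise_closure.

Section limit_control.
Context {R : realType} {n m : nat}.
Variables (A : R -> set 'rV[R]_n) (U : R -> 'rV[R]_n -> set 'rV[R]_m)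
  (f : R * ('rV[R]_n * 'rV[R]_m) -> 'rV[R]_n)
  (f0 : R * ('rV[R]_n * 'rV[R]_m) -> \bar R).
Hypothesis hdata : standing_conditions A U f f0.
Local Notation LT := (lebesgue_type R).
Local Notation BU := (borel_type 'rV[R]_m).
Variables (X : R -> 'rV[R]_n) (g : R -> R) (h : 'I_n -> R -> R).
Hypotheses (acX : locally_abs_continuous X) (mg : measurable_fun setT (g : LT -> R))
  (mh : forall j, measurable_fun setT (h j : LT -> R)).

Let phi (p : LT * BU) : LT * borel_type ('rV[R]_n * 'rV[R]_m)%type :=
  (p.1, (X (Num.max p.1 0), p.2)).

Let mphi : measurable_fun setT phi.
Proof.
have [q dq] := dense_rV R n; have [q' dq'] := dense_rV R m.
apply: measurable_fun_pair; first exact: measurable_fst.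
apply: (@measurable_borel_pair _ (LT * BU)%type R _ _ q q' setT
  (fun p => X (Num.max p.1 0)) snd dq dq' measurableT); last exact: measurable_snd.
apply: (@measurable_rV _ (LT * BU)%type R n setT (fun p => X (Num.max p.1 0)) measurableT) => j.
exact: (measurableT_comp (lac_clip_measurable (lac_coord j acX)) measurable_fst).
Qed.

Let D : set (LT * BU) := phi @^-1` graphU A U.

Let E : set (LT * BU) := (D `&` [set p | ((g p.1)%:E <= f0 (phi p))%E]) `&`
  \bigcap_(j in [set: 'I_n]) (D `&` [set p | ((f (phi p) 0 j)%:E = (h j p.1)%:E)]).

Let mD : measurable D.
Proof. by have [_ mU _ _ _] := hdata; have := mphi measurableT mU; rewrite setTI. Qed.

Let mE : measurable E.
Proof.
have [_ mU mf mf0 _] := hdata.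
have sD : phi @` D `<=` graphU A U by move=> _ [p Dp <-].
have mfst (c : R -> R) : measurable_fun setT (c : LT -> R) ->
    measurable_fun D (fun p : LT * BU => (c p.1)%:E).
  move=> mc; apply/measurable_EFinP; apply: measurable_funTS.
  exact: (measurableT_comp mc measurable_fst).
have mphiD : measurable_fun D phi by exact: measurable_funTS mphi.
apply: measurableI.
  apply: (measurable_lee mD); first exact: mfst.
  exact: (measurable_comp mU sD mf0 mphiD).
apply: fin_bigcap_measurable; first exact: finite_finset.
move=> j _; apply: (measurable_eqe mD); last exact: mfst.
apply/measurable_EFinP.
exact: (@measurable_rV_coord _ (LT * BU)%type R n D _ j (measurable_comp mU sD mf mphiD)).
Qed.

Lemma limit_control :
  {ae leb R, forall t : R, 0 <= t -> Q U f f0 t (X t) (g t, \row_j h j t) /\ A t (X t)} ->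
  exists u : R -> 'rV[R]_m,
    measurable_fun (`[0%R, +oo[%classic : set LT) (u : LT -> BU) /\
    {ae leb R, forall t : R, 0 <= t -> [/\ A t (X t), U t (X t) (u t),
      ((g t)%:E <= f0 (t, (X t, u t)))%E & f (t, (X t, u t)) = \row_j h j t]}.
Proof.
move=> QX; pose Dl (l : nat) := (`[0%R, l%:R]%classic : set LT).
have EP (t : R) v : 0 <= t -> E (t, v) <-> [/\ A t (X t), U t (X t) v,
      ((g t)%:E <= f0 (t, (X t, v)))%E & f (t, (X t, v)) = \row_j h j t].
  move=> t0; rewrite /E /D /phi /=; split.
    move=> [[/= [[_ At] Ut] gt] ft]; move: At Ut gt ft; rewrite /= max_l // => At Ut gt ft.
    by split=> //; apply/rowP => j; rewrite mxE; have [_ /=] := ft j Logic.I; rewrite max_l // => -[].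
  by move=> [At Ut gt ft]; split; [|move=> j _]; split => //=; rewrite /= max_l // ft mxE.
have [|u [mu uE]] := @measurable_selection _ LT R m (leb R) E mE Dl
    (fun l => leb_measurable_itv _) (fun l => leb_itv_lty _).
  apply: filterS QX => t Qt [l _ lt]; have t0 : 0 <= t by move: lt; rewrite /Dl /= in_itv => /andP[].
  have [[v Uv [gv fv]] At] := Qt t0; exists v; apply/(EP t v t0).
  by split => //; rewrite -fv.
exists u; split; first exact: measurable_funTS.
apply: filterS uE => t Et t0; apply/(EP t (u t) t0); apply: Et; exists (Num.truncn t).+1 => //.
by rewrite /Dl /= in_itv /= t0 ltW // truncnS_gt.
Qed.

End limit_control.

Lemma tail_integral_le {d : measure_display} {T : measurableType d} {R : realType}
    (mu : {measure set T -> \bar R}) (D : set T) (v : T -> R) (w : T -> \bar R) (c : R) :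
  measurable D -> measurable_fun D v -> measurable_fun D w ->
  (forall x, D x -> 0 <= v x) -> (forall x, D x -> ((v x)%:E <= w x)%E) ->
  (\int[mu]_(x in D `&` [set x | (c < v x)%R]) (v x)%:E <=
   \int[mu]_(x in D `&` [set x | (c%:E < w x)%E]) w x)%E.
Proof.
move=> mD mv mw v0 vw.
have mv' : measurable_fun D (fun x => (v x)%:E) by exact/measurable_EFinP.
have w0 x : D x -> (0 <= w x)%E.
  by move=> Dx; apply: le_trans (vw x Dx); rewrite lee_fin v0.
have mDv : measurable (D `&` [set x | (c < v x)%R]).
  exact: (measurable_lte mD (measurable_cst c%:E) mv').
have mDw : measurable (D `&` [set x | (c%:E < w x)%E]).
  exact: (measurable_lte mD (measurable_cst c%:E) mw).
apply: (@le_trans _ _ (\int[mu]_(x in D `&` [set x | (c < v x)%R]) w x)%E).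
  apply: ge0_le_integral => //.
  - by move=> x [Dx _]; rewrite lee_fin v0.
  - by apply: measurable_funS mv' => //; exact: subIsetl.
  - by apply: measurable_funS mw => //; exact: subIsetl.
  - by move=> x [Dx _]; exact: vw.
apply: ge0_subset_integral => //.
- by apply: measurable_funS mw => //; exact: subIsetl.
- by move=> x [Dx _]; exact: w0.
- move=> x [Dx cv]; split=> //=; apply: lt_le_trans (vw x Dx); rewrite lte_fin; exact: cv.
Qed.

Lemma neg_part_le (R : realDomainType) (a C : R) (P N : \bar R) :
  (0 <= P)%E -> (P <= C%:E)%E -> (a%:E <= P - N)%E -> (N <= (Num.max (C - a) 0)%:E)%E.
Proof.
move: P N => [P| |] [N| |] //= _; rewrite ?leye_eq ?leeNy_eq ?leNye //.
by rewrite -EFinB !lee_fin => PC aPN; rewrite le_max; apply/orP; left; lra.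
Qed.

Lemma le_integral_ae {d : measure_display} {T : measurableType d} {R : realType}
    (mu : {measure set T -> \bar R}) (D : set T) (g1 g2 : T -> \bar R) :
  measurable D -> measurable_fun D g1 -> measurable_fun D g2 ->
  {ae mu, forall x, D x -> (g1 x <= g2 x)%E} ->
  (\int[mu]_(x in D) g1 x <= \int[mu]_(x in D) g2 x)%E.
Proof.
move=> mD m1 m2 g12; rewrite integralE [leRHS]integralE; apply: leeB.
  apply: ae_ge0_le_integral => //; try exact: measurable_funepos.
  by apply: filterS g12 => x h Dx; rewrite !funeposE ge_max !le_max lexx orbT andbT h.
apply: ae_ge0_le_integral => //; try exact: measurable_funeneg.
apply: filterS g12 => x h Dx; rewrite !funenegE ge_max !le_max lexx orbT andbT.
by rewrite leeN2 h.
Qed.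

(** * Sequences of admissible processes with payoffs bounded below *)

Section process_sequence.
Context {R : realType} {n m : nat}.
Variables (A : R -> set 'rV[R]_n) (U : R -> 'rV[R]_n -> set 'rV[R]_m)
  (f : R * ('rV[R]_n * 'rV[R]_m) -> 'rV[R]_n)
  (f0 : R * ('rV[R]_n * 'rV[R]_m) -> \bar R).
Hypothesis hdata : standing_conditions A U f f0.
Local Notation LT := (lebesgue_type R).
Local Notation halfline := (`[0%R, +oo[%classic : set LT).
Local Notation seg T := (`[0%R, T]%classic : set LT).
Local Notation process := ((R -> 'rV[R]_n) * (R -> 'rV[R]_m))%type.

Variables (p : nat -> process) (a T1 : R).
Hypotheses (Op : forall k, Omega A U f (p k))
  (UIf : forall T e : R, 0 < T -> 0 < e -> exists2 c : R, 0 < c & forall k,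
    (\int[leb R]_(t in seg T `&` [set t | (c%:E < `|rhs f (p k) t|%:E)%E]) `|rhs f (p k) t|%:E
       <= e%:E)%E)
  (UIg : forall T e : R, 0 < T -> 0 < e -> exists2 c : R, 0 < c & forall k,
    (\int[leb R]_(t in seg T `&` [set t | (c%:E < ((payoff_rate f0 (p k)) ^\+)%E t)%E])
       ((payoff_rate f0 (p k)) ^\+)%E t <= e%:E)%E)
  (payoff_ge : forall k T, T1 <= T -> (a%:E <= payoff f0 0 T (p k))%E).

(** Velocity coordinates and payoff rate form one vector, [None] being the payoff rate. [fine]
    replaces infinite rates by 0, which by [rate_fin] concerns a null set of times only. *)
Definition rates k (c : option 'I_n) : R -> R :=
  (if c is Some j then fun t => rhs f (p k) t 0 j else fun t => fine (payoff_rate f0 (p k) t))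
    \_ halfline.

Lemma seg_halfline T : seg T `<=` halfline.
Proof. by move=> t; rewrite /= !in_itv /= andbT => /andP[]. Qed.

Lemma measurable_seg T : measurable (seg T).
Proof. exact: leb_measurable_itv. Qed.

Lemma rates_measurable k c : measurable_fun setT (rates k c : LT -> R).
Proof.
have [mh mg] := process_measurable hdata (Op k).
apply: (proj1 (@measurable_restrictT _ _ LT R halfline _ (measurable_halfline (R := R)))).
case: c => [j|]; first exact: mh.
apply: (@measurable_comp _ _ _ _ _ _ setT _ _ (payoff_rate f0 (p k) : LT -> \bar R)) => //.
Qed.

Lemma rates_seg k c t T : seg T t ->
  rates k c t = if c is Some j then rhs f (p k) t 0 j else fine (payoff_rate f0 (p k) t).
Proof. by move=> /seg_halfline Ht; rewrite /rates patchE mem_set //; case: c. Qed.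

Lemma rhs_norm_measurable k T : measurable_fun (seg T) (fun t => `|rhs f (p k) t|).
Proof.
have [mh _] := process_measurable hdata (Op k).
apply: (measurable_sub_halfline (measurable_seg T) (@seg_halfline T)).
have mr := @measurable_rV _ LT R n halfline (rhs f (p k)) (measurable_halfline (R := R)) mh.
apply: (@measurableT_comp _ _ _ _ _ _ (fun v : borel_type 'rV[R]_n => `|v|) _ _ _ mr).
by apply: measurable_continuous_borel; exact: norm_continuous.
Qed.

Lemma rate_measurable k T : measurable_fun (seg T) (payoff_rate f0 (p k)).
Proof. exact: (rate_measurable_itv hdata (lexx 0) (Op k)). Qed.

Lemma rhs_integral_bound T : 0 < T -> exists2 C : R, 0 <= C & forall k,
  (\int[leb R]_(t in seg T) `|rhs f (p k) t|%:E <= C%:E)%E.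
Proof.
move=> T0; have [c c0 cP] := UIf T0 ltr01.
exists (c * fine (leb R (seg T)) + 1).
  by rewrite addr_ge0 ?ler01 ?mulr_ge0 ?(ltW c0) ?fine_ge0.
move=> k; apply: (@integral_le_tail _ LT R (leb R) (seg T) (fun t => `|rhs f (p k) t|%:E) c 1).
- exact: measurable_seg.
- exact: leb_itv_lty.
- by apply/measurable_EFinP; exact: rhs_norm_measurable.
- by move=> t _; rewrite lee_fin.
- exact: ltW.
- exact: cP.
Qed.

Lemma rate_pos_integral_bound T : 0 < T -> exists2 C : R, 0 <= C & forall k,
  (\int[leb R]_(t in seg T) ((payoff_rate f0 (p k)) ^\+)%E t <= C%:E)%E.
Proof.
move=> T0; have [c c0 cP] := UIg T0 ltr01.
exists (c * fine (leb R (seg T)) + 1).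
  by rewrite addr_ge0 ?ler01 ?mulr_ge0 ?(ltW c0) ?fine_ge0.
move=> k; apply: (@integral_le_tail _ LT R (leb R) (seg T) ((payoff_rate f0 (p k)) ^\+)%E c 1).
- exact: measurable_seg.
- exact: leb_itv_lty.
- by apply: measurable_funepos; exact: rate_measurable.
- by [].
- exact: ltW.
- exact: cP.
Qed.

(** The payoff is at least a and its positive part at most C, so the negative part is at most C - a.
    The lower bound on payoffs holds from [T1] on, hence the passage to the larger horizon [T']. *)
Lemma rate_neg_integral_bound T : 0 < T -> exists2 C : R, 0 <= C & forall k,
  (\int[leb R]_(t in seg T) ((payoff_rate f0 (p k)) ^\-)%E t <= C%:E)%E.
Proof.
move=> T0; pose T' := Num.max T T1; have T'0 : 0 < T' by rewrite lt_max T0.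
have [C C0 CP] := rate_pos_integral_bound T'0.
exists (Num.max (C - a) 0); first by rewrite le_max lexx orbT.
move=> k; apply: (@le_trans _ _ (\int[leb R]_(t in seg T') ((payoff_rate f0 (p k)) ^\-)%E t)%E).
  apply: ge0_subset_integral.
  - exact: measurable_seg.
  - exact: measurable_seg.
  - by apply: measurable_funeneg; exact: rate_measurable.
  - by [].
  - by apply: subset_itvl; rewrite bnd_simp le_max lexx.
have := payoff_ge k (_ : T1 <= T'); rewrite le_max lexx orbT => /(_ isT).
rewrite /payoff integralE => aPN; apply: (neg_part_le _ (CP k) aPN).
by apply: integral_ge0 => t _; exact: funepos_ge0.
Qed.

Lemma rate_integrable k T : 0 < T -> (leb R).-integrable (seg T) (payoff_rate f0 (p k)).
Proof.
move=> T0; have [C _ CP] := rate_pos_integral_bound T0.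
have [D _ DP] := rate_neg_integral_bound T0.
have mr := @rate_measurable k T; have ms := measurable_seg T.
apply/integrableP; split => //.
rewrite (_ : (fun t => _) = abse \o payoff_rate f0 (p k)) // fune_abse ge0_integralD //; last 2 first.
- exact: measurable_funepos.
- exact: measurable_funeneg.
by rewrite lte_add_pinfty // ?(le_lt_trans (CP k) (ltry _)) ?(le_lt_trans (DP k) (ltry _)).
Qed.

Lemma rate_fin : {ae leb R, forall t : R, forall k, 0 <= t -> payoff_rate f0 (p k) t \is a fin_num}.
Proof.
apply: ae_foralln => k.
have : {ae leb R, forall t : R, forall l : nat, seg l.+1%:R t -> payoff_rate f0 (p k) t \is a fin_num}.
  by apply: ae_foralln => l; apply: integrable_ae; [exact: measurable_seg|exact: rate_integrable].
apply: filterS => t tl t0; apply: (tl (Num.truncn t)).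
by rewrite /= in_itv /= t0 ltW // truncnS_gt.
Qed.

Lemma rates_integrable k c T : 0 < T -> (leb R).-integrable (seg T) (EFin \o rates k c).
Proof.
move=> T0; have ms := measurable_seg T.
have mr : measurable_fun (seg T) (EFin \o rates k c).
  by apply/measurable_EFinP; apply: measurable_funTS; exact: rates_measurable.
case: c mr => [j|] mr.
  have [C _ CP] := rhs_integral_bound T0.
  apply/integrableP; split => //; apply: le_lt_trans (ltry C); apply: le_trans (CP k).
  apply: (@ge0_le_integral _ LT R (leb R) (seg T) ms).
  - by move=> t _; exact: abse_ge0.
  - exact: (measurableT_comp (@abse_measurable R setT) mr).
  - by apply/measurable_EFinP; exact: rhs_norm_measurable.
  - by move=> t st; rewrite /= (rates_seg _ _ st) lee_fin norm_coord_le.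
apply: le_integrable (rate_integrable k T0) => // t st.
rewrite /= (rates_seg _ _ st); case: (payoff_rate f0 (p k) t) => [r| |] /=; rewrite ?normr0 ?leey ?lexx //.
Qed.

Lemma payoff_rates k T : 0 < T -> payoff f0 0 T (p k) = (\int[leb R]_(t in seg T) rates k None t)%:E.
Proof.
move=> T0; have ms := measurable_seg T.
rewrite /Rintegral fineK; last exact: (integrable_fin_num ms (rates_integrable k None T0)).
apply: ae_eq_integral.
- exact: ms.
- exact: rate_measurable.
- exact: measurable_int (rates_integrable k None T0).
apply: filterS rate_fin => t tfin st.
have t0 : 0 <= t by move: (seg_halfline st); rewrite /= in_itv /= andbT.
by rewrite (rates_seg _ _ st) fineK //; exact: tfin.
Qed.

Lemma state_coord k j t : 0 <= t ->
  (p k).1 t 0 j - (p k).1 0 0 j = \int[leb R]_(s in seg t) rates k (Some j) s.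
Proof.
move=> t0; have := Op k; case Epk: (p k) => [x u] [acx _ adm].
apply: (@ac_ftc R (fun t => x t 0 j) (rates k (Some j)) (lac_coord j acx)
  (rates_measurable k (Some j)) (rates_integrable k (Some j)) _ t t0).
apply: filterS adm => s adms s0; have [_ _ ds] := adms s0.
rewrite /rates patchE mem_set /= ?in_itv /= ?s0 //.
by rewrite /rhs Epk; exact: is_derive_coord.
Qed.

Lemma rates_increment k j s t : 0 <= s -> s <= t ->
  (`|\int[leb R]_(r in seg t) rates k (Some j) r - \int[leb R]_(r in seg s) rates k (Some j) r|%:E
    <= \int[leb R]_(r in (`[s, t]%classic : set LT)) `|rhs f (p k) r|%:E)%E.
Proof.
move=> s0 st; have t0 : 0 < t + 1 by rewrite ltr_wpDl // (le_trans s0).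
have it := rates_integrable k (Some j) t0.
have sub : (`]s, t]%classic : set R) `<=` `[0, t + 1]%classic.
  by move=> r; rewrite /= !in_itv /= => /andP[sr rt]; apply/andP; split; lra.
have sub' : (`[s, t]%classic : set R) `<=` `[0, t + 1]%classic.
  by move=> r; rewrite /= !in_itv /= => /andP[sr rt]; apply/andP; split; lra.
have mst : measurable (`]s, t]%classic : set LT) by exact: leb_measurable_itv.
have mst' : measurable (`[s, t]%classic : set LT) by exact: leb_measurable_itv.
have segE : seg t = seg s `|` (`]s, t]%classic : set LT).
  by rewrite -itv_bndbnd_setU ?bnd_simp.
have ist : (leb R).-integrable (`]s, t]%classic : set LT) (EFin \o rates k (Some j)).
  exact: (integrableS (measurable_seg (t + 1)) mst sub it).
have mr : measurable_fun (seg (t + 1)) (fun r => `|rhs f (p k) r|%:E).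
  by apply/measurable_EFinP; exact: rhs_norm_measurable.
rewrite segE Rintegral_setU; last 4 first.
- exact: measurable_seg.
- exact: mst.
- rewrite -segE; apply: (integrableS (measurable_seg (t + 1)) (measurable_seg t) _ it).
  by apply: subset_itvl; rewrite bnd_simp lerDl.
- apply/disj_setPS => r [] /=; rewrite !in_itv /= => /andP[_ rs] /andP[sr _].
  by have := lt_le_trans sr rs; rewrite ltxx.
rewrite addrAC subrr add0r.
apply: (@le_trans _ _ (\int[leb R]_(r in (`]s, t]%classic : set LT)) `|rhs f (p k) r|%:E)%E).
  rewrite -abse_EFin /Rintegral fineK; last exact: (integrable_fin_num mst ist).
  apply: le_trans (le_abse_integral _ mst _) _; first exact: (measurable_int _ ist).
  apply: (@ge0_le_integral _ LT R (leb R) _ mst).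
  - by move=> r _; exact: abse_ge0.
  - exact: (measurableT_comp (@abse_measurable R setT) (measurable_int _ ist)).
  - exact: (measurable_funS (measurable_seg _) sub mr).
  - by move=> r /sub sr; rewrite (rates_seg _ _ sr) abse_EFin lee_fin norm_coord_le.
apply: ge0_subset_integral.
- exact: mst.
- exact: mst'.
- exact: (measurable_funS (measurable_seg _) sub' mr).
- by move=> r _; rewrite lee_fin.
- by apply: subset_itvr; rewrite bnd_simp.
Qed.

Lemma state_equicontinuous T e : 0 < T -> 0 < e -> exists2 d, 0 < d & forall k s t,
  0 <= s -> s <= T -> 0 <= t -> t <= T -> `|t - s| < d -> `|(p k).1 t - (p k).1 s| <= e.
Proof.
move=> T0 e0; have e2 : 0 < e / 2 by rewrite divr_gt0.
have [c c0 cP] := UIf T0 e2.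
(* On an interval shorter than this, the velocities below c contribute at most [e / 2] to the
   increment, and those above c at most [e / 2] by the choice of c. *)
exists (e / 2 / c); first by rewrite divr_gt0.
move=> k s t; wlog st : s t / s <= t.
  move=> W s0 sT t0 tT ts; have [/W|/ltW/W] := leP s t; first exact.
  by rewrite -(distrC ((p k).1 t)); apply => //; rewrite distrC.
move=> s0 sT t0 tT; rewrite ger0_norm ?subr_ge0 // => tsd.
have mst : measurable (`[s, t]%classic : set LT) by exact: leb_measurable_itv.
have sub : (`[s, t]%classic : set R) `<=` `[0, T]%classic.
  by move=> r; rewrite /= !in_itv /= => /andP[sr rt]; apply/andP; split; lra.
have mr : measurable_fun (seg T) (fun r => `|rhs f (p k) r|%:E).
  by apply/measurable_EFinP; exact: rhs_norm_measurable.
have lst : leb R (`[s, t]%classic : set R) = (t - s)%:E.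
  rewrite lebE lebesgue_measure_itv /= lte_fin; case: ltP => // ts.
  by rewrite (le_anti (introT andP (conj st ts))) subrr.
apply: norm_rV_le => [|j]; first exact: ltW.
rewrite !mxE -lee_fin.
rewrite (_ : _ - _ = \int[leb R]_(r in seg t) rates k (Some j) r - \int[leb R]_(r in seg s) rates k (Some j) r); last first.
  by rewrite -!state_coord // opprB addrA subrK.
apply: le_trans (rates_increment k j s0 st) _.
apply: (@le_trans _ _ (c * fine (leb R (`[s, t]%classic : set R)) + e / 2)%:E).
  apply: (@integral_le_tail _ LT R (leb R) _ (fun r => `|rhs f (p k) r|%:E) c (e / 2)).
  - exact: mst.
  - by rewrite lst ltry.
  - exact: (measurable_funS (measurable_seg _) sub mr).
  - by move=> r _; rewrite lee_fin.
  - exact: ltW.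
  apply: le_trans (cP k); apply: ge0_subset_integral.
  - apply: (measurable_lte mst (measurable_cst c%:E)).
    exact: (measurable_funS (measurable_seg _) sub mr).
  - exact: (measurable_lte (measurable_seg T) (measurable_cst c%:E)).
  - by apply: (measurable_funS (measurable_seg _) _ mr); exact: subIsetl.
  - by move=> r _; rewrite lee_fin.
  - by move=> r [/sub].
rewrite lst /= lee_fin; move: tsd; rewrite ltr_pdivlMr //; lra.
Qed.

Lemma state_bounded B : (forall k, `|(p k).1 0| <= B) ->
  exists C : R -> R, forall k t, 0 <= t -> `|(p k).1 t| <= C t.
Proof.
move=> x0B; have /choice[C CP] t : exists C, 0 <= t -> forall k, `|(p k).1 t| <= C.
  have [t0|_] := leP 0 t; last by exists 0.
  have [|C C0 CP] := @rhs_integral_bound (t + 1); first by rewrite ltr_wpDl.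
  exists (B + C) => _ k.
  rewrite -[X in `|X|](subrK ((p k).1 0)) addrC; apply: le_trans (ler_normD _ _) _.
  apply: lerD => //; apply: norm_rV_le => // j; rewrite !mxE -lee_fin state_coord //.
  have := rates_increment k j (lexx 0) t0; rewrite -(state_coord k j (lexx 0)) subrr subr0.
  move=> h; apply: le_trans h _; apply: le_trans (CP k); apply: ge0_subset_integral.
  - exact: measurable_seg.
  - exact: measurable_seg.
  - by apply/measurable_EFinP; exact: rhs_norm_measurable.
  - by move=> r _; rewrite lee_fin.
  - by apply: subset_itvl; rewrite bnd_simp lerDl.
by exists C => k t t0; exact: CP.
Qed.

Lemma rates_abs_le_rhs k j T t : seg T t -> `|rates k (Some j) t| <= `|rhs f (p k) t|.
Proof. by move=> st; rewrite (rates_seg _ _ st) norm_coord_le. Qed.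

Lemma rates_L1_bound T : 0 < T -> exists C : R, forall k c,
  (\int[leb R]_(t in seg T) `|rates k c t|%:E <= C%:E)%E.
Proof.
move=> T0; have ms := measurable_seg T.
have [C1 C10 C1P] := rhs_integral_bound T0.
have [C2 C20 C2P] := rate_pos_integral_bound T0.
have [C3 C30 C3P] := rate_neg_integral_bound T0.
have mr k c : measurable_fun (seg T) (fun t => `|rates k c t|%:E).
  apply/measurable_EFinP; apply: measurableT_comp => //.
  by apply: measurable_funTS; exact: rates_measurable.
exists (C1 + (C2 + C3)) => k [j|].
  apply: (@le_trans _ _ C1%:E); last by rewrite lee_fin lerDl addr_ge0.
  apply: le_trans (C1P k); apply: (@ge0_le_integral _ LT R (leb R) (seg T) ms).
  - by move=> t _; rewrite lee_fin.
  - exact: mr.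
  - by apply/measurable_EFinP; exact: rhs_norm_measurable.
  - by move=> t st; rewrite lee_fin (rates_abs_le_rhs _ _ st).
apply: (@le_trans _ _ (C2%:E + C3%:E)%E); last by rewrite lee_fin lerDr.
have mp := measurable_funepos (@rate_measurable k T).
have mn := measurable_funeneg (@rate_measurable k T).
apply: le_trans (leeD (C2P k) (C3P k)).
rewrite -(@ge0_integralD _ LT R (leb R) (seg T) ms); last 4 first.
- by move=> t _; exact: funepos_ge0.
- exact: mp.
- by move=> t _; exact: funeneg_ge0.
- exact: mn.
apply: (@ge0_le_integral _ LT R (leb R) (seg T) ms).
- by move=> t _; rewrite lee_fin.
- exact: mr.
- exact: emeasurable_funD.
move=> t st; rewrite (rates_seg _ _ st) -[leRHS](_ : (`|payoff_rate f0 (p k) t| = _)%E).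
  by case: (payoff_rate f0 (p k) t) => [r| |] /=; rewrite ?normr0 ?leey ?lexx.
by have /(congr1 (@^~ t)) := fune_abse (payoff_rate f0 (p k)).
Qed.

Lemma rates_tail b c T e : b || isSome c -> 0 < T -> 0 < e -> exists M : R, forall k,
  (\int[leb R]_(t in seg T `&`
       [set t | (M < Num.max (if b then rates k c t else - rates k c t) 0)%R])
     (Num.max (if b then rates k c t else - rates k c t) 0)%:E <= e%:E)%E.
Proof.
move=> bc T0 e0; have ms := measurable_seg T.
have mr k : measurable_fun (seg T)
    (fun t => Num.max (if b then rates k c t else - rates k c t) 0).
  have mc : measurable_fun (seg T) (rates k c) by apply: measurable_funTS; exact: rates_measurable.
  apply: measurable_maxr; last exact: measurable_cst.
  by case: (b); [exact: mc|exact: (measurableT_comp (@oppr_measurable R setT) mc)].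
have r0 k t : seg T t -> 0 <= Num.max (if b then rates k c t else - rates k c t) 0.
  by rewrite le_max lexx orbT.
case: c bc mr r0 => [j|] bc mr r0.
  have [M _ MP] := UIf T0 e0; exists M => k; apply: le_trans (MP k).
  apply: (@tail_integral_le _ LT R (leb R) (seg T) _ (fun t => `|rhs f (p k) t|%:E) M ms).
  - exact: mr.
  - by apply/measurable_EFinP; exact: rhs_norm_measurable.
  - exact: r0.
  move=> t st; rewrite lee_fin; apply: le_trans (rates_abs_le_rhs _ _ st).
  rewrite ge_max normr_ge0 andbT; case: (b); first exact: ler_norm.
  by rewrite -normrN ler_norm.
move: bc mr r0; rewrite orbF => -> mr r0.
have [M _ MP] := UIg T0 e0; exists M => k; apply: le_trans (MP k).
apply: (@tail_integral_le _ LT R (leb R) (seg T) _ ((payoff_rate f0 (p k)) ^\+)%E M ms).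
- exact: mr.
- by apply: measurable_funepos; exact: rate_measurable.
- exact: r0.
move=> t st; rewrite (rates_seg _ _ st) funeposE.
case: (payoff_rate f0 (p k) t) => [r| |] /=; first by rewrite EFin_max lexx.
  by rewrite maxxx le_max leey.
by rewrite maxxx le_max lexx orbT.
Qed.

Lemma rates_lower_closure : exists h : option 'I_n -> R -> R,
  [/\ forall c, measurable_fun setT (h c : LT -> R),
      forall c T, 0 < T -> (leb R).-integrable (seg T) (EFin \o h c),
      forall c T b K, 0 < T -> (forall k, (K <= k)%N -> b <= \int[leb R]_(t in seg T) rates k c t) ->
        b <= \int[leb R]_(t in seg T) h c t,
      forall j T b K, 0 < T ->
        (forall k, (K <= k)%N -> \int[leb R]_(t in seg T) rates k (Some j) t <= b) ->
        \int[leb R]_(t in seg T) h (Some j) t <= b &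
      {ae leb R, forall t : R, 0 <= t -> forall S : set (option 'I_n -> R),
        convex_set_ffun S -> closed_set_ffun S ->
        (forall (M : nat) e, 0 < e -> exists K, forall k, (K <= k)%N ->
          (forall c, `|rates k c t| <= M%:R) ->
          exists2 b, S b & forall c, `|rates k c t - b c| <= e) ->
        S (h ^~ t)}].
Proof.
pose Dl l := seg (l.+1%:R : R).
have l0 l : 0 < l.+1%:R :> R by [].
have /choice[C CP] l : exists C : R, forall k c,
    (\int[leb R]_(t in Dl l) `|rates k c t|%:E <= C%:E)%E.
  exact: rates_L1_bound.
have seg_Dl T : seg T `<=` Dl (Num.truncn T).
  by apply: subset_itvl; rewrite bnd_simp ltW // truncnS_gt.
have [|h [mh ih lb ub Sh]] := @signed_lower_closure _ LT R (leb R) Dl _ rates C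
    (fun c : option 'I_n => isSome c) (fun l => measurable_seg _) (fun l => leb_itv_lty _)
    rates_measurable CP.
  by move=> b c bc l e e0; exact: rates_tail.
exists h; split => //.
- move=> c T T0; exact: (integrableS (measurable_seg _) (measurable_seg _) (@seg_Dl T) (ih _ c)).
- by move=> c T b K T0; exact: (lb _ _ _ _ _ (measurable_seg _) (@seg_Dl T)).
- by move=> j T b K T0; exact: (ub _ _ _ _ _ _ (measurable_seg _) (@seg_Dl T)).
have : {ae leb R, forall t, forall l, Dl l t -> forall S : set (option 'I_n -> R),
    convex_set_ffun S -> closed_set_ffun S ->
    (forall (M : nat) e, 0 < e -> exists K, forall k, (K <= k)%N ->
      (forall c, `|rates k c t| <= M%:R) ->
      exists2 b, S b & forall c, `|rates k c t - b c| <= e) ->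
    S (h ^~ t)} by exact: ae_foralln.
apply: filterS => t Sht t0; apply: (Sht (Num.truncn t)); apply: seg_Dl.
by rewrite /= in_itv /= t0 lexx.
Qed.

Section limit_process.
Variable y : R -> 'rV[R]_n.
Hypotheses (yP : forall t, 0 <= t -> (p k).1 t @[k --> \oo] --> y t)
  (h6 : forall t : R, 0 <= t -> closed (A t))
  (h9 : forall (t : R) (chi : 'rV[R]_n), graphA A (t, chi) ->
      convex_set (Q U f f0 t chi : set (convex_lmodType (R^o * 'rV[R]_n)%type)))
  (h10 : forall (t : R) (chi : 'rV[R]_n), graphA A (t, chi) ->
      Q U f f0 t chi = \bigcap_(d in [set d : R | 0 < d])
        closure (\bigcup_(chi' in A t `&` ball chi d) Q U f f0 t chi')).
Variable h : option 'I_n -> R -> R.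
Hypotheses (mh : forall c, measurable_fun setT (h c : LT -> R))
  (ih : forall c T, 0 < T -> (leb R).-integrable (seg T) (EFin \o h c))
  (hlb : forall c T b K, 0 < T ->
    (forall k, (K <= k)%N -> b <= \int[leb R]_(t in seg T) rates k c t) ->
    b <= \int[leb R]_(t in seg T) h c t)
  (hub : forall j T b K, 0 < T ->
    (forall k, (K <= k)%N -> \int[leb R]_(t in seg T) rates k (Some j) t <= b) ->
    \int[leb R]_(t in seg T) h (Some j) t <= b)
  (hS : {ae leb R, forall t : R, 0 <= t -> forall S : set (option 'I_n -> R),
    convex_set_ffun S -> closed_set_ffun S ->
    (forall (M : nat) e, 0 < e -> exists K, forall k, (K <= k)%N ->
      (forall c, `|rates k c t| <= M%:R) ->
      exists2 b, S b & forall c, `|rates k c t - b c| <= e) ->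
    S (h ^~ t)}).

(** The pointwise limit y is controlled on the half-line only. Written as a primitive, the state has
    its absolute continuity and its derivative from the general theory. *)
Definition limit_state (t : R) : 'rV[R]_n := \row_j (y 0 0 j + primitive (h (Some j)) t).

(** For velocity components both [hlb] and [hub] hold, so the convergent integrals of the velocities
    have the integral of [h] as their limit. *)
Lemma limit_stateE t : 0 <= t -> limit_state t = y t.
Proof.
move=> t0; apply/rowP => j; rewrite mxE.
have ycoord s : 0 <= s -> (p k).1 s 0 j @[k --> \oo] --> y s 0 j.
  move=> s0; exact: (@continuous_cvg nat 'rV[R]_n R \oo _ (fun k => (p k).1 s) (fun v => v 0 j) (y s) (@continuous_coord_rV R n j (y s)) (yP s0)).
have [->|tn0] := eqVneq t 0; first by rewrite (primitive0 (mh _) (ih (Some j))) addr0.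
have {tn0}t_gt0 : 0 < t by rewrite lt_def tn0.
have cI : \int[leb R]_(s in seg t) rates k (Some j) s @[k --> \oo] --> y t 0 j - y 0 0 j.
  rewrite (_ : (fun k => _) = fun k => (p k).1 t 0 j - (p k).1 0 0 j).
    by apply: cvgB; exact: ycoord.
  by apply/funext => k; rewrite -state_coord.
suff -> : primitive (h (Some j)) t = y t 0 j - y 0 0 j by rewrite addrC subrK.
apply/eqP; rewrite eq_le; apply/andP; split; apply/ler_addgt0Pr => e e0.
  have /cvgrPdist_le/(_ e e0)[K _ KP] := cI; apply: (hub (K := K) t_gt0) => k Kk.
  by have := KP k Kk; rewrite /= ler_norml => /andP[]; lra.
rewrite -lerBlDr; have /cvgrPdist_le/(_ e e0)[K _ KP] := cI; apply: (hlb (K := K) t_gt0) => k Kk.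
by have := KP k Kk; rewrite /= ler_norml => /andP[]; lra.
Qed.

Lemma limit_state_ac : locally_abs_continuous limit_state.
Proof.
apply: lac_rV => j a' b' a0 ab e e0.
have [d d0 dP] := leb_primitive_ac (mh (Some j)) (ih (Some j)) a0 ab e0; exists d => //.
move=> k s r sr tr sd; apply: le_lt_trans (dP k s r sr tr sd).
by apply: ler_sum => i _; rewrite !mxE opprD addrACA subrr add0r.
Qed.

Lemma limit_state_derive :
  {ae leb R, forall t : R, 0 <= t -> is_derive t (1 : R) limit_state (\row_j h (Some j) t)}.
Proof.
have n0 : {ae leb R, forall s : R, s <> 0}.
  apply: negligibleS (leb_set1 (0 : R)) => s /= /contrapT; exact.
have dh : {ae leb R, forall t : R, forall j, 0 < t ->
    is_derive t (1 : R) (primitive (h (Some j))) (h (Some j) t)}.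
  by apply: filter_forall => j; exact: (leb_primitive_derive (mh (Some j)) (ih (Some j))).
move: n0 dh; apply: filterS2 => t tn0 dt t0; apply: is_derive_rV => j; rewrite mxE.
have t_gt0 : 0 < t by rewrite lt_def t0 andbT; apply/eqP.
rewrite (_ : (fun s => _) = cst (y 0 0 j) + primitive (h (Some j))).
  by have := is_deriveD (is_derive_cst (y 0 0 j) t 1) (dt j t_gt0); rewrite add0r.
by apply/funext => s; rewrite mxE.
Qed.

Lemma limit_in_Q : {ae leb R, forall t : R, 0 <= t ->
  Q U f f0 t (limit_state t) (h None t, \row_j h (Some j) t) /\ A t (limit_state t)}.
Proof.
have adm : {ae leb R, forall t : R, forall k, 0 <= t ->
    A t ((p k).1 t) /\ U t ((p k).1 t) ((p k).2 t)}.
  apply: ae_foralln => k; have := Op k; case: (p k) => x u [_ _].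
  by apply: filterS => t h' t0; have [] := h' t0.
move: adm rate_fin hS; apply: filterS3 => t admt tfin hSt t0.
have cX : (p k).1 t @[k --> \oo] --> limit_state t by rewrite limit_stateE //; exact: yP.
have AX : A t (limit_state t).
  apply: (closed_cvg _ (h6 t0) _ _ cX); apply: nearW => k; exact: (admt k t0).1.
have gX : graphA A (t, limit_state t) by [].
split=> //; have convQ := h9 gX; have QE := h10 gX.
have st : seg t t by rewrite /= in_itv /= t0 lexx.
apply: (hSt t0 [set b | Q U f f0 t (limit_state t) (rates_point b)]).
- exact: rates_point_convex.
- exact: rates_point_closed QE.
move=> M e e0; apply: (rates_point_near QE cX (ups := fun k => (p k).2 t)) => //.
- by move=> k; exact: (admt k t0).1.
- by move=> k; exact: (admt k t0).2.
- by move=> k; rewrite (rates_seg _ _ st) fineK //; exact: tfin.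
- by move=> k j; rewrite (rates_seg _ _ st).
Qed.

(** The bound passes through the integral of [h None]: [hlb] places that integral above b, and the
    selected control has a rate of at least [h None]. *)
Lemma limit_process : exists p', Omega A U f p' /\
  forall T b K, 0 < T -> (forall k, (K <= k)%N -> (b%:E <= payoff f0 0 T (p k))%E) ->
    (b%:E <= payoff f0 0 T p')%E.
Proof.
have [u [mu adm]] := limit_control hdata limit_state_ac (mh None) (fun j => mh (Some j)) limit_in_Q.
have Op' : Omega A U f (limit_state, u).
  split=> //; first exact: limit_state_ac.
  move: adm limit_state_derive; apply: filterS2 => t at' dt t0.
  by have [At Ut _ ft] := at' t0; split => //; rewrite ft; exact: dt.
exists (limit_state, u); split => // T b K T0 bP.
have ms := measurable_seg T.
apply: (@le_trans _ _ (\int[leb R]_(t in seg T) (h None t)%:E)%E).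
  rewrite -[leRHS]fineK; last exact: (integrable_fin_num ms (ih None T0)).
  rewrite lee_fin; apply: (hlb (K := K) T0) => k Kk.
  by rewrite -lee_fin -payoff_rates //; exact: bP.
apply: (@le_integral_ae _ LT R (leb R) (seg T)).
- exact: ms.
- exact: (measurable_int _ (ih None T0)).
- exact: (rate_measurable_itv hdata (lexx 0) Op').
apply: filterS adm => t at' st; have [|_ _ le_gf0 _] := at'; last exact: le_gf0.
by move: (seg_halfline st); rewrite /= in_itv /= andbT.
Qed.

End limit_process.

End process_sequence.

Lemma maximizing_sequence {R : realType} {n m : nat}
    (A : R -> set 'rV[R]_n) (U : R -> 'rV[R]_n -> set 'rV[R]_m)
    (f : R * ('rV[R]_n * 'rV[R]_m) -> 'rV[R]_n)
    (f0 : R * ('rV[R]_n * 'rV[R]_m) -> \bar R) (alpha C : R) :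
  Omega_ge A U f f0 alpha !=set0 -> (forall p, Omega A U f p -> J_exists f0 p) ->
  (forall p, Omega A U f p -> (J f0 p <= C%:E)%E) ->
  exists S : R, ereal_sup [set J f0 p | p in Omega A U f] = S%:E /\
    exists p, forall k, Omega_ge A U f f0 alpha (p k) /\
      ((S - k.+1%:R^-1)%:E <= J f0 (p k))%E.
Proof.
move=> [p0 [Op0 Jp0 ap0]] JE JC; set SJ := ereal_sup _.
have JS p : Omega A U f p -> (J f0 p <= SJ)%E.
  by move=> Op; apply: ereal_sup_ubound; exists p.
have SC : (SJ <= C%:E)%E by apply: ge_ereal_sup => _ [p Op <-]; exact: JC.
have aS := le_trans ap0 (JS p0 Op0).
have Sfin : SJ \is a fin_num.
  by rewrite fin_numElt (lt_le_trans (ltNyr _) aS) (le_lt_trans SC (ltry _)).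
exists (fine SJ); rewrite fineK //; split => //.
have /choice[p pP] k : exists p, Omega_ge A U f f0 alpha p /\
    ((fine SJ - k.+1%:R^-1)%:E <= J f0 p)%E; last by exists p.
have k0 : 0 < k.+1%:R^-1 :> R by rewrite invr_gt0.
have [_ [p Op <-]] := ub_ereal_sup_adherent k0 Sfin; rewrite -/SJ => Sp.
have {}Sp : ((fine SJ - k.+1%:R^-1)%:E <= J f0 p)%E by rewrite EFinB fineK // ltW.
(* A process with payoff below alpha is replaced by [p0], whose payoff is at least alpha and hence
   even larger. *)
have [ap|pa] := leP (alpha%:E) (J f0 p); first by exists p; split => //; split => //; exact: JE.
by exists p0; split => //; apply: le_trans Sp (le_trans (ltW pa) ap0).
Qed.

Theorem theorem1 (R : realType) (n m : nat)
    (A : R -> set 'rV[R]_n) (U : R -> 'rV[R]_n -> set 'rV[R]_m)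
    (f : R * ('rV[R]_n * 'rV[R]_m) -> 'rV[R]_n)
    (f0 : R * ('rV[R]_n * 'rV[R]_m) -> \bar R)
    (hdata : standing_conditions A U f f0)
    (alpha : R)
    (hne : Omega_ge A U f f0 alpha !=set0)
    (h4 : forall t : R, 0 <= t ->
      {within sliceU A U t, continuous (fun q => f (t, q))})
    (h5 : forall t : R, 0 <= t ->
      upper_semicontinuous_on (sliceU A U t) (fun q => f0 (t, q)))
    (h6 : forall t : R, 0 <= t -> closed (A t) /\ closed (sliceU A U t))
    (h7 : bounded_set [set p.1 0 | p in Omega_ge A U f f0 alpha])
    (h8 : forall T : R, 0 < T ->
      uniformly_integrable (fun v : 'rV[R]_n => `|v|%:E) T
        [set rhs f p | p in Omega_ge A U f f0 alpha])
    (h9 : forall (t : R) (chi : 'rV[R]_n), graphA A (t, chi) ->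
      convex_set
        (Q U f f0 t chi : set (convex_lmodType (R^o * 'rV[R]_n)%type)))
    (h10 : forall (t : R) (chi : 'rV[R]_n), graphA A (t, chi) ->
      Q U f f0 t chi =
      \bigcap_(d in [set d : R | 0 < d])
        closure (\bigcup_(chi' in A t `&` ball chi d) Q U f f0 t chi'))
    (h11 : forall T : R, 0 < T ->
      uniformly_integrable (@abse R) T
        [set ((payoff_rate f0 p) ^\+)%E | p in Omega A U f])
    (h12 :
      [\/ (limf_esup (fun T : R =>
             ereal_sup [set ereal_sup [set payoff f0 T T' p | p in Omega A U f]
                       | T' in [set T' | (T < T')%R]]) +oo%R <= 0)%E,
          exists omega : R * R -> R,
          [/\ {within [set s : R * R | 0 <= s.1 /\ 0 <= s.2],
                continuous omega},
              forall T T' : R, 0 <= T -> 0 <= T' -> 0 <= omega (T, T'),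
              omega @ filter_prod +oo%R +oo%R --> (0 : R) &
              forall T T' : R, 0 <= T -> T < T' ->
                (ereal_sup [set payoff f0 T T' p | p in Omega A U f]
                   <= (omega (T, T'))%:E)%E] |
          exists omega : R -> R,
          [/\ {within [set s : R | 0 <= s], continuous omega},
              forall T : R, 0 <= T -> 0 <= omega T,
              omega @ +oo%R --> (0 : R) &
              forall T : R, 0 <= T ->
                (ereal_sup
                   [set ereal_sup [set payoff f0 T T' p | p in Omega A U f]
                   | T' in [set T' | (T < T')%R]]
                   <= (omega T)%:E)%E]]) :
  exists x_ u_,
    [/\ Omega A U f (x_, u_), J_exists f0 (x_, u_) &
        J f0 (x_, u_) = ereal_sup [set J f0 p | p in Omega A U f]].
Proof.
have tail := @payoff_tailP _ _ _ A U f f0 h12.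
have JE := payoff_cvg hdata tail.
have JP := J_le_payoff hdata tail.
(* Beyond [T1] the payoff grows by at most 1. This bounds J from above by C + 1 over all admissible
   processes and, on [Omega_ge], the finite-horizon payoffs from below by alpha - 1. *)
have [T1 T1_gt0 T1P] := JP 1 ltr01.
have [C _ CP] := payoff_bound hdata h11 T1_gt0.
have [p' Op'|S [SE [p pP]]] := @maximizing_sequence _ _ _ A U f f0 alpha (C + 1) hne (@JE).
  by apply: le_trans (T1P p' Op' T1 (lexx _)) _; rewrite EFinD leeD2r // CP.
have Oalpha k : Omega_ge A U f f0 alpha (p k) by case: (pP k).
have Op k : Omega A U f (p k) by case: (Oalpha k).
pose UI (w : nat -> R -> \bar R) := forall T e : R, 0 < T -> 0 < e ->
  exists2 c : R, 0 < c & forall k,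
    (\int[leb R]_(t in (`[0%R, T]%classic : set (lebesgue_type R)) `&`
      [set t | (c%:E < w k t)%E]) w k t <= e%:E)%E.
have pUIf : UI (fun k t => `|rhs f (p k) t|%:E).
  move=> T e T0 e0; have [c c0 cP] := uniformly_integrable_le (h8 T T0) e0.
  by exists c => // k; exact: (cP _ (ex_intro2 _ _ (p k) (Oalpha k) erefl)).
have pUIg : UI (fun k => ((payoff_rate f0 (p k)) ^\+)%E).
  move=> T e T0 e0; have [c c0 cP] := rate_pos_tail h11 T0 e0.
  by exists c => // k; exact: cP.
have payoff_ge k T : T1 <= T -> ((alpha - 1)%:E <= payoff f0 0 T (p k))%E.
  move=> T1T; rewrite EFinB leeBlDr //; case: (Oalpha k) => _ _ /le_trans; apply.
  exact: T1P.
have [B x0B] : exists B, forall k, `|(p k).1 0| <= B.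
  have [M [_ MP]] := h7; exists (M + 1) => k.
  by apply: (MP (M + 1)); [rewrite ltrDl|exists (p k)].
have [bound xbound] := state_bounded hdata Op pUIf pUIg payoff_ge x0B.
have equi := state_equicontinuous hdata Op pUIf pUIg payoff_ge.
have [sigma [y [sigma_ge yP]]] := pointwise_subsequence xbound equi.
pose q k := p (sigma k).
have UI_sub w : UI w -> UI (w \o sigma).
  by move=> UIw T e T0 e0; have [c c0 cP] := UIw T e T0 e0; exists c => // k; exact: cP.
have qUIf := UI_sub _ pUIf; have qUIg := UI_sub _ pUIg.
have Oq k : Omega A U f (q k) by exact: Op.
have qge k T := payoff_ge (sigma k) T.
have [h [mh ih hlb hub hS]] := rates_lower_closure hdata Oq qUIf qUIg qge.
have [[x u] [Oxu xuP]] := limit_process hdata Oq qUIf qUIg qge yP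
  (fun t t0 => (h6 t t0).1) h9 h10 mh ih hlb hub hS.
exists x, u; split => //; first exact: JE.
apply/eqP; rewrite eq_le; apply/andP; split; first by apply: ereal_sup_ubound; exists (x, u).
rewrite SE; apply/lee_addgt0Pr => e e0; have e2 : 0 < e / 2 by rewrite divr_gt0.
(* One half of e pays for the payoff after [T0], the other for the distance of J from the supremum
   along the sequence, which is at most 1 / (sigma k + 1) and thus small because sigma k >= k. *)
have [T0 T0_gt0 T0P] := JP _ e2.
have [K _ KP] := near_infty_natSinv_lt (PosNum e2).
rewrite -leeBlDr // -EFinB; apply: lime_ge; first exact: JE.
exists T0; split; first exact: num_real.
move=> T /ltW T0T; apply: (xuP _ _ K); first exact: lt_le_trans T0_gt0 T0T.
move=> k Kk; have [_ Sk] := pP (sigma k).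
have := le_trans Sk (T0P _ (Oq k) _ T0T); rewrite -leeBlDr // -EFinB; apply: le_trans.
have : (sigma k).+1%:R^-1 < e / 2 by exact: KP (leq_trans Kk (sigma_ge k)).
by rewrite lee_fin [in leLHS](splitr e) opprD addrA lerD2r lerD2l lerN2 => /ltW.
Qed.
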